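(* Consider the double sample split estimators $\hat\psi^{\mathrm{INT}}_{k_1,k_2}$, $\hat\psi^{\mathrm{MC}}_{k_1,k_2}$, $\hat\psi^{\mathrm{IF}}_{k_1,k_2}$ of $\psi(\mathbb P)=\mathbb E_{\mathbb P}[\mathrm{Cov}_{\mathbb P}(A,Y\mid X)]$ over $\mathcal P_{(\alpha,\beta)}$ defined in the context. If $\frac{\alpha+\beta}2\ge\frac d4$, then (1) $\hat\psi^{\mathrm{INT}}_{k_1,k_2}$ is minimax rate optimal when choosing $n^{\frac{d}{2\alpha+2\beta}}\lesssim k_1\wedge k_2\lesssim n$; (2) $\hat\psi^{\mathrm{MC}}_{k_1,k_2}$ is minimax rate optimal when choosing $n^{\frac{d}{2\alpha+2\beta}}\lesssim k_\ell\lesssim n$ for $\ell=1,2$; (3) $\hat\psi^{\mathrm{IF}}_{k_1,k_2}$ is minimax rate optimal when choosing $n^{\frac{d}{2\alpha+2\beta}}\lesssim k_1\vee k_2\lesssim n$. If $\frac{\alpha+\beta}2<\frac d4$, then (1) $\hat\psi^{\mathrm{INT}}_{k_1,k_2}$ is minimax rate optimal when choosing $k_1\wedge k_2\asymp n^{\frac{2d}{2\alpha+2\beta+d}}$; (2) $\hat\psi^{\mathrm{MC}}_{k_1,k_2}$ cannot be minimax rate optimal for any choice of $k_1,k_2$; the best rate of estimation of $\psi(\mathbb P)$ for $\hat\psi^{\mathrm{MC}}_{k_1,k_2}$ is $n^{-\frac{3\alpha+3\beta}{\alpha+\beta+d}}$, which occurs when choosing $k_\ell\asymp n^{\frac{3d}{2\alpha+2\beta+2d}}$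 for $\ell=1,2$; (3) $\hat\psi^{\mathrm{IF}}_{k_1,k_2}$ is minimax rate optimal when choosing $k_1\vee k_2\asymp n^{\frac{2d}{2\alpha+2\beta+d}}$ and $k_1\wedge k_2\lesssim n$.
   Context: Notation. $a\vee b=\max(a,b)$, $a\wedge b=\min(a,b)$; integrals are over $[0,1]^d$. For nonnegative sequences, $a_n\lesssim b_n$ means there is a constant $C>0$ with $a_n\le Cb_n$ for all $n\ge n_0$; $a_n\gtrsim b_n$ means $b_n\lesssim a_n$; $a_n\asymp b_n$ means both. Resolutions $k_1,k_2$ are sequences that may depend on $n$. Wavelets. Fix a compactly supported Cohen–Daubechies–Vial type orthonormal wavelet basis $\{\Phi_{J_0m},\Psi^{\iota}_{lm'}: m\in\mathcal Z_{J_0},\,m'\in\mathcal Z_l,\,\iota\in\{0,1\}^d\setminus\{0\},\,l\ge J_0\}$ of $L^2([0,1]^d)$ of regularity $S\ge1$, $S>\alpha\vee\beta$, with $2^{J_0}\ge S$, $|\mathcal Z_l|\asymp 2^{ld}$. For $j\ge J_0$ let $V_j=\mathrm{span}\{\Phi_{jm}:m\in\mathcal Z_j\}$ ($\{\Phi_{jm}\}_m$ the orthonormal scaling functions at level $j$; the $V_j$ are nested). A resolution is a number $k=2^{jd}$, $j\ge J_0$; write $V_k,\Phi_{km},\mathcal Z_k$ for $V_j,\Phi_{jm},\mathcal Z_j$. Standard properties: $|\Phi_{km}|\lesssim\sqrt k$ uniformly with support in a set of Lebesgue measure $O(1/k)$; $V_k$ contains all polynomials of degree at most $S-1$. The projection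 kernel is $K_{V_k}(x,y)=\sum_{m\in\mathcal Z_k}\Phi_{km}(x)\Phi_{km}(y)$. Hölder ball. $H(\alpha,M)$ is the set of uniformly continuous $h:[0,1]^d\to\mathbb R$ with $2^{J_0(\alpha+d/2)}\max_m|\langle h,\Phi_{J_0m}\rangle|+\sup_{l\ge J_0,m\in\mathcal Z_l,\iota}2^{l(\alpha+d/2)}|\langle h,\Psi^\iota_{lm}\rangle|\le M$. Model. $\mathcal P_{(\alpha,\beta)}$ is the set of distributions $\mathbb P$ of $(X,A,Y)\in[0,1]^d\times\mathbb R\times\mathbb R$ with $X\sim\mathrm{Uniform}([0,1]^d)$, $A,Y\in[C_1,C_2]$ a.s., $p(x):=\mathbb E_{\mathbb P}[A\mid X=x]\in H(\alpha,M)$ and $b(x):=\mathbb E_{\mathbb P}[Y\mid X=x]\in H(\beta,M)$, where $C_1,C_2\in\mathbb R$, $\alpha,\beta,M>0$ are fixed known constants. The functional is $\psi(\mathbb P)=\mathbb E_{\mathbb P}[\mathrm{Cov}_{\mathbb P}(A,Y\mid X)]$. Estimators. I.i.d. observations from $\mathbb P$ are split into disjoint subsamples $\mathcal D_1,\mathcal D_2,\dots$, each of size $n$. Put $\hat p^{(j)}_k(x)=\frac1n\sum_{i\in\mathcal D_j}A_iK_{V_k}(X_i,x)$ and $\hat b^{(j)}_k(x)=\frac1n\sum_{i\in\mathcal D_j}Y_iK_{V_k}(X_i,x)$. With double sample splitting: $\hat\psi^{\mathrm{INT}}_{k_1,k_2}=\frac1n\sum_{i\in\mathcal D_3}A_iY_i-\int\hat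 p^{(1)}_{k_1}(x)\hat b^{(2)}_{k_2}(x)\,dx$; $\hat\psi^{\mathrm{MC}}_{k_1,k_2}=\frac1n\sum_{i\in\mathcal D_3}A_iY_i-\frac1n\sum_{i\in\mathcal D_4}\hat p^{(1)}_{k_1}(X_i)\hat b^{(2)}_{k_2}(X_i)$; $\hat\psi^{\mathrm{IF}}_{k_1,k_2}=\frac1n\sum_{i\in\mathcal D_3}(A_i-\hat p^{(1)}_{k_1}(X_i))(Y_i-\hat b^{(2)}_{k_2}(X_i))$. Rates. The (known) minimax rate for squared error over $\mathcal P_{(\alpha,\beta)}$ is $r_n^*=n^{-1}$ if $\frac{\alpha+\beta}2\ge\frac d4$ and $r_n^*=n^{-\frac{4\alpha+4\beta}{2\alpha+2\beta+d}}$ if $\frac{\alpha+\beta}2<\frac d4$. For an estimator $\hat\psi$ with given resolution sequences let $R_n=\sup_{\mathbb P\in\mathcal P_{(\alpha,\beta)}}\mathbb E_{\mathbb P}[(\hat\psi-\psi(\mathbb P))^2]$. The estimator is minimax rate optimal for a choice of resolutions if $R_n\lesssim r_n^*$. Its best rate is $r_n$ if some choice of resolutions gives $R_n\lesssim r_n$ while every choice gives $R_n\gtrsim r_n$; the best rate ''occurs when choosing'' certain resolutions if these give $R_n\lesssim r_n$.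
   Formalization: That the MC estimator cannot be minimax rate optimal, and that its best rate is as stated, is proved assuming C_1 < C_2 and that the class is nonempty for some radius M' < M; without this it can fail (e.g. C_1 = C_2 = 0 gives zero risk). *)

(* Defs.v *)
From HB Require Import structures.
From mathcomp Require Import all_boot all_order all_algebra.
From mathcomp Require Import all_classical all_reals all_analysis.

Set Implicit Arguments.
Unset Strict Implicit.
Unset Printing Implicit Defensive.
Import Order.TTheory GRing.Theory Num.Theory.
Import numFieldNormedType.Exports.
Local Open Scope classical_set_scope.
Local Open Scope ring_scope.

Section PowerLaw.
Context d (T : measurableType d) (R : realType).

Definition tuple_cons n (x : T * n.-tuple T) : n.+1.-tuple T :=
  [the n.+1.-tuple T of x.1 :: x.2].

Lemma measurable_tuple_cons n : measurable_fun setT (@tuple_cons n).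
Proof. exact: measurable_cons. Qed.

HB.instance Definition _ n :=
  isMeasurableFun.Build _ _ _ _ (@tuple_cons n) (@measurable_tuple_cons n).

(* The n-fold product P x ... x P, i.e. the law of n i.i.d. draws from P. *)
Fixpoint iid (P : probability T R) (n : nat) : probability (n.-tuple T) R :=
  match n with
  | 0 => \d_ [tuple]
  | n'.+1 => distribution (P \x iid P n')%E (@tuple_cons n')
  end.

End PowerLaw.

Lemma measurable_box d (T : measurableType d) n (B : 'I_n -> set T) :
  (forall i, measurable (B i)) ->
  measurable [set t : n.-tuple T | forall i, B i (tnth t i)].
Proof.
move=> mB.
rewrite [X in measurable X](_ : _ =
  \bigcap_(i in [set: 'I_n]) ((fun t : n.-tuple T => tnth t i) @^-1` B i)).
  apply: fin_bigcap_measurable => // i _.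
  by rewrite -[X in measurable X]setTI; exact: measurable_tnth.
by apply/seteqP; split=> [t tB i _|t tB i]; [exact: tB|exact: tB].
Qed.

Lemma iid_box d (T : measurableType d) (R : realType) (P : probability T R)
    (n : nat) (B : 'I_n -> set T) : (forall i, measurable (B i)) ->
  iid P n [set t | forall i, B i (tnth t i)] = (\prod_(i < n) P (B i))%E.
Proof.
elim: n B => [|n IH] B mB.
  by rewrite big_ord0 /= diracE mem_set//; case.
rewrite big_ord_recl -IH /=; last by move=> i; exact: mB.
rewrite /distribution /pushforward -product_measure1E//=; last first.
  by apply: (measurable_box (B := fun i => B (lift ord0 i))) => i; exact: mB.
congr (_ _); apply/seteqP; split=> [[x t]/= xtB|[x t]/= [xB tB] i].
  split; first by have := xtB ord0.
  by move=> i; have := xtB (lift ord0 i); rewrite tnthS.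
by case: (unliftP ord0 i) => [j ->|->] //; rewrite tnthS.
Qed.

Section UnitInterval.
Variable R : realType.

(* The library's uniform law lives on measurableTypeR R, whose measurable
   structure is that of R under another display; idTR only changes the latter. *)
Definition idTR : measurableTypeR R -> R := idfun.

Lemma measurable_idTR : measurable_fun setT idTR.
Proof. exact: measurable_id. Qed.

HB.instance Definition _ :=
  isMeasurableFun.Build _ _ _ _ idTR measurable_idTR.

Definition unif01 : probability R R := distribution (uniform_prob (@ltr01 R)) idTR.

End UnitInterval.

Section Cube.
Variables (R : realType) (d : nat).

Definition cube : set (d.-tuple R) := [set x | forall i, 0 <= tnth x i <= 1].

(* Lebesgue measure on [0,1]^d, as the d-fold product of that on [0,1]. *)
Definition unif : probability (d.-tuple R) R := iid (unif01 R) d.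

Definition ip (f h : d.-tuple R -> R) : R := \int[unif]_(x in cube) (f x * h x).

Definition unif_continuous_on_cube (h : d.-tuple R -> R) :=
  forall eps : R, 0 < eps -> exists2 delta : R, 0 < delta &
    forall x y, cube x -> cube y -> (forall i, `|tnth x i - tnth y i| < delta) ->
      `|h x - h y| < eps.

End Cube.

(* Generators of a Cohen-Daubechies-Vial system on [0,1]. The boolean is false
   for scaling functions (fathers) and true for wavelets (mothers). Dyadic
   dilates and integer translates of the interior generators are completed by
   finitely many edge functions, at 0 and (after t |-> 1 - t) at 1. *)
Record cdv_generators (R : realType) := CDVGenerators {
  interior : bool -> R -> R;
  n_left : nat;
  n_right : nat;
  left_edge : bool -> nat -> R -> R;
  right_edge : bool -> nat -> R -> R
}.

Section Wavelets.
Variables (R : realType) (d : nat) (g : cdv_generators R).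

Definition cdv1 (e : bool) (j m : nat) (t : R) : R :=
  Num.sqrt (2 ^+ j) *
    (if (m < n_left g)%N then left_edge g e m (2 ^+ j * t)
     else if (m < 2 ^ j - n_right g)%N then interior g e (2 ^+ j * t - m%:R)
     else right_edge g e (2 ^ j - m).-1 (2 ^+ j * (1 - t))).

Definition Zidx (j : nat) : finType := {ffun 'I_d -> 'I_(2 ^ j)}.

Definition wav (io : {ffun 'I_d -> bool}) (j : nat) (m : Zidx j)
    (x : d.-tuple R) : R :=
  \prod_(i < d) cdv1 (io i) j (m i) (tnth x i).

Definition iota0 : {ffun 'I_d -> bool} := [ffun=> false].

Definition Phi (j : nat) (m : Zidx j) := wav iota0 m.

Definition in_V (j : nat) (f : d.-tuple R -> R) :=
  exists c : Zidx j -> R,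
    {ae unif R d, forall x, f x = \sum_(m : Zidx j) c m * Phi m x}.

Definition bounded_compact_support (f : R -> R) :=
  measurable_fun setT f /\
  exists A : R, forall t, `|f t| <= A /\ (A < `|t| -> f t = 0).

(* {Phi_{J0 m}, Psi^io_{l m} : l >= J0, io <> 0} is a compactly supported
   orthonormal wavelet basis of L^2([0,1]^d) of regularity S, of CDV type.
   Elements of L^2 are compared almost everywhere. Regularity S is the
   reproduction by every V_j of the polynomials of (total) degree at most S-1,
   equivalently the vanishing of the moments of the wavelets up to that order;
   no smoothness of the generators is required. *)
Record cdv_basis (S J0 : nat) : Prop := CDVBasis {
  cdv_interior : forall e, bounded_compact_support (interior g e);
  cdv_left : forall e k, (k < n_left g)%N ->
    bounded_compact_support (left_edge g e k);
  cdv_right : forall e k, (k < n_right g)%N ->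
    bounded_compact_support (right_edge g e k);
  cdv_orthonormal_Phi : forall j, (J0 <= j)%N -> forall m m' : Zidx j,
    ip (Phi m) (Phi m') = (m == m')%:R;
  cdv_orthogonal_Phi_Psi : forall l io, (J0 <= l)%N -> io != iota0 ->
    forall (m : Zidx J0) (m' : Zidx l), ip (Phi m) (wav io m') = 0;
  cdv_orthonormal_Psi : forall l l' io io',
    (J0 <= l)%N -> (J0 <= l')%N -> io != iota0 -> io' != iota0 ->
    forall (m : Zidx l) (m' : Zidx l'),
    ip (wav io m) (wav io' m') =
      [&& l == l', io == io' & [forall i, m i == m' i :> nat]]%:R;
  (* io = 0 gives the nestedness of the V_j, io <> 0 the wavelets *)
  cdv_nested : forall j io (m : Zidx j), (J0 <= j)%N -> in_V j.+1 (wav io m);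
  cdv_total : forall f, f \in Lfun (unif R d) 2%:E ->
    forall eps : R, 0 < eps ->
    exists (N : nat) (a : Zidx J0 -> R)
           (c : {ffun 'I_d -> bool} -> forall l, Zidx l -> R),
    let r x := f x - \sum_(m : Zidx J0) a m * Phi m x
      - \sum_(J0 <= l < N) \sum_(io | io != iota0) \sum_(m : Zidx l)
          c io l m * wav io m x in
    ip r r < eps;
  cdv_regular : forall j, (J0 <= j)%N -> forall a : {ffun 'I_d -> nat},
    (\sum_i a i < S)%N -> in_V j (fun x => \prod_i tnth x i ^+ a i)
}.

(* projection kernel on V_j, i.e. at resolution 2^(j d) *)
Definition kernel (j : nat) (x y : d.-tuple R) : R :=
  \sum_(m : Zidx j) Phi m x * Phi m y.

Definition hoelder_ball (J0 : nat) (a M : R) : set (d.-tuple R -> R) :=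
  [set h | unif_continuous_on_cube h /\
    ((2 `^ (J0%:R * (a + d%:R / 2)) *
        \big[Num.max/0]_(m : Zidx J0) `|ip h (Phi m)|)%:E +
     ereal_sup [set v | exists l io (m : Zidx l),
        [/\ (J0 <= l)%N, io != iota0 &
            v = (2 `^ (l%:R * (a + d%:R / 2)) * `|ip h (wav io m)|)%:E]]
     <= M%:E)%E].

End Wavelets.

Notation obs R d := (d.-tuple R * R * R)%type.

Section Model.
Variables (R : realType) (d : nat).

Definition X_ (o : obs R d) : d.-tuple R := o.1.1.
Definition A_ (o : obs R d) : R := o.1.2.
Definition Y_ (o : obs R d) : R := o.2.

Implicit Types P : probability (obs R d) R.

(* f is a version of x |-> E_P[W | X = x] *)
Definition is_cond_exp P (W : obs R d -> R) (f : d.-tuple R -> R) :=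
  [/\ measurable_fun setT f,
      P.-integrable setT (EFin \o W),
      P.-integrable setT (EFin \o (f \o X_)) &
      forall B, measurable B ->
        \int[P]_(o in X_ @^-1` B) W o = \int[P]_(o in X_ @^-1` B) f (X_ o)].

(* some version of E_P[W | X = .] (0 if there is none) *)
Definition cond_exp P (W : obs R d -> R) : d.-tuple R -> R :=
  xget (fun=> 0) [set f | is_cond_exp P W f].

Definition cond_cov P : d.-tuple R -> R :=
  cond_exp P (fun o => (A_ o - cond_exp P A_ (X_ o)) *
                       (Y_ o - cond_exp P Y_ (X_ o))).

Definition psi P : R := \int[P]_o cond_cov P (X_ o).

Definition model (g : cdv_generators R) (J0 : nat) (alpha beta C1 C2 M : R) :
    set (probability (obs R d) R) :=
  [set P : probability (obs R d) R | [/\ forall B, measurable B -> P (X_ @^-1` B) = unif R d B,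
      {ae P, forall o, C1 <= A_ o <= C2 /\ C1 <= Y_ o <= C2},
      exists2 p, hoelder_ball g J0 alpha M p & is_cond_exp P A_ p &
      exists2 b, hoelder_ball g J0 beta M b & is_cond_exp P Y_ b]].

(* Under C1 < C2 this says that the Hoelder constraint is not tight: some
   member satisfies it with a smaller radius. Automatic if C1 <= 0 <= C2. It
   excludes e.g. the empty class and classes on which psi vanishes. *)
Definition nondegenerate_class (g : cdv_generators R) (J0 : nat)
    (alpha beta C1 C2 M : R) :=
  C1 < C2 /\
  exists2 M' : R, M' < M & model g J0 alpha beta C1 C2 M' !=set0.

End Model.

Section Estimators.
Variables (R : realType) (d : nat) (g : cdv_generators R).

(* The subsamples D_1, ..., D_4 are the components 0, ..., 3. *)
Definition samples (n : nat) := 4.-tuple (n.-tuple (obs R d)).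

Definition series_est (W : obs R d -> R) (j n : nat) (D : n.-tuple (obs R d))
    (x : d.-tuple R) : R :=
  n%:R^-1 * \sum_(i < n) W (tnth D i) * kernel g j (X_ (tnth D i)) x.

Definition phat j n D := @series_est (@A_ R d) j n D.
Definition bhat j n D := @series_est (@Y_ R d) j n D.

Definition psi_INT (j1 j2 n : nat) (D : samples n) : R :=
  n%:R^-1 * \sum_(i < n) A_ (tnth [tnth D 2] i) * Y_ (tnth [tnth D 2] i)
  - \int[unif R d]_(x in @cube R d)
      (phat j1 [tnth D 0] x * bhat j2 [tnth D 1] x).

Definition psi_MC (j1 j2 n : nat) (D : samples n) : R :=
  n%:R^-1 * \sum_(i < n) A_ (tnth [tnth D 2] i) * Y_ (tnth [tnth D 2] i)
  - n%:R^-1 * \sum_(i < n) phat j1 [tnth D 0] (X_ (tnth [tnth D 3] i)) *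
                           bhat j2 [tnth D 1] (X_ (tnth [tnth D 3] i)).

Definition psi_IF (j1 j2 n : nat) (D : samples n) : R :=
  n%:R^-1 * \sum_(i < n)
    (A_ (tnth [tnth D 2] i) - phat j1 [tnth D 0] (X_ (tnth [tnth D 2] i))) *
    (Y_ (tnth [tnth D 2] i) - bhat j2 [tnth D 1] (X_ (tnth [tnth D 2] i))).

Definition estimator := forall j1 j2 n : nat, samples n -> R.

Definition worst_risk (J0 : nat) (alpha beta C1 C2 M : R) (est : estimator)
    (j1 j2 : nat -> nat) (n : nat) : \bar R :=
  ereal_sup [set 'E_(iid (iid P n) 4)
                    [fun D => ((est (j1 n) (j2 n) n D - psi P) ^+ 2)%R]%E
            | P in model g J0 alpha beta C1 C2 M].

End Estimators.

Section Rates.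
Variable R : realType.
Implicit Types a b : nat -> \bar R.

Definition lesssim a b :=
  exists2 C : R, 0 < C &
    exists n0 : nat, forall n, (n0 <= n)%N -> (a n <= C%:E * b n)%E.

Definition asymp a b := lesssim a b /\ lesssim b a.

Definition npow (r : R) : nat -> \bar R := fun n => (n%:R `^ r)%:E.

(* the resolutions 2^(j_n d) *)
Definition res (d : nat) (j : nat -> nat) : nat -> \bar R :=
  fun n => (2 ^+ (j n * d))%:E.

Definition mins a b : nat -> \bar R := fun n => Order.min (a n) (b n).
Definition maxs a b : nat -> \bar R := fun n => Order.max (a n) (b n).

Definition minimax_rate (d : nat) (alpha beta : R) : nat -> \bar R :=
  if d%:R / 4 <= (alpha + beta) / 2 then npow (- 1)
  else npow (- ((4 * alpha + 4 * beta) / (2 * alpha + 2 * beta + d%:R))).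

Definition levels (J0 : nat) (j : nat -> nat) := forall n, (J0 <= j n)%N.

(* risk j1 j2 n is the worst-case risk with resolutions 2^(j1_n d), 2^(j2_n d) *)
Definition best_rate (J0 : nat)
    (risk : (nat -> nat) -> (nat -> nat) -> nat -> \bar R) (r : nat -> \bar R) :=
  (exists j1 j2, [/\ levels J0 j1, levels J0 j2 & lesssim (risk j1 j2) r]) /\
  (forall j1 j2, levels J0 j1 -> levels J0 j2 -> lesssim r (risk j1 j2)).

End Rates.

(* Main.v *)
Require Import Defs.
From HB Require Import structures.
From mathcomp Require Import all_boot all_order all_algebra.
From mathcomp Require Import all_classical all_reals all_analysis.
From mathcomp Require Import measurable_realfun zify ring lra.

Import Order.TTheory GRing.Theory Num.Theory.
Import numFieldNormedType.Exports.
Local Open Scope classical_set_scope.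
Local Open Scope ring_scope.

Set Implicit Arguments.
Unset Strict Implicit.
Unset Printing Implicit Defensive.

(** Write [s] for [alpha + beta], [k] for a resolution (the dimension of the
    space [V_k]), [p] and [b] for the two regression functions and [Pi] for
    orthogonal projections on scaling spaces. The responses are bounded almost
    surely, so they may be truncated ([risk_clamp]); all risks then become
    integrals of bounded functions, and a conditional expectation only enters
    through its inner products with such functions ([psiE]).

    Upper bounds. The estimated regressions are unbiased for [Pi1 p] and
    [Pi2 b], and the second moment of a sample mean is explicit
    ([E_iid_mean_sqr]). Integrating one subsample at a time, [psi_INT] has
    squared error at most
      bias^2 + C (1 / n + min(k1, k2) / n^2),
    where the minimum comes from the trace of the product of two projections
    ([trace_le], [mse_INT_le]). In [psi_MC] and [psi_IF] one further sample mean
    replaces an integral, which adds 1/n times the mean of the square of a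
    product of two noisy regressions, of order (1 + k1 / n) (1 + k2 / n)
    ([mse_MC_le], [mse_IF_le]). As the spaces are nested, the bias is the inner
    product of the two approximation errors in the smaller space for [psi_INT]
    and [psi_MC] ([bias_min]) and in the larger one for [psi_IF] ([bias_max]).
    Parseval's inequality and the decay of the wavelet coefficients make it at
    most of order [k^(-s/d)] ([hoelder_residual_le], [bias_bound]). The lemmas
    [worst_risk_INT_le], [worst_risk_MC_le] and [worst_risk_IF_le] collect these
    bounds. Substituting powers of [n] for the resolutions gives all the claims
    of optimality, and the rate of [psi_MC].

    Lower bound for [psi_MC]. Its error is at least the squared bias
    ([mse_MC_ge_bias]), and at least the variance of the additional sample mean,
    which for large resolutions is of order k1 k2 / n^3 because the projection
    kernel is of order [k] on the whole diagonal ([scal_kernel_ge],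
    [mse_MC_ge_var]). A large bias needs regression functions that are rough at
    the level of the smaller space. Single wavelets cannot serve, as the
    generators may be discontinuous and members of a ball may not. Cosines in one
    coordinate can: counting shows that one of low frequency has half of its
    energy outside of the scaling space ([rough_wave]), while vanishing moments
    and Taylor's formula bound its wavelet coefficients ([wave_coef]). A member
    of the class satisfying the constraint with a smaller radius leaves room to
    add such a wave to both regression functions ([room]); any two regression
    functions with values strictly between [C1] and [C2] are those of responses
    with the two values [C1] and [C2] ([two_point_law]); and a choice of signs
    prevents the biases from cancelling ([four_signs]). This is
    [worst_risk_MC_ge]. In the rough regime a resolution below
    [n^(3d/(2s+2d))] makes the bias too large and one above it the variance, so
    that no choice beats [n^(-3s/(s+d))] ([risk_MC_lower]), a slower rate than
    the minimax one. *)

(** * Expectations of bounded measurable functions *)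

(** After truncation of the responses all moments are those of functions that
    are bounded and measurable everywhere. This class is stable under the
    operations in use, so no integrability conditions have to be tracked. *)
Definition bnd d (T : measurableType d) (R : realType) (f : T -> R) : Prop :=
  measurable_fun setT f /\ exists C : R, forall x, `|f x| <= C.

Section BoundedFunctions.
Context d (T : measurableType d) (R : realType).
Implicit Types f g : T -> R.

Lemma bnd_cst (c : R) : bnd (fun _ : T => c).
Proof. by split; [exact: measurable_cst | exists `|c|]. Qed.

Lemma bndD f g : bnd f -> bnd g -> bnd (fun x => f x + g x).
Proof.
move=> [mf [C Cf]] [mg [D Dg]]; split; first exact: measurable_funD.
by exists (C + D) => x; rewrite (le_trans (ler_normD _ _))// lerD.
Qed.

Lemma bndN f : bnd f -> bnd (fun x => - f x).
Proof.
move=> [mf [C Cf]]; split; first exact: measurable_funN.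
by exists C => x; rewrite normrN.
Qed.

Lemma bndB f g : bnd f -> bnd g -> bnd (fun x => f x - g x).
Proof. by move=> bf bg; apply: bndD => //; exact: bndN. Qed.

Lemma bndM f g : bnd f -> bnd g -> bnd (fun x => f x * g x).
Proof.
move=> [mf [C Cf]] [mg [D Dg]]; split; first exact: measurable_funM.
by exists (C * D) => x; rewrite normrM ler_pM.
Qed.

Lemma bndX f n : bnd f -> bnd (fun x => f x ^+ n).
Proof.
move=> bf; elim: n => [|n IH]; first exact: bnd_cst.
by under eq_fun do rewrite exprS; exact: bndM.
Qed.

Lemma bnd_abs f : bnd f -> bnd (fun x => `|f x|).
Proof.
move=> [mf [C Cf]]; split; first exact: measurableT_comp.
by exists C => x; rewrite normr_id.
Qed.

Lemma bnd_sum (I : Type) (r : seq I) (P : pred I) (F : I -> T -> R) :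
  (forall i, P i -> bnd (F i)) -> bnd (fun x => \sum_(i <- r | P i) F i x).
Proof.
move=> bF; elim: r => [|i r IH].
  have -> : (fun x => \sum_(i <- [::] | P i) F i x) = fun=> 0.
    by apply/funext => x; rewrite big_nil.
  exact: bnd_cst.
case Pi : (P i); last first.
  suff -> : (fun x => \sum_(j <- i :: r | P j) F j x) =
            fun x => \sum_(j <- r | P j) F j x by [].
  by apply/funext => x; rewrite big_cons Pi.
have -> : (fun x => \sum_(j <- i :: r | P j) F j x) =
          fun x => F i x + \sum_(j <- r | P j) F j x.
  by apply/funext => x; rewrite big_cons Pi.
by apply: bndD => //; exact: bF.
Qed.

Lemma bnd_prod (I : Type) (r : seq I) (P : pred I) (F : I -> T -> R) :
  (forall i, P i -> bnd (F i)) -> bnd (fun x => \prod_(i <- r | P i) F i x).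
Proof.
move=> bF; elim: r => [|i r IH].
  have -> : (fun x => \prod_(i <- [::] | P i) F i x) = fun=> 1.
    by apply/funext => x; rewrite big_nil.
  exact: bnd_cst.
case Pi : (P i); last first.
  suff -> : (fun x => \prod_(j <- i :: r | P j) F j x) =
            fun x => \prod_(j <- r | P j) F j x by [].
  by apply/funext => x; rewrite big_cons Pi.
have -> : (fun x => \prod_(j <- i :: r | P j) F j x) =
          fun x => F i x * \prod_(j <- r | P j) F j x.
  by apply/funext => x; rewrite big_cons Pi.
by apply: bndM => //; exact: bF.
Qed.

Lemma bnd_comp d' (T' : measurableType d') (h : T' -> T) f :
  measurable_fun setT h -> bnd f -> bnd (fun x => f (h x)).
Proof.
move=> mh [mf [C Cf]]; split; first exact: measurableT_comp.
by exists C => x.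
Qed.

Lemma bnd_le f : bnd f -> exists2 C : R, 0 <= C & forall x, `|f x| <= C.
Proof.
move=> [_ [C Cf]]; exists (Num.max 0 C); first by rewrite le_max lexx.
by move=> x; rewrite le_max Cf orbT.
Qed.

Lemma bnd_indic (B : set T) : measurable B -> bnd (\1_B : T -> R).
Proof.
move=> mB; split; first exact: measurable_indic.
by exists 1 => x; rewrite indicE; case: (_ \in _); rewrite ?normr1 ?normr0.
Qed.

End BoundedFunctions.

Ltac bnd_tac :=
  intros; cbv beta; lazymatch goal with
  | |- bnd (fun _ => ?c) => exact: bnd_cst
  | |- bnd (fun x => @?f x + @?g x) => apply: (@bndD _ _ _ f g); bnd_tac
  | |- bnd (fun x => - @?f x) => apply: (@bndN _ _ _ f); bnd_tac
  | |- bnd (fun x => @?f x * @?g x) => apply: (@bndM _ _ _ f g); bnd_tac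
  | |- bnd (fun x => @?f x ^+ ?n) => apply: (@bndX _ _ _ f n); bnd_tac
  | |- bnd (fun x => `|@?f x|) => apply: (@bnd_abs _ _ _ f); bnd_tac
  | |- bnd (fun x => bigop _ _ _) => apply: bnd_sum; bnd_tac
  | |- bnd _ => first [ assumption
      | match goal with H : _ |- _ => solve [simple apply H; bnd_tac] end
      | done ]
  end.

Section Expectation.
Context d (T : measurableType d) (R : realType) (P : probability T R).
Implicit Types f g : T -> R.

Local Notation E f := (\int[P]_x f x).

Lemma bnd_integrable f : bnd f -> P.-integrable setT (EFin \o f).
Proof.
move=> [mf [C Cf]]; apply: measurable_bounded_integrable => //.
  by rewrite (le_lt_trans (probability_le1 P measurableT))// ltry.
exists C; split; first exact: num_real.
by move=> y Cy x _; rewrite /= (le_trans (Cf x))// ltW.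
Qed.
Local Hint Resolve bnd_integrable : core.

Lemma EFin_E f : bnd f -> (\int[P]_x (f x)%:E)%E = (E f)%:E.
Proof.
move=> bf; rewrite /Rintegral fineK//.
exact: integrable_fin_num (bnd_integrable bf).
Qed.

Lemma E_cst (c : R) : \int[P]_x c = c.
Proof.
rewrite Rintegral_cst// [X in fine X](_ : _ = 1%E) ?mulr1//.
exact: probability_setT.
Qed.

Lemma E_add f g : bnd f -> bnd g -> \int[P]_x (f x + g x) = E f + E g.
Proof. by move=> bf bg; rewrite RintegralD//; exact: bnd_integrable. Qed.

Lemma E_sub f g : bnd f -> bnd g -> \int[P]_x (f x - g x) = E f - E g.
Proof. by move=> bf bg; rewrite RintegralB//; exact: bnd_integrable. Qed.

Lemma E_scale c f : bnd f -> \int[P]_x (c * f x) = c * E f.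
Proof. by move=> bf; rewrite RintegralZl//; exact: bnd_integrable. Qed.

Lemma E_scaler c f : bnd f -> \int[P]_x (f x * c) = E f * c.
Proof. by move=> bf; rewrite RintegralZr//; exact: bnd_integrable. Qed.

Lemma E_opp f : bnd f -> \int[P]_x (- f x) = - E f.
Proof.
by move=> bf; under eq_Rintegral do rewrite -mulN1r; rewrite E_scale// mulN1r.
Qed.

Lemma E_sum (I : Type) (r : seq I) (Q : pred I) (F : I -> T -> R) :
  (forall i, Q i -> bnd (F i)) ->
  \int[P]_x (\sum_(i <- r | Q i) F i x) = \sum_(i <- r | Q i) E (F i).
Proof.
move=> bF; elim: r => [|i r IH].
  rewrite big_nil -[RHS](E_cst 0).
  by apply: eq_Rintegral => x _; rewrite big_nil.
rewrite big_cons; case: ifPn => Qi.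
  rewrite -IH -E_add; [|exact: bF|exact: bnd_sum].
  by apply: eq_Rintegral => x _; rewrite big_cons Qi.
by rewrite -IH; apply: eq_Rintegral => x _; rewrite big_cons (negbTE Qi).
Qed.

Lemma E_le f g : bnd f -> bnd g -> (forall x, f x <= g x) -> E f <= E g.
Proof. by move=> bf bg fg; apply: le_Rintegral => //; exact: bnd_integrable. Qed.

Lemma E_ge0 f : (forall x, 0 <= f x) -> 0 <= E f.
Proof. by move=> f0; apply: Rintegral_ge0. Qed.

Lemma E_ae f g : measurable_fun setT f -> measurable_fun setT g ->
  {ae P, forall x, f x = g x} -> E f = E g.
Proof.
move=> mf mg fg; congr fine; apply: ae_eq_integral => //.
- exact/measurable_EFinP.
- exact/measurable_EFinP.
- by apply: filterS fg => x /= -> _.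
Qed.

Lemma E_le_ae f g : bnd f -> bnd g -> {ae P, forall x, f x <= g x} -> E f <= E g.
Proof.
move=> bf bg fg; have -> : E g = E (fun x => Num.max (f x) (g x)).
  apply: E_ae; [exact: bg.1|exact: measurable_maxr bf.1 bg.1|].
  by apply: filterS fg => x fg; rewrite (max_idPr fg).
apply: E_le => //; last by move=> x; rewrite le_max lexx.
split; first exact: measurable_maxr bf.1 bg.1.
have [C C0 Cf] := bnd_le bf; have [D D0 Dg] := bnd_le bg.
exists (C + D) => x; case: (leP (f x) (g x)) => _.
  by rewrite (le_trans (Dg x))// lerDr.
by rewrite (le_trans (Cf x))// lerDl.
Qed.

Lemma E_abs_le f (C : R) : bnd f -> (forall x, `|f x| <= C) -> `|E f| <= C.
Proof.
move=> bf fC; rewrite (le_trans (le_normr_Rintegral _ (bnd_integrable bf)))//.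
by rewrite -[leRHS]E_cst; apply: E_le => //; bnd_tac.
Qed.

Lemma E_eq f g : f =1 g -> E f = E g.
Proof. by move=> fg; apply: eq_Rintegral => x _; exact: fg. Qed.

(** Cauchy-Schwarz, from the nonnegativity of the quadratic form at the
    critical point. *)
Lemma E_CauchySchwarz f g : bnd f -> bnd g ->
  (\int[P]_x (f x * g x)) ^+ 2 <= (\int[P]_x (f x ^+ 2)) * (\int[P]_x (g x ^+ 2)).
Proof.
move=> bf bg.
set a := \int[P]_x (f x ^+ 2); set c := \int[P]_x (g x ^+ 2).
set b := \int[P]_x (f x * g x).
have quad s t : 0 <= s ^+ 2 * a + 2 * s * t * b + t ^+ 2 * c.
  have -> : s ^+ 2 * a + 2 * s * t * b + t ^+ 2 * c =
      \int[P]_x ((s * f x + t * g x) ^+ 2).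
    rewrite /a /b /c -!E_scale; try bnd_tac.
    rewrite -!E_add; try bnd_tac.
    by apply: E_eq => x; ring.
  by apply: E_ge0 => x; exact: sqr_ge0.
have a0 : 0 <= a by apply: E_ge0 => x; exact: sqr_ge0.
have c0 : 0 <= c by apply: E_ge0 => x; exact: sqr_ge0.
have [c_eq0|c_neq0] := eqVneq c 0.
  have [->|b0] := eqVneq b 0; first by rewrite expr0n mulr_ge0.
  have := quad 1 (- (a + 1) / (2 * b)); rewrite c_eq0 => h; exfalso.
  have : 2 * 1 * (- (a + 1) / (2 * b)) * b = - (a + 1) by field.
  by lra.
have cp : 0 < c by rewrite lt_def c_neq0.
have := quad c (- b) => h.
have : 0 <= c * (c * a - b ^+ 2) by nra.
by rewrite pmulr_rge0// subr_ge0 mulrC.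
Qed.

Lemma E_sqr_le f : bnd f -> (E f) ^+ 2 <= \int[P]_x (f x ^+ 2).
Proof.
move=> bf; have := E_CauchySchwarz bf (bnd_cst T 1).
rewrite (_ : \int[P]_x (1 ^+ 2) = 1); last by rewrite E_cst expr1n.
by rewrite mulr1; under eq_Rintegral do rewrite mulr1.
Qed.

End Expectation.

Section Transfer.
Context d d' (T : measurableType d) (T' : measurableType d') (R : realType).

Lemma E_distribution (P : probability T R) (X : {mfun T >-> T'}) (f : T' -> R) :
  bnd f -> \int[distribution P X]_y f y = \int[P]_x f (X x).
Proof.
move=> bf; rewrite /Rintegral integral_distribution//.
  by apply/measurable_EFinP; exact: bf.1.
exact: (bnd_integrable P (bnd_comp (@measurable_funPT _ _ _ _ X) bf)).
Qed.

Lemma E_transfer (P : probability T R) (Q : probability T' R) (X : T -> T')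
    (f : T' -> R) : measurable_fun setT X ->
  (forall B, measurable B -> P (X @^-1` B) = Q B) ->
  bnd f -> \int[P]_x f (X x) = \int[Q]_y f y.
Proof.
move=> mX XQ bf.
pose X' : {mfun T >-> T'} := HB.pack X (isMeasurableFun.Build _ _ _ _ X mX).
rewrite -[LHS](@E_distribution P X' f)//; congr fine.
by apply: eq_measure_integral => B mB _; exact: XQ.
Qed.

End Transfer.

Section Fubini.
Context d d' (T : measurableType d) (U : measurableType d') (R : realType).
Variables (P : probability T R) (Q : probability U R).

Lemma bnd_section1 (f : T * U -> R) x : bnd f -> bnd (fun y => f (x, y)).
Proof. by move=> bf; apply: (@bnd_comp _ _ _ _ _ (pair x)). Qed.

Lemma bnd_section2 (f : T * U -> R) y : bnd f -> bnd (fun x => f (x, y)).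
Proof. by move=> bf; apply: (@bnd_comp _ _ _ _ _ (fun x => (x, y))). Qed.

Lemma bnd_E2 (f : T * U -> R) : bnd f -> bnd (fun x => \int[Q]_y f (x, y)).
Proof.
move=> bf; split; last first.
  have [C C0 Cf] := bnd_le bf; exists C => x.
  by apply: E_abs_le => //; exact: bnd_section1.
apply/measurable_EFinP.
rewrite [X in measurable_fun _ X](_ : _ = fubini_F Q (EFin \o f)).
  exact: (measurable_fubini_F (bnd_integrable (P \x Q)%E bf)).
by apply/funext => x; rewrite /fubini_F /= -EFin_E//; exact: bnd_section1.
Qed.

Lemma bnd_E1 (f : T * U -> R) : bnd f -> bnd (fun y => \int[P]_x f (x, y)).
Proof.
move=> bf; split; last first.
  have [C C0 Cf] := bnd_le bf; exists C => x.
  by apply: E_abs_le => //; exact: bnd_section2.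
apply/measurable_EFinP.
rewrite [X in measurable_fun _ X](_ : _ = fubini_G P (EFin \o f)).
  exact: (measurable_fubini_G (bnd_integrable (P \x Q)%E bf)).
by apply/funext => x; rewrite /fubini_G /= -EFin_E//; exact: bnd_section2.
Qed.

Lemma E_prod (f : T * U -> R) : bnd f ->
  \int[(P \x Q)%E]_z f z = \int[P]_x \int[Q]_y f (x, y).
Proof.
move=> bf; rewrite /Rintegral; congr fine.
rewrite -(integral12_prod_meas1 (bnd_integrable (P \x Q)%E bf)).
apply: eq_integral => x _; rewrite /fubini_F /= -EFin_E//.
exact: bnd_section1.
Qed.

Lemma E_swap (f : T * U -> R) : bnd f ->
  \int[P]_x \int[Q]_y f (x, y) = \int[Q]_y \int[P]_x f (x, y).
Proof.
move=> bf; rewrite /Rintegral; congr fine.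
transitivity (\int[P]_x \int[Q]_y (EFin \o f) (x, y))%E.
  by apply: eq_integral => x _; rewrite -EFin_E//; exact: bnd_section1.
rewrite (Fubini (bnd_integrable (P \x Q)%E bf)).
by apply: eq_integral => y _; rewrite -EFin_E//; exact: bnd_section2.
Qed.

End Fubini.

(** * Sample means of i.i.d. draws *)

Section IidExpectation.
Context d (T : measurableType d) (R : realType).
Implicit Types (P : probability T R) (n : nat).

Lemma bnd_tnth n (i : 'I_n) (f : T -> R) :
  bnd f -> bnd (fun t : n.-tuple T => f (tnth t i)).
Proof. by apply: bnd_comp; exact: measurable_tnth. Qed.

Lemma bnd_tuple_cons n (F : n.+1.-tuple T -> R) :
  bnd F -> bnd (fun xt : T * n.-tuple T => F (tuple_cons xt)).
Proof. by apply: bnd_comp; exact: measurable_tuple_cons. Qed.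

Lemma E_iidS P n (F : n.+1.-tuple T -> R) : bnd F ->
  \int[iid P n.+1]_t F t = \int[P]_x \int[iid P n]_t F (tuple_cons (x, t)).
Proof.
move=> bF; rewrite /= E_distribution//.
by rewrite (E_prod P (iid P n) (bnd_tuple_cons bF)).
Qed.

Lemma tnth_cons0 n (x : T) (t : n.-tuple T) : tnth (tuple_cons (x, t)) ord0 = x.
Proof. by []. Qed.

Lemma tnth_consS n (x : T) (t : n.-tuple T) i :
  tnth (tuple_cons (x, t)) (lift ord0 i) = tnth t i.
Proof. by rewrite tnthS. Qed.

Lemma E_iid_coord P n (i : 'I_n) (f : T -> R) : bnd f ->
  \int[iid P n]_t f (tnth t i) = \int[P]_x f x.
Proof.
elim: n i => [[]//|n IH] i bf.
rewrite E_iidS; last exact: (bnd_tnth i bf).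
case: (unliftP ord0 i) => [j|] ->.
  rewrite -[RHS](E_cst P); apply: E_eq => x.
  by rewrite -(IH j)//; apply: E_eq => t; rewrite tnth_consS.
by apply: E_eq => x; rewrite -[RHS](E_cst (iid P n)).
Qed.

(** The variance of a sum of independent terms is additive: peel off the first
    draw and absorb it into the constant. *)
Lemma E_iid_sum_sqr P n (f : T -> R) (c : R) : bnd f ->
  \int[iid P n]_t ((c + \sum_(i < n) f (tnth t i)) ^+ 2) =
  (c + n%:R * \int[P]_x f x) ^+ 2
  + n%:R * (\int[P]_x (f x ^+ 2) - (\int[P]_x f x) ^+ 2).
Proof.
move=> bf; elim: n c => [|n IH] c.
  rewrite !mul0r !addr0 -[RHS](E_cst (iid P 0)).
  by apply: E_eq => t; rewrite big_ord0 addr0.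
have bS : bnd (fun t : n.+1.-tuple T => (c + \sum_(i < n.+1) f (tnth t i)) ^+ 2).
  apply: bndX; apply: bndD; first exact: bnd_cst.
  by apply: bnd_sum => i _; exact: bnd_tnth.
rewrite E_iidS//.
set m := \int[P]_x f x; set s := \int[P]_x (f x ^+ 2).
transitivity (\int[P]_x ((c + f x + n%:R * m) ^+ 2 + n%:R * (s - m ^+ 2))).
  apply: E_eq => x; rewrite -IH; apply: E_eq => t.
  rewrite big_ord_recl tnth_cons0 addrA; congr ((_ + _) ^+ 2).
  by apply: eq_bigr => i _; rewrite tnth_consS.
rewrite E_add; try bnd_tac.
rewrite E_cst.
transitivity (\int[P]_x (((c + n%:R * m) ^+ 2 + 2 * (c + n%:R * m) * f x) + f x ^+ 2)
   + n%:R * (s - m ^+ 2)).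
  by congr (_ + _); apply: E_eq => x; ring.
rewrite E_add; try bnd_tac.
rewrite E_add; try bnd_tac.
rewrite E_cst E_scale// -/m -/s -natr1; ring.
Qed.

Lemma E_iid_mean_sqr P n (f : T -> R) (c : R) : (0 < n)%N -> bnd f ->
  \int[iid P n]_t ((c + n%:R^-1 * \sum_(i < n) f (tnth t i)) ^+ 2) =
  (c + \int[P]_x f x) ^+ 2
  + n%:R^-1 * (\int[P]_x (f x ^+ 2) - (\int[P]_x f x) ^+ 2).
Proof.
move=> n0 bf; have n1 : n%:R != 0 :> R by rewrite pnatr_eq0 -lt0n.
transitivity (n%:R^-1 ^+ 2 * \int[iid P n]_t
    ((n%:R * c + \sum_(i < n) f (tnth t i)) ^+ 2)).
  rewrite -E_scale; last first.
    apply: bndX; apply: bndD; first exact: bnd_cst.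
    by apply: bnd_sum => i _; exact: bnd_tnth.
  by apply: E_eq => t; rewrite -exprMn mulrDr mulKf.
by rewrite E_iid_sum_sqr//; field.
Qed.

Lemma bnd_mean n (f : T -> R) : bnd f ->
  bnd (fun t : n.-tuple T => n%:R^-1 * \sum_(i < n) f (tnth t i)).
Proof.
move=> bf; apply: bndM; first exact: bnd_cst.
by apply: bnd_sum => i _; exact: bnd_tnth.
Qed.

Lemma E_iid4 P (F : 4.-tuple T -> R) : bnd F ->
  \int[iid P 4]_t F t =
  \int[P]_x0 \int[P]_x1 \int[P]_x2 \int[P]_x3 F [tuple x0; x1; x2; x3].
Proof.
move=> bF; rewrite E_iidS//; apply: E_eq => x0.
have bF0 := bnd_section1 x0 (bnd_tuple_cons bF).
rewrite E_iidS//; apply: E_eq => x1.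
have bF1 := bnd_section1 x1 (bnd_tuple_cons bF0).
rewrite E_iidS//; apply: E_eq => x2.
have bF2 := bnd_section1 x2 (bnd_tuple_cons bF1).
rewrite E_iidS//; apply: E_eq => x3.
have bF3 := bnd_section1 x3 (bnd_tuple_cons bF2).
rewrite -[RHS](E_cst (iid P 0)); apply: E_eq => t.
by congr (F _); apply: val_inj => /=; rewrite (tuple0 t).
Qed.

Lemma iid_ae_all P n (G : set T) : measurable G -> P G = 1%E ->
  {ae iid P n, forall t, forall i, G (tnth t i)}.
Proof.
move=> mG PG; have mbox := measurable_box (n := n) (fun _ : 'I_n => mG).
exists (~` [set t | forall i, G (tnth t i)]); split => //.
- exact: measurableC.
- have h : iid P n [set t | forall i, G (tnth t i)] = 1%E.
    by rewrite (iid_box P (fun _ : 'I_n => mG)) big1.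
  transitivity (1 - iid P n [set t | forall i, G (tnth t i)])%E.
    exact: probability_setC.
  by rewrite h subee.
Qed.

End IidExpectation.

(** * Orthonormal systems *)

Definition dot d (U : measurableType d) (R : realType) (mu : probability U R)
  (f g : U -> R) : R := \int[mu]_x (f x * g x).

Definition orthonormal d (U : measurableType d) (R : realType)
    (mu : probability U R) (I : finType) (P : pred I) (phi : I -> U -> R) :=
  forall i k, P i -> P k -> dot mu (phi i) (phi k) = (i == k)%:R.

Definition proj d (U : measurableType d) (R : realType) (mu : probability U R)
    (I : finType) (phi : I -> U -> R) (f : U -> R) (x : U) : R :=
  \sum_i dot mu f (phi i) * phi i x.

Definition repr_kernel (U : Type) (R : realType) (I : finType) (phi : I -> U -> R)
  (x y : U) : R := \sum_i phi i x * phi i y.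

Section Orthonormal.
Context d (U : measurableType d) (R : realType) (mu : probability U R).
Implicit Types f g : U -> R.

Local Notation "<| f , g |>" := (dot mu f g) (at level 0, f, g at level 200).

Lemma dotC f g : <| f, g |> = <| g, f |>.
Proof. by apply: E_eq => x; rewrite mulrC. Qed.

Lemma dotDl f g h : bnd f -> bnd g -> bnd h ->
  <| fun x => f x + g x, h |> = <| f, h |> + <| g, h |>.
Proof.
move=> bf bg bh; rewrite /dot -E_add; try bnd_tac.
by apply: E_eq => x; rewrite mulrDl.
Qed.

Lemma dotBl f g h : bnd f -> bnd g -> bnd h ->
  <| fun x => f x - g x, h |> = <| f, h |> - <| g, h |>.
Proof.
move=> bf bg bh; rewrite /dot -E_sub; try bnd_tac.
by apply: E_eq => x; rewrite mulrBl.
Qed.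

Lemma dotBr f g h : bnd f -> bnd g -> bnd h ->
  <| h, fun x => f x - g x |> = <| h, f |> - <| h, g |>.
Proof. by move=> bf bg bh; rewrite dotC dotBl// !(dotC h). Qed.

Lemma dotDr f g h : bnd f -> bnd g -> bnd h ->
  <| h, fun x => f x + g x |> = <| h, f |> + <| h, g |>.
Proof. by move=> bf bg bh; rewrite dotC dotDl// !(dotC h). Qed.

Lemma dotZl c f h : bnd f -> bnd h -> <| fun x => c * f x, h |> = c * <| f, h |>.
Proof.
move=> bf bh; rewrite /dot -E_scale; try bnd_tac.
by apply: E_eq => x; rewrite mulrA.
Qed.

Lemma dotZr c f h : bnd f -> bnd h -> <| h, fun x => c * f x |> = c * <| h, f |>.
Proof. by move=> bf bh; rewrite dotC dotZl// dotC. Qed.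

Lemma dot_suml (I : finType) (P : pred I) (c : I -> R) (phi : I -> U -> R) h :
  (forall i, bnd (phi i)) -> bnd h ->
  <| fun x => \sum_(i | P i) c i * phi i x, h |> =
  \sum_(i | P i) c i * <| phi i, h |>.
Proof.
move=> bphi bh; rewrite /dot.
transitivity (\sum_(i | P i) \int[mu]_x (c i * (phi i x * h x))); last first.
  by apply: eq_bigr => i _; rewrite E_scale//; bnd_tac.
rewrite -E_sum; last by bnd_tac.
by apply: E_eq => x; rewrite mulr_suml; apply: eq_bigr => i _; rewrite mulrA.
Qed.

Lemma dot_ae f g h : bnd f -> bnd g -> bnd h ->
  {ae mu, forall x, f x = g x} -> <| f, h |> = <| g, h |>.
Proof.
move=> bf bg bh fg; apply: E_ae.
- exact: (bndM bf bh).1.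
- exact: (bndM bg bh).1.
- by apply: filterS fg => x /= ->.
Qed.

Lemma dot_ge0 f : 0 <= <| f, f |>.
Proof. by apply: E_ge0 => x; rewrite -expr2 sqr_ge0. Qed.

Lemma dot_sqr_le f (C : R) : bnd f -> (forall x, `|f x| <= C) -> <| f, f |> <= C ^+ 2.
Proof.
move=> bf fC; rewrite -[leRHS](E_cst mu); apply: E_le; try bnd_tac.
move=> x; rewrite -expr2 -real_normK ?num_real// lerXn2r// nnegrE//.
exact: le_trans (fC x).
Qed.

Lemma dot_CauchySchwarz f g : bnd f -> bnd g ->
  <| f, g |> ^+ 2 <= <| f, f |> * <| g, g |>.
Proof.
move=> bf bg; apply: le_trans (E_CauchySchwarz mu bf bg) _.
by under eq_Rintegral do rewrite expr2; under [X in _ * X <= _]eq_Rintegral do rewrite expr2.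
Qed.

Lemma dot_add_le f g : bnd f -> bnd g ->
  <| fun x => f x - g x, fun x => f x - g x |> <= 2 * <| f, f |> + 2 * <| g, g |>.
Proof.
move=> bf bg; rewrite /dot -!E_scale; try bnd_tac.
rewrite -E_add; try bnd_tac.
by apply: E_le; [bnd_tac|bnd_tac|move=> x; have := sqr_ge0 (f x + g x); nra].
Qed.

Section System.
Variables (I : finType) (phi : I -> U -> R).
Hypothesis bphi : forall i, bnd (phi i).

Lemma bnd_comb (P : pred I) (c : I -> R) :
  bnd (fun x => \sum_(i | P i) c i * phi i x).
Proof. by apply: bnd_sum => i _; apply: bndM => //; exact: bnd_cst. Qed.

Lemma bnd_proj f : bnd (proj mu phi f).
Proof. exact: bnd_comb. Qed.

(** Pythagoras: among the combinations of an orthonormal system the one with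
    the Fourier coefficients is closest to [f]. *)
Lemma residual_sqr (P : pred I) (c : I -> R) f :
  orthonormal mu P phi -> bnd f ->
  let r x := f x - \sum_(i | P i) c i * phi i x in
  <| r, r |> = <| f, f |> - \sum_(i | P i) <| f, phi i |> ^+ 2
    + \sum_(i | P i) (c i - <| f, phi i |>) ^+ 2.
Proof.
move=> ortho bf r; pose g x := \sum_(i | P i) c i * phi i x.
have bg : bnd g by exact: bnd_comb.
have -> : <| r, r |> = <| f, f |> - 2 * <| g, f |> + <| g, g |>.
  rewrite /r -/g dotBl ?dotBr//; try bnd_tac.
  by rewrite (dotC f g); ring.
have -> : <| g, f |> = \sum_(i | P i) c i * <| f, phi i |>.
  by rewrite dot_suml//; apply: eq_bigr => i _; rewrite dotC.
have -> : <| g, g |> = \sum_(i | P i) c i ^+ 2.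
  rewrite dot_suml//; apply: eq_bigr => i Pi; rewrite expr2; congr (_ * _).
  rewrite dotC dot_suml// (bigD1 i)//= ortho// eqxx mulr1 big1 ?addr0//.
  by move=> k /andP[Pk /negbTE ki]; rewrite ortho// ki mulr0.
rewrite mulr_sumr -sumrN -!addrA; congr (_ + _).
rewrite -!sumrN -!big_split/=; apply: eq_bigr => i _; ring.
Qed.

Hypothesis ortho : orthonormal mu predT phi.

Lemma Bessel f : bnd f -> \sum_i <| f, phi i |> ^+ 2 <= <| f, f |>.
Proof.
move=> bf; rewrite -subr_ge0.
have := residual_sqr (fun i => <| f, phi i |>) ortho bf.
rewrite [X in _ - _ + X]big1 ?addr0 => [<-|i _]; last by rewrite subrr expr0n.
exact: dot_ge0.
Qed.

Lemma proj_residual f : bnd f ->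
  <| fun x => f x - proj mu phi f x, fun x => f x - proj mu phi f x |> =
  <| f, f |> - \sum_i <| f, phi i |> ^+ 2.
Proof.
move=> bf; rewrite (residual_sqr (fun i => <| f, phi i |>) ortho bf).
by rewrite [X in _ - _ + X]big1 ?addr0// => i _; rewrite subrr expr0n.
Qed.

Lemma proj_best f (c : I -> R) : bnd f ->
  <| fun x => f x - proj mu phi f x, fun x => f x - proj mu phi f x |> <=
  <| fun x => f x - \sum_i c i * phi i x, fun x => f x - \sum_i c i * phi i x |>.
Proof.
move=> bf; rewrite proj_residual// (residual_sqr c ortho bf) lerDl.
by apply: sumr_ge0 => i _; exact: sqr_ge0.
Qed.

Lemma dot_proj f g : bnd f -> bnd g ->
  <| proj mu phi f, g |> = \sum_i <| f, phi i |> * <| g, phi i |>.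
Proof.
move=> bf bg; rewrite dot_suml//; apply: eq_bigr => i _.
by rewrite (dotC g).
Qed.

Lemma dot_projC f g : bnd f -> bnd g -> <| proj mu phi f, g |> = <| f, proj mu phi g |>.
Proof.
move=> bf bg; rewrite dot_proj// dotC dot_proj//.
by apply: eq_bigr => i _; rewrite mulrC.
Qed.

Lemma dot_proj_base f i : bnd f -> <| proj mu phi f, phi i |> = <| f, phi i |>.
Proof.
move=> bf; rewrite dot_proj// (bigD1 i)//= ortho// eqxx mulr1 big1 ?addr0//.
by move=> k /negbTE ki; rewrite ortho// eq_sym ki mulr0.
Qed.

Lemma dot_proj_proj f g : bnd f -> bnd g ->
  <| proj mu phi f, proj mu phi g |> = <| proj mu phi f, g |>.
Proof.
move=> bf bg; rewrite dotC dot_proj//; last exact: bnd_proj.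
rewrite dotC dotC dot_proj//; apply: eq_bigr => i _.
by rewrite dot_proj_base// mulrC.
Qed.

Lemma proj_sqr f : bnd f ->
  <| proj mu phi f, proj mu phi f |> = \sum_i <| f, phi i |> ^+ 2.
Proof. by move=> bf; rewrite dot_proj_proj// dot_proj. Qed.

Lemma proj_sqr_le f : bnd f -> <| proj mu phi f, proj mu phi f |> <= <| f, f |>.
Proof. by move=> bf; rewrite proj_sqr//; exact: Bessel. Qed.

Lemma proj_residual_le f : bnd f ->
  <| fun x => f x - proj mu phi f x, fun x => f x - proj mu phi f x |> <= <| f, f |>.
Proof.
move=> bf; rewrite proj_residual// gerBl.
by apply: sumr_ge0 => i _; exact: sqr_ge0.
Qed.

Lemma dot_residuals f g : bnd f -> bnd g ->
  <| fun x => f x - proj mu phi f x, fun x => g x - proj mu phi g x |> =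
  <| f, g |> - <| proj mu phi f, proj mu phi g |>.
Proof.
move=> bf bg; have bpf := bnd_proj f; have bpg := bnd_proj g.
rewrite dotBl; try bnd_tac.
rewrite !dotBr; try bnd_tac.
by rewrite dot_proj_proj// -dot_projC//; ring.
Qed.

Lemma bnd_kernel x : bnd (repr_kernel phi x).
Proof. exact: bnd_comb. Qed.

Lemma bnd_kernel2 : bnd (fun z : U * U => repr_kernel phi z.1 z.2).
Proof.
by apply: bnd_sum => i _; apply: bndM; apply: bnd_comp => //.
Qed.

Lemma kernelC x y : repr_kernel phi x y = repr_kernel phi y x.
Proof. by apply: eq_bigr => i _; rewrite mulrC. Qed.

Lemma dot_kernel x g : bnd g -> <| repr_kernel phi x, g |> = proj mu phi g x.
Proof.
move=> bg; rewrite dot_suml//; apply: eq_bigr => i _.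
by rewrite mulrC dotC.
Qed.

(** The reproducing property of the kernel, applied to the kernel itself. *)
Lemma kernel_sqr x : \int[mu]_y (repr_kernel phi y x ^+ 2) = repr_kernel phi x x.
Proof.
transitivity <| repr_kernel phi x, repr_kernel phi x |>.
  by apply: E_eq => y; rewrite (kernelC y) expr2.
rewrite dot_kernel; last exact: bnd_kernel.
apply: eq_bigr => i _; congr (_ * _).
rewrite dot_suml// (bigD1 i)//= ortho// eqxx mulr1 big1 ?addr0//.
by move=> k /negbTE ki; rewrite ortho// ki mulr0.
Qed.

End System.

Definition nested (I J : finType) (phi : I -> U -> R) (chi : J -> U -> R) :=
  forall i, exists a : J -> R, {ae mu, forall x, phi i x = \sum_j a j * chi j x}.

Section TwoSystems.
Variables (I J : finType) (phi : I -> U -> R) (chi : J -> U -> R).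
Hypotheses (bphi : forall i, bnd (phi i)) (bchi : forall j, bnd (chi j)).
Hypotheses (ophi : orthonormal mu predT phi) (ochi : orthonormal mu predT chi).

Lemma nested_Parseval f i : nested phi chi -> bnd f ->
  <| f, phi i |> = \sum_j <| phi i, chi j |> * <| f, chi j |>.
Proof.
move=> /(_ i)[a phiE] bf; rewrite dotC.
rewrite (dot_ae (bphi i) (bnd_comb bchi predT a) bf phiE).
rewrite dot_suml//; apply: eq_bigr => j _; rewrite (dotC f); congr (_ * _).
rewrite (dot_ae (bphi i) (bnd_comb bchi predT a) (bchi j) phiE).
rewrite dot_suml// (bigD1 j)//= ochi// eqxx mulr1 big1 ?addr0//.
by move=> k /negbTE ki; rewrite ochi// ki mulr0.
Qed.

(** The coefficients of [f] on the coarser system only involve its projection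
    on the finer one. *)
Lemma dot_proj_nested f g : nested phi chi -> bnd f -> bnd g ->
  <| proj mu phi f, proj mu chi g |> = <| proj mu phi f, proj mu phi g |>.
Proof.
move=> nest bf bg; have bpf := bnd_proj bphi f.
rewrite [RHS](dot_proj_proj bphi ophi)// [RHS](dot_proj bphi)//.
rewrite -(dot_projC bchi)// (dot_proj bchi)//.
transitivity (\sum_j \sum_i <| f, phi i |> * <| phi i, chi j |> * <| g, chi j |>).
  by apply: eq_bigr => j _; rewrite (dot_suml predT _ bphi)// mulr_suml.
rewrite exchange_big; apply: eq_bigr => i _ /=.
rewrite (nested_Parseval i nest bg) mulr_sumr.
by apply: eq_bigr => j _; rewrite mulrA.
Qed.

(** The trace of a product of two projections, hence at most either rank: one
    bound is termwise, the other is Bessel's inequality after exchanging the two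
    sums. *)
Lemma trace_le :
  \sum_j <| proj mu phi (chi j), proj mu phi (chi j) |> <= (minn #|I| #|J|)%:R.
Proof.
under eq_bigr => j _ do rewrite proj_sqr//.
rewrite /minn; case: ifPn => _.
  rewrite exchange_big -sum1_card natr_sum; apply: ler_sum => i _.
  have := Bessel bchi ochi (bphi i); rewrite ophi// eqxx.
  by under eq_bigr => j _ do rewrite dotC.
rewrite -sum1_card natr_sum; apply: ler_sum => j _.
by have := Bessel bphi ophi (bchi j); rewrite ochi// eqxx.
Qed.

End TwoSystems.

End Orthonormal.

(** * Risk of the estimators for a general design *)

Definition series (T U : Type) (R : realType) (X : T -> U) (I : finType)
    (phi : I -> U -> R) (W : T -> R) n (D : n.-tuple T) (x : U) : R :=
  n%:R^-1 * \sum_(i < n) W (tnth D i) * repr_kernel phi (X (tnth D i)) x.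

(** The weak form of [w x = E(W | X = x)]: testing against bounded functions is
    all that the computations of moments below require. *)
Definition regression d d' (T : measurableType d) (U : measurableType d')
    (R : realType) (P : probability T R) (mu : probability U R) (X : T -> U)
    (W : T -> R) (w : U -> R) :=
  forall h, bnd h -> \int[P]_o (W o * h (X o)) = dot mu w h.

Section Risk.
Context d d' (T : measurableType d) (U : measurableType d') (R : realType).
Variables (P : probability T R) (mu : probability U R) (X : T -> U).
Hypothesis mX : measurable_fun setT X.
Hypothesis X_law : forall h, bnd h -> \int[P]_o h (X o) = \int[mu]_x h x.

Local Notation "<| f , g |>" := (dot mu f g) (at level 0, f, g at level 200).

Lemma bnd_X (h : U -> R) : bnd h -> bnd (fun o => h (X o)).
Proof. by move=> bh; exact: bnd_comp. Qed.

Section OneSample.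
Variables (I : finType) (phi : I -> U -> R).
Hypothesis bphi : forall i, bnd (phi i).
Hypothesis ophi : orthonormal mu predT phi.
Variables (W : T -> R) (w : U -> R) (C : R).
Hypotheses (bW : bnd W) (bw : bnd w) (reg : regression P mu X W w).
Hypothesis WC : forall o, `|W o| <= C.

Local Notation what := (series X phi W).

Lemma bnd_series n (D : n.-tuple T) : bnd (what D).
Proof.
apply: bndM; first exact: bnd_cst.
by apply: bnd_sum => i _; apply: bndM; [exact: bnd_cst|exact: bnd_kernel].
Qed.

Lemma bnd_series2 n : bnd (fun z : n.-tuple T * U => what z.1 z.2).
Proof.
apply: bndM; first exact: bnd_cst.
apply: bnd_sum => i _; apply: bndM.
  apply: (bnd_comp (h := fst) (f := fun D : n.-tuple T => W (tnth D i))) => //.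
  exact: bnd_tnth.
apply: (bnd_comp (h := fun z : n.-tuple T * U => (X (tnth z.1 i), z.2)) _
  (bnd_kernel2 bphi)).
apply: measurable_fun_pair => //; apply: measurableT_comp => //.
by apply: (measurableT_comp (measurable_tnth i)).
Qed.

(** Pairing with [g] turns the estimate into a sample mean, to which the exact
    formula for the second moment of a mean applies. *)
Lemma dot_series n (D : n.-tuple T) g : bnd g ->
  <| what D, g |> =
  n%:R^-1 * \sum_(i < n) W (tnth D i) * proj mu phi g (X (tnth D i)).
Proof.
move=> bg; rewrite /series dotZl//; last first.
  by apply: bnd_sum => i _; apply: bndM; [exact: bnd_cst|exact: bnd_kernel].
congr (_ * _); rewrite (dot_suml mu predT (fun i => W (tnth D i))
  (phi := fun i => repr_kernel phi (X (tnth D i))))//; last first.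
  by move=> i; exact: bnd_kernel.
by apply: eq_bigr => i _; rewrite dot_kernel.
Qed.

Lemma Wh_sqr_le h : bnd h -> \int[P]_o ((W o * h (X o)) ^+ 2) <= C ^+ 2 * <| h, h |>.
Proof.
move=> bh; have bhX := bnd_X bh.
rewrite /dot -(@X_law (fun x => h x * h x)); last by bnd_tac.
rewrite -E_scale; last by bnd_tac.
apply: E_le; [by bnd_tac|by bnd_tac|move=> o].
rewrite exprMn -expr2 ler_wpM2r ?sqr_ge0//.
by rewrite -real_normK ?num_real// lerXn2r// nnegrE// (le_trans _ (WC o)).
Qed.

Let mean_moments n (g : U -> R) (c : R) : (0 < n)%N -> bnd g ->
  \int[iid P n]_D ((c + <| what D, g |>) ^+ 2) =
  (c + <| proj mu phi w, g |>) ^+ 2 + n%:R^-1 *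
    (\int[P]_o ((W o * proj mu phi g (X o)) ^+ 2) - <| proj mu phi w, g |> ^+ 2).
Proof.
move=> n0 bg; have bpg := bnd_X (bnd_proj mu bphi g).
rewrite dot_projC// -reg; last exact: bnd_proj.
rewrite -E_iid_mean_sqr//; last by bnd_tac.
by apply: E_eq => D; rewrite dot_series.
Qed.

Lemma bnd_dot_series n g : bnd g -> bnd (fun D : n.-tuple T => <| what D, g |>).
Proof.
move=> bg; under eq_fun do rewrite dot_series//.
have bpg := bnd_X (bnd_proj mu bphi g).
exact: (bnd_mean n (bndM bW bpg)).
Qed.

Lemma E_dot_series_le n g c : (0 < n)%N -> bnd g ->
  \int[iid P n]_D ((c + <| what D, g |>) ^+ 2) <=
  (c + <| proj mu phi w, g |>) ^+ 2
  + n%:R^-1 * (C ^+ 2 * <| proj mu phi g, proj mu phi g |>).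
Proof.
move=> n0 bg; rewrite mean_moments// lerD2l ler_wpM2l ?invr_ge0//.
have := Wh_sqr_le (bnd_proj mu bphi g).
have := sqr_ge0 <| proj mu phi w, g |>; lra.
Qed.

Lemma E_dot_series_ge n g c : (0 < n)%N -> bnd g ->
  (c + <| proj mu phi w, g |>) ^+ 2 <=
  \int[iid P n]_D ((c + <| what D, g |>) ^+ 2).
Proof.
move=> n0 bg; rewrite mean_moments// lerDl mulr_ge0 ?invr_ge0// subr_ge0.
rewrite dot_projC// -reg; last exact: bnd_proj.
apply: E_sqr_le; apply: bndM => //; apply: bnd_X; exact: bnd_proj.
Qed.

(** At a fixed point the estimate is again a sample mean, of the responses
    weighted by the kernel. *)
Lemma E_series_sqr n x : (0 < n)%N ->
  \int[iid P n]_D (what D x ^+ 2) =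
  proj mu phi w x ^+ 2 + n%:R^-1 *
    (\int[P]_o ((W o * repr_kernel phi (X o) x) ^+ 2) - proj mu phi w x ^+ 2).
Proof.
move=> n0; have bk : bnd (fun o => repr_kernel phi (X o) x).
  under eq_fun do rewrite kernelC; apply: bnd_X; exact: bnd_kernel.
have -> : proj mu phi w x = \int[P]_o (W o * repr_kernel phi (X o) x).
  under eq_Rintegral do rewrite kernelC.
  by rewrite (reg (bnd_kernel bphi x)) dotC (dot_kernel mu bphi x bw).
rewrite -[X in _ = X ^+ 2 + _]add0r -E_iid_mean_sqr//; last by bnd_tac.
by apply: E_eq => D; rewrite add0r.
Qed.

Lemma E_series_sqr_le n x (B : R) : (0 < n)%N -> `|proj mu phi w x| <= B ->
  \int[iid P n]_D (what D x ^+ 2) <=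
  B ^+ 2 + n%:R^-1 * (C ^+ 2 * repr_kernel phi x x).
Proof.
move=> n0 wB; rewrite (E_series_sqr _ n0).
have n1 : 0 <= n%:R^-1 :> R by rewrite invr_ge0.
have h1 : proj mu phi w x ^+ 2 <= B ^+ 2.
  by rewrite -real_normK ?num_real// lerXn2r// nnegrE// (le_trans _ wB).
have h2 : \int[P]_o ((W o * repr_kernel phi (X o) x) ^+ 2) <=
    C ^+ 2 * repr_kernel phi x x.
  have := Wh_sqr_le (bnd_kernel bphi x).
  rewrite (dot_kernel mu bphi x (bnd_kernel bphi x)).
  under eq_Rintegral do rewrite kernelC.
  move=> /le_trans; apply; rewrite -(kernel_sqr bphi ophi) le_eqVlt.
  rewrite -(dot_kernel mu bphi x (bnd_kernel bphi x)).
  apply/orP; left; apply/eqP; congr (_ * _); apply: E_eq => y.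
  by rewrite expr2 kernelC.
have h3 := sqr_ge0 (proj mu phi w x).
by apply: lerD => //; apply: ler_wpM2l => //; lra.
Qed.

(** The hypothesis says that the conditional second moment of the response is at
    least [a0]; the noise of the estimate is then of the order of the kernel. *)
Lemma E_series_sqr_ge n x (a0 : R) : (0 < n)%N ->
  (forall h, bnd h -> (forall y, 0 <= h y) ->
     a0 * \int[mu]_y h y <= \int[P]_o (W o ^+ 2 * h (X o))) ->
  n%:R^-1 * (a0 * repr_kernel phi x x) <= \int[iid P n]_D (what D x ^+ 2).
Proof.
move=> n0 W2; rewrite (E_series_sqr _ n0).
have n1 : 0 <= n%:R^-1 :> R by rewrite invr_ge0.
have n2 : n%:R^-1 <= 1 :> R by rewrite invf_le1 ?ltr0n// ler1n.
have h3 := sqr_ge0 (proj mu phi w x).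
have h2 : a0 * repr_kernel phi x x <=
    \int[P]_o ((W o * repr_kernel phi (X o) x) ^+ 2).
  rewrite -(kernel_sqr bphi ophi).
  under [leRHS]eq_Rintegral do rewrite exprMn.
  have bk := bnd_kernel bphi x.
  apply: (W2 (fun y => repr_kernel phi y x ^+ 2)); last by move=> y; exact: sqr_ge0.
  by under eq_fun do rewrite kernelC; bnd_tac.
have h4 := ler_wpM2l n1 h2.
have : 0 <= (1 - n%:R^-1) * proj mu phi w x ^+ 2 by rewrite mulr_ge0// subr_ge0.
lra.
Qed.

End OneSample.

Section TwoSamples.
Variables (I1 I2 : finType) (phi1 : I1 -> U -> R) (phi2 : I2 -> U -> R).
Hypotheses (bphi1 : forall i, bnd (phi1 i)) (bphi2 : forall i, bnd (phi2 i)).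
Hypothesis ophi1 : orthonormal mu predT phi1.
Hypothesis ophi2 : orthonormal mu predT phi2.
Variables (A Y : T -> R) (p b : U -> R) (C : R).
Hypotheses (bA : bnd A) (bY : bnd Y) (bp : bnd p) (bb : bnd b).
Hypotheses (regA : regression P mu X A p) (regY : regression P mu X Y b).
Hypotheses (AC : forall o, `|A o| <= C) (YC : forall o, `|Y o| <= C).
Hypotheses (pC : forall x, `|p x| <= C) (bC : forall x, `|b x| <= C).

Variable n : nat.
Hypothesis n0 : (0 < n)%N.

Local Notation phat := (series X phi1 A (n := n)).
Local Notation bhat := (series X phi2 Y (n := n)).
Local Notation Q := (iid P n).
Local Notation Pi1 := (proj mu phi1).
Local Notation Pi2 := (proj mu phi2).
Local Notation kmin := (minn #|I1| #|I2|)%:R.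

Let bphat D : bnd (phat D). Proof. exact: bnd_series. Qed.
Let bbhat D : bnd (bhat D). Proof. exact: bnd_series. Qed.
Let bPi1 f : bnd (Pi1 f). Proof. exact: bnd_proj. Qed.
Let bPi2 f : bnd (Pi2 f). Proof. exact: bnd_proj. Qed.

Let n_ge0 : 0 <= n%:R^-1 :> R. Proof. by rewrite invr_ge0. Qed.

Let C_ge0 : 0 <= C. Proof. by apply: le_trans (pC point). Qed.

Lemma bnd_phat_x : bnd (fun z : n.-tuple T * n.-tuple T * U => phat z.1.1 z.2).
Proof.
apply: (bnd_comp (h := fun z : n.-tuple T * n.-tuple T * U => (z.1.1, z.2)) _
  (bnd_series2 bphi1 bA n)).
by apply: measurable_fun_pair => //; apply: measurableT_comp.
Qed.

Lemma bnd_bhat_x : bnd (fun z : n.-tuple T * n.-tuple T * U => bhat z.1.2 z.2).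
Proof.
apply: (bnd_comp (h := fun z : n.-tuple T * n.-tuple T * U => (z.1.2, z.2)) _
  (bnd_series2 bphi2 bY n)).
by apply: measurable_fun_pair => //; apply: measurableT_comp.
Qed.

Lemma bnd_DD (F : n.-tuple T * n.-tuple T * U -> R) : bnd F ->
  bnd (fun z : n.-tuple T * n.-tuple T => \int[mu]_x F (z, x)).
Proof. by move=> bF; exact: (bnd_E2 (Q \x Q)%E mu bF). Qed.

Lemma bnd_quartic (s t : R) : bnd (fun z : n.-tuple T * n.-tuple T =>
  \int[mu]_x ((s + t * phat z.1 x ^+ 2) * (s + t * bhat z.2 x ^+ 2))).
Proof.
apply: (@bnd_DD (fun z => (s + t * phat z.1.1 z.2 ^+ 2) * (s + t * bhat z.1.2 z.2 ^+ 2))).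
by have := bnd_phat_x; have := bnd_bhat_x; move=> *; bnd_tac.
Qed.

Lemma bnd_dot_DD u v : bnd u -> bnd v ->
  bnd (fun z : n.-tuple T * n.-tuple T =>
    <| fun x => phat z.1 x - u x, fun x => bhat z.2 x - v x |>).
Proof.
move=> bu bv; apply: (@bnd_DD (fun z => (phat z.1.1 z.2 - u z.2) * (bhat z.1.2 z.2 - v z.2))).
have := bnd_comp (h := @snd (n.-tuple T * n.-tuple T) U) measurable_snd bu.
have := bnd_comp (h := @snd (n.-tuple T * n.-tuple T) U) measurable_snd bv.
have := bnd_phat_x; have := bnd_bhat_x.
by move=> ? ? ? ?; apply: bndM; apply: bndB.
Qed.

(** Two conditional applications of the moment formula. The term that is
    quadratic in the noise is the trace of the product of both projections,
    hence the smaller of the two dimensions. *)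
Lemma E_bilinear_le u v c : bnd u -> bnd v ->
  \int[Q]_D0 \int[Q]_D1
    ((<| fun x => phat D0 x - u x, fun x => bhat D1 x - v x |> - c) ^+ 2) <=
  (<| fun x => Pi1 p x - u x, fun x => Pi2 b x - v x |> - c) ^+ 2
  + n%:R^-1 * (C ^+ 2 * <| fun x => Pi2 b x - v x, fun x => Pi2 b x - v x |>)
  + n%:R^-1 * (C ^+ 2 * (2 * <| u, u |>
      + 2 * (<| p, p |> + n%:R^-1 * (C ^+ 2 * kmin)))).
Proof.
move=> bu bv; set z := fun x => Pi2 b x - v x.
have bz : bnd z by rewrite /z; bnd_tac.
(* The first subsample is held fixed and the second one integrated. *)
have inner D0 : \int[Q]_D1
    ((<| fun x => phat D0 x - u x, fun x => bhat D1 x - v x |> - c) ^+ 2) <=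
    (- <| u, z |> - c + <| phat D0, z |>) ^+ 2
    + n%:R^-1 * (C ^+ 2 * (2 * <| u, u |> +
        2 * \sum_j (0 + <| phat D0, phi2 j |>) ^+ 2)).
  have bw : bnd (fun x => phat D0 x - u x) by bnd_tac.
  set w := fun x => _ in bw *.
  have -> : \int[Q]_D1 ((<| w, fun x => bhat D1 x - v x |> - c) ^+ 2) =
      \int[Q]_D1 ((- <| w, v |> - c + <| bhat D1, w |>) ^+ 2).
    by apply: E_eq => D1; rewrite dotBr// (dotC _ w); congr (_ ^+ 2); ring.
  apply: le_trans (E_dot_series_le bphi2 bY bb regY YC _ n0 bw) _.
  apply: lerD.
    rewrite le_eqVlt; apply/orP; left; apply/eqP; congr (_ ^+ 2).
    rewrite (dotC mu (Pi2 b)) /w /z !dotBl ?dotBr//; try bnd_tac.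
    by ring.
  apply: ler_wpM2l => //; apply: ler_wpM2l; first exact: sqr_ge0.
  have -> : <| Pi2 w, Pi2 w |> = <| fun x => Pi2 (phat D0) x - Pi2 u x,
      fun x => Pi2 (phat D0) x - Pi2 u x |>.
    by apply: E_eq => x; congr (_ * _);
      rewrite /proj -sumrB; apply: eq_bigr => j _; rewrite dotBl// mulrBl.
  apply: le_trans (dot_add_le mu (bPi2 _) (bPi2 _)) _.
  rewrite addrC lerD//.
    by rewrite ler_pM2l// proj_sqr_le.
  by rewrite ler_pM2l// proj_sqr//; apply: ler_sum => j _; rewrite add0r.
have bin : bnd (fun D0 : n.-tuple T => \int[Q]_D1
    ((<| fun x => phat D0 x - u x, fun x => bhat D1 x - v x |> - c) ^+ 2)).
  apply: (bnd_E2 Q Q (f := fun z => (<| fun x => phat z.1 x - u x,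
    fun x => bhat z.2 x - v x |> - c) ^+ 2)).
  by apply: bndX; apply: bndB; [exact: bnd_dot_DD|exact: bnd_cst].
have bds g : bnd g -> bnd (fun D : n.-tuple T => <| phat D, g |>).
  by move=> bg; exact: bnd_dot_series.
apply: le_trans (E_le Q bin _ inner) _.
  apply: bndD; first by have := bds _ bz; bnd_tac.
  apply: bndM; first exact: bnd_cst.
  apply: bndM; first exact: bnd_cst.
  apply: bndD; first exact: bnd_cst.
  apply: bndM; first exact: bnd_cst.
  by apply: bnd_sum => j _; have := bds _ (bphi2 j); bnd_tac.
have bS : bnd (fun D0 : n.-tuple T => \sum_j (0 + <| phat D0, phi2 j |>) ^+ 2).
  by apply: bnd_sum => j _; have := bds _ (bphi2 j); bnd_tac.
rewrite E_add; [|by have := bds _ bz; bnd_tac|by bnd_tac].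
rewrite E_scale; last by bnd_tac.
rewrite E_scale; last by bnd_tac.
rewrite E_add; [|by bnd_tac|by bnd_tac].
rewrite E_cst E_scale//.
apply: lerD.
  apply: le_trans (E_dot_series_le bphi1 bA bp regA AC _ n0 bz) _.
  apply: lerD.
    rewrite le_eqVlt; apply/orP; left; apply/eqP; congr (_ ^+ 2).
    by rewrite dotBl//; ring.
  apply: ler_wpM2l => //; apply: ler_wpM2l; first exact: sqr_ge0.
  exact: proj_sqr_le.
apply: ler_wpM2l => //; apply: ler_wpM2l; first exact: sqr_ge0.
rewrite lerD2l ler_pM2l// E_sum; last first.
  by move=> j _; have := bds _ (bphi2 j); bnd_tac.
apply: (@le_trans _ _ (\sum_j (<| Pi1 p, phi2 j |> ^+ 2 +
    n%:R^-1 * (C ^+ 2 * <| Pi1 (phi2 j), Pi1 (phi2 j) |>)))).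
  apply: ler_sum => j _.
  apply: le_trans (E_dot_series_le bphi1 bA bp regA AC 0 n0 (bphi2 j)) _.
  by rewrite add0r.
rewrite big_split/= -!mulr_sumr; apply: lerD.
  apply: le_trans (Bessel bphi2 ophi2 (bPi1 p)) _; exact: proj_sqr_le.
apply: ler_wpM2l => //; apply: ler_wpM2l; first exact: sqr_ge0.
exact: trace_le.
Qed.

(** Jensen's inequality, once for each subsample: the bias cannot be undone by
    averaging. *)
Lemma E_bilinear_ge c :
  (<| Pi1 p, Pi2 b |> - c) ^+ 2 <=
  \int[Q]_D0 \int[Q]_D1 ((<| phat D0, bhat D1 |> - c) ^+ 2).
Proof.
have b0 : bnd (fun _ : U => 0 : R) by exact: bnd_cst.
have bdd : bnd (fun z : n.-tuple T * n.-tuple T => <| phat z.1, bhat z.2 |>).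
  apply: (@bnd_DD (fun z => phat z.1.1 z.2 * bhat z.1.2 z.2)).
  by apply: bndM; [exact: bnd_phat_x|exact: bnd_bhat_x].
apply: (@le_trans _ _ (\int[Q]_D0 ((- c + <| phat D0, Pi2 b |>) ^+ 2))).
  rewrite addrC; exact: (E_dot_series_ge bphi1 bA bp regA).
apply: E_le.
- by have := bnd_dot_series bphi1 bA n (bPi2 b); bnd_tac.
- apply: (bnd_E2 Q Q (f := fun z => (<| phat z.1, bhat z.2 |> - c) ^+ 2)).
  by bnd_tac.
- move=> D0; rewrite dotC.
  apply: le_trans (E_dot_series_ge bphi2 bY bb regY _ n0 (bphat D0)) _.
  by rewrite le_eqVlt; apply/orP; left; apply/eqP; apply: E_eq => D1; rewrite addrC dotC.
Qed.

(** At each point the two estimates are independent. *)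
Lemma E_quartic (s t : R) :
  \int[Q]_D0 \int[Q]_D1
    \int[mu]_x ((s + t * phat D0 x ^+ 2) * (s + t * bhat D1 x ^+ 2)) =
  \int[mu]_x ((s + t * \int[Q]_D (phat D x ^+ 2)) *
              (s + t * \int[Q]_D (bhat D x ^+ 2))).
Proof.
have bP2 := bnd_series2 bphi1 bA n.
have bB2 := bnd_series2 bphi2 bY n.
have bPx x : bnd (fun D : n.-tuple T => phat D x) by exact: (bnd_section2 x bP2).
have bBx x : bnd (fun D : n.-tuple T => bhat D x) by exact: (bnd_section2 x bB2).
have bEB : bnd (fun x => \int[Q]_D (bhat D x ^+ 2)).
  by apply: (bnd_E1 Q mu (f := fun z => bhat z.1 z.2 ^+ 2)); bnd_tac.
transitivity (\int[Q]_D0 \int[mu]_x ((s + t * phat D0 x ^+ 2) *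
    (s + t * \int[Q]_D (bhat D x ^+ 2)))).
  apply: E_eq => D0.
  rewrite (E_swap Q mu (f := fun z => (s + t * phat D0 z.2 ^+ 2) *
     (s + t * bhat z.1 z.2 ^+ 2))); last first.
    have := bnd_comp (h := @snd (n.-tuple T) U) measurable_snd (bphat D0).
    by move=> h; bnd_tac.
  apply: E_eq => x /=; rewrite E_scale; last by have := bBx x; bnd_tac.
  congr (_ * _); have bx := bBx x; rewrite E_add; try bnd_tac.
  by rewrite E_cst E_scale//; bnd_tac.
rewrite (E_swap Q mu (f := fun z => (s + t * phat z.1 z.2 ^+ 2) *
   (s + t * \int[Q]_D (bhat D z.2 ^+ 2)))); last first.
  have := bnd_comp (h := @snd (n.-tuple T) U) measurable_snd bEB.
  by move=> h; bnd_tac.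
apply: E_eq => x /=; have bx := bPx x; rewrite E_scaler; last by bnd_tac.
congr (_ * _); rewrite E_add; try bnd_tac.
by rewrite E_cst E_scale//; bnd_tac.
Qed.

End TwoSamples.
End Risk.

Section Estimators.
Context d d' (T : measurableType d) (U : measurableType d') (R : realType).
Variables (P : probability T R) (mu : probability U R) (X : T -> U).
Hypothesis mX : measurable_fun setT X.
Hypothesis X_law : forall h, bnd h -> \int[P]_o h (X o) = \int[mu]_x h x.
Variables (I1 I2 : finType) (phi1 : I1 -> U -> R) (phi2 : I2 -> U -> R).
Hypotheses (bphi1 : forall i, bnd (phi1 i)) (bphi2 : forall i, bnd (phi2 i)).
Hypothesis ophi1 : orthonormal mu predT phi1.
Hypothesis ophi2 : orthonormal mu predT phi2.
Variables (A Y : T -> R) (p b : U -> R) (C : R).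
Hypotheses (bA : bnd A) (bY : bnd Y) (bp : bnd p) (bb : bnd b).
Hypotheses (regA : regression P mu X A p) (regY : regression P mu X Y b).
Hypotheses (AC : forall o, `|A o| <= C) (YC : forall o, `|Y o| <= C).
Hypotheses (pC : forall x, `|p x| <= C) (bC : forall x, `|b x| <= C).

Variable n : nat.
Hypothesis n0 : (0 < n)%N.

Local Notation "<| f , g |>" := (dot mu f g) (at level 0, f, g at level 200).
Local Notation phat := (series X phi1 A (n := n)).
Local Notation bhat := (series X phi2 Y (n := n)).
Local Notation Q := (iid P n).
Local Notation Pi1 := (proj mu phi1).
Local Notation Pi2 := (proj mu phi2).
Local Notation kmin := (minn #|I1| #|I2|)%:R.
Local Notation samples := (4.-tuple (n.-tuple T)).

Definition mean_AY (D : n.-tuple T) : R :=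
  n%:R^-1 * \sum_(i < n) A (tnth D i) * Y (tnth D i).

Definition est_INT (D : samples) : R :=
  mean_AY [tnth D 2] - <| phat [tnth D 0], bhat [tnth D 1] |>.

Definition est_MC (D : samples) : R :=
  mean_AY [tnth D 2] - n%:R^-1 * \sum_(i < n)
    phat [tnth D 0] (X (tnth [tnth D 3] i)) *
    bhat [tnth D 1] (X (tnth [tnth D 3] i)).

Definition est_IF (D : samples) : R :=
  n%:R^-1 * \sum_(i < n)
    (A (tnth [tnth D 2] i) - phat [tnth D 0] (X (tnth [tnth D 2] i))) *
    (Y (tnth [tnth D 2] i) - bhat [tnth D 1] (X (tnth [tnth D 2] i))).

(** The mean conditional covariance, since the mean of [p (X o) * b (X o)]
    is that of [A o * b (X o)] and of [p (X o) * Y o]. *)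
Definition target : R := \int[P]_o (A o * Y o) - <| p, b |>.

Definition mse (est : samples -> R) : R :=
  \int[iid (iid P n) 4]_D ((est D - target) ^+ 2).

Let bphat D : bnd (phat D). Proof. exact: bnd_series. Qed.
Let bbhat D : bnd (bhat D). Proof. exact: bnd_series. Qed.
Let bPi1 f : bnd (Pi1 f). Proof. exact: bnd_proj. Qed.
Let bPi2 f : bnd (Pi2 f). Proof. exact: bnd_proj. Qed.
Let n_ge0 : 0 <= n%:R^-1 :> R. Proof. by rewrite invr_ge0. Qed.
Let C_ge0 : 0 <= C. Proof. by apply: le_trans (pC point). Qed.
Let bAY : bnd (fun o => A o * Y o). Proof. by bnd_tac. Qed.
Let VAY : R := \int[P]_o ((A o * Y o) ^+ 2) - (\int[P]_o (A o * Y o)) ^+ 2.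

Let tnth_D (i : 'I_4) : measurable_fun setT (fun D : samples => tnth D i).
Proof. exact: measurable_tnth. Qed.

Lemma bnd_mean_AY (i : 'I_4) : bnd (fun D : samples => mean_AY (tnth D i)).
Proof.
apply: (bnd_comp (h := fun D : samples => tnth D i)) => //.
exact: (bnd_mean n bAY).
Qed.

Lemma bnd_dot_hat : bnd (fun z : n.-tuple T * n.-tuple T => <| phat z.1, bhat z.2 |>).
Proof.
apply: (@bnd_DD _ _ _ _ _ P mu n (fun z => phat z.1.1 z.2 * bhat z.1.2 z.2)).
by apply: bndM; [exact: bnd_phat_x|exact: bnd_bhat_x].
Qed.

Lemma bnd_hat_X (I : finType) (phi : I -> U -> R) (W : T -> R) (i k : 'I_4) (j : 'I_n) :
  (forall i, bnd (phi i)) -> bnd W ->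
  bnd (fun D : samples => series X phi W (tnth D i) (X (tnth (tnth D k) j))).
Proof.
move=> bphi bW; apply: (bnd_comp (h := fun D : samples =>
  (tnth D i, X (tnth (tnth D k) j))) _ (bnd_series2 mX bphi bW n)).
apply: measurable_fun_pair => //; apply: measurableT_comp => //.
by apply: (measurableT_comp (measurable_tnth j)).
Qed.

Let i0 : 'I_4 := @Ordinal 4 0 (erefl true).
Let i1 : 'I_4 := @Ordinal 4 1 (erefl true).
Let i2 : 'I_4 := @Ordinal 4 2 (erefl true).
Let i3 : 'I_4 := @Ordinal 4 3 (erefl true).

Lemma bnd_est_INT : bnd est_INT.
Proof.
apply: (bndB (bnd_mean_AY i2)).
apply: (bnd_comp (h := fun D : samples => (tnth D i0, tnth D i1)) _ bnd_dot_hat).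
by apply: measurable_fun_pair.
Qed.

Lemma bnd_est_MC : bnd est_MC.
Proof.
apply: (bndB (bnd_mean_AY i2)).
apply: bndM; first exact: bnd_cst.
apply: bnd_sum => i _; apply: bndM.
  exact: (bnd_hat_X i0 i3 i bphi1 bA).
exact: (bnd_hat_X i1 i3 i bphi2 bY).
Qed.

Lemma bnd_est_IF : bnd est_IF.
Proof.
apply: bndM; first exact: bnd_cst.
apply: bnd_sum => i _; apply: bndM; apply: bndB.
- exact: (bnd_comp (tnth_D i2) (bnd_tnth i bA)).
- exact: (bnd_hat_X i0 i2 i bphi1 bA).
- exact: (bnd_comp (tnth_D i2) (bnd_tnth i bY)).
- exact: (bnd_hat_X i1 i2 i bphi2 bY).
Qed.

Let bsq est : bnd est -> bnd (fun D : samples => (est D - target) ^+ 2).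
Proof. by move=> h; bnd_tac. Qed.

Lemma VAY_le : 0 <= VAY <= C ^+ 4.
Proof.
apply/andP; split; first by rewrite subr_ge0; exact: E_sqr_le.
rewrite /VAY lerBlDr -[leLHS]addr0 lerD ?sqr_ge0//.
rewrite -(E_cst P (C ^+ 4)); apply: E_le; [by bnd_tac|by bnd_tac|move=> o].
rewrite -real_normK ?num_real// normrM (_ : 4 = 2 * 2)%N// exprM.
by rewrite lerXn2r// ?nnegrE ?mulr_ge0// ?exprn_ge0// expr2 ler_pM.
Qed.

Let mean_AY_sqr c : \int[Q]_D ((mean_AY D - c - target) ^+ 2) =
  (c - <| p, b |>) ^+ 2 + n%:R^-1 * VAY.
Proof.
have -> : (c - <| p, b |>) ^+ 2 = (- c - target + \int[P]_o (A o * Y o)) ^+ 2.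
  by rewrite /target; ring.
rewrite -E_iid_mean_sqr//.
by apply: E_eq => D; rewrite /mean_AY; congr (_ ^+ 2); ring.
Qed.

Lemma mse_INT : mse est_INT =
  \int[Q]_D0 \int[Q]_D1 ((<| phat D0, bhat D1 |> - <| p, b |>) ^+ 2)
  + n%:R^-1 * VAY.
Proof.
rewrite /mse E_iid4; last by exact: bsq bnd_est_INT.
have bdd := bnd_dot_hat.
have bz : bnd (fun z : n.-tuple T * n.-tuple T =>
    (<| phat z.1, bhat z.2 |> - <| p, b |>) ^+ 2) by bnd_tac.
rewrite -[X in _ = _ + X](E_cst Q) -E_add; [|exact: (bnd_E2 Q Q bz)|by bnd_tac].
apply: E_eq => D0.
rewrite -[X in _ = _ + X](E_cst Q) -E_add; [|exact: (bnd_section1 D0 bz)|by bnd_tac].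
apply: E_eq => D1.
rewrite -mean_AY_sqr; apply: E_eq => D2.
by rewrite -[RHS](E_cst Q).
Qed.

Let bMC2 : bnd (fun z : n.-tuple T * n.-tuple T =>
  \int[mu]_x ((phat z.1 x * bhat z.2 x) ^+ 2) - <| phat z.1, bhat z.2 |> ^+ 2).
Proof.
apply: bndB; last by have := bnd_dot_hat; bnd_tac.
apply: (@bnd_DD _ _ _ _ _ P mu n (fun z => (phat z.1.1 z.2 * bhat z.1.2 z.2) ^+ 2)).
by apply: bndX; apply: bndM; [exact: bnd_phat_x|exact: bnd_bhat_x].
Qed.

(** Replacing the exact integral by an empirical mean over a fourth subsample
    adds exactly the conditional variance of that mean. *)
Lemma mse_MC : mse est_MC = mse est_INT + n%:R^-1 *
  \int[Q]_D0 \int[Q]_D1 (\int[mu]_x ((phat D0 x * bhat D1 x) ^+ 2)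
     - <| phat D0, bhat D1 |> ^+ 2).
Proof.
have bF := bsq bnd_est_INT.
rewrite /mse !E_iid4//; last by exact: bsq bnd_est_MC.
rewrite -E_scale; last exact: (bnd_E2 Q Q bMC2).
rewrite -E_add; last 2 first.
- pose G (x : n.-tuple T * n.-tuple T) := \int[Q]_x2 \int[Q]_x3
    ((est_INT [tuple x.1; x.2; x2; x3] - target) ^+ 2).
  have -> : (fun x0 => \int[Q]_x1 \int[Q]_x2 \int[Q]_x3
      ((est_INT [tuple x0; x1; x2; x3] - target) ^+ 2)) =
      fun x0 => \int[Q]_x1 ((<| phat x0, bhat x1 |> - <| p, b |>) ^+ 2 + n%:R^-1 * VAY).
    apply/funext => D0; apply: E_eq => D1; rewrite -mean_AY_sqr.
    by apply: E_eq => D2; rewrite -[RHS](E_cst Q).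
  apply: (bnd_E2 Q Q (f := fun z =>
    (<| phat z.1, bhat z.2 |> - <| p, b |>) ^+ 2 + n%:R^-1 * VAY)).
  by have := bnd_dot_hat; bnd_tac.
- by have := bnd_E2 Q Q bMC2; bnd_tac.
apply: E_eq => D0.
rewrite -E_scale; last exact: (bnd_section1 D0 bMC2).
rewrite -E_add; last 2 first.
- have -> : (fun x1 => \int[Q]_x2 \int[Q]_x3
      ((est_INT [tuple D0; x1; x2; x3] - target) ^+ 2)) =
      fun x1 => ((<| phat D0, bhat x1 |> - <| p, b |>) ^+ 2 + n%:R^-1 * VAY).
    apply/funext => D1; rewrite -mean_AY_sqr.
    by apply: E_eq => D2; rewrite -[RHS](E_cst Q).
  by have := bnd_section1 D0 bnd_dot_hat; bnd_tac.
- exact: (bndM (bnd_cst _ _) (bnd_section1 D0 bMC2)).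
apply: E_eq => D1.
rewrite -[X in _ = _ + X](E_cst Q) -E_add; last 2 first.
- have -> : (fun x2 => \int[Q]_x3 ((est_INT [tuple D0; D1; x2; x3] - target) ^+ 2)) =
      fun x2 => (mean_AY x2 - <| phat D0, bhat D1 |> - target) ^+ 2.
    by apply/funext => D2; rewrite -[RHS](E_cst Q).
  by have := bnd_mean n bAY; rewrite -/mean_AY => h; bnd_tac.
- by bnd_tac.
apply: E_eq => D2.
have bg : bnd (fun o => - (phat D0 (X o) * bhat D1 (X o))).
  by apply: bndN; apply: bndM; apply: bnd_comp.
transitivity (\int[Q]_D3 ((mean_AY D2 - target + n%:R^-1 * \sum_(i < n)
    - (phat D0 (X (tnth D3 i)) * bhat D1 (X (tnth D3 i)))) ^+ 2)).
  apply: E_eq => D3; rewrite /est_MC sumrN; congr (_ ^+ 2).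
  by rewrite /tnth /=; ring.
rewrite (E_iid_mean_sqr P (f := fun o => - (phat D0 (X o) * bhat D1 (X o))))//.
rewrite (@X_law (fun x => - (phat D0 x * bhat D1 x))); last by bnd_tac.
rewrite (@X_law (fun x => (- (phat D0 x * bhat D1 x)) ^+ 2)); last by bnd_tac.
rewrite E_opp; last by bnd_tac.
under [X in _ + n%:R^-1 * (X - _)]eq_Rintegral do rewrite sqrrN.
rewrite (_ : \int[Q]_x3 ((est_INT [tuple D0; D1; D2; x3] - target) ^+ 2) =
  (mean_AY D2 - <| phat D0, bhat D1 |> - target) ^+ 2); last first.
  by rewrite -[RHS](E_cst Q).
by rewrite /dot; ring.
Qed.

(** Given the first two subsamples, [est_IF] is a sample mean whose expectation
    misses the target by the product of the two estimation errors. *)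
Lemma mse_IF : mse est_IF =
  \int[Q]_D0 \int[Q]_D1 (<| fun x => phat D0 x - p x, fun x => bhat D1 x - b x |> ^+ 2
  + n%:R^-1 * (\int[P]_o (((A o - phat D0 (X o)) * (Y o - bhat D1 (X o))) ^+ 2)
     - (\int[P]_o ((A o - phat D0 (X o)) * (Y o - bhat D1 (X o)))) ^+ 2)).
Proof.
rewrite /mse E_iid4; last by exact: bsq bnd_est_IF.
apply: E_eq => D0; apply: E_eq => D1.
have bphX := bnd_comp mX (bphat D0); have bbhX := bnd_comp mX (bbhat D1).
have bf : bnd (fun o => (A o - phat D0 (X o)) * (Y o - bhat D1 (X o))) by bnd_tac.
have -> : <| fun x => phat D0 x - p x, fun x => bhat D1 x - b x |> =
    - target + \int[P]_o ((A o - phat D0 (X o)) * (Y o - bhat D1 (X o))).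
  have -> : \int[P]_o ((A o - phat D0 (X o)) * (Y o - bhat D1 (X o))) =
     \int[P]_o (((A o * Y o - A o * bhat D1 (X o)) - Y o * phat D0 (X o))
         + phat D0 (X o) * bhat D1 (X o)) by apply: E_eq => o; ring.
  rewrite E_add; try bnd_tac.
  rewrite E_sub; try bnd_tac.
  rewrite E_sub; try bnd_tac.
  rewrite regA// regY//.
  rewrite (@X_law (fun x => phat D0 x * bhat D1 x)); last by bnd_tac.
  rewrite /target -/(<| phat D0, bhat D1 |>).
  rewrite dotBl; try bnd_tac.
  rewrite !dotBr; try bnd_tac.
  by rewrite (dotC mu (phat D0) b); ring.
rewrite -E_iid_mean_sqr//; apply: E_eq => D2.
by rewrite -[RHS](E_cst Q); apply: E_eq => D3; rewrite addrC.
Qed.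

Let pp_le : <| p, p |> <= C ^+ 2. Proof. exact: dot_sqr_le. Qed.
Let bb_le : <| b, b |> <= C ^+ 2. Proof. exact: dot_sqr_le. Qed.
Let C4 : C ^+ 4 = C ^+ 2 * C ^+ 2. Proof. by rewrite -exprD. Qed.
Let C2_ge0 : 0 <= C ^+ 2. Proof. exact: sqr_ge0. Qed.

Let E_dot_hat_le c :
  \int[Q]_D0 \int[Q]_D1 ((<| phat D0, bhat D1 |> - c) ^+ 2) <=
  (<| Pi1 p, Pi2 b |> - c) ^+ 2
  + n%:R^-1 * (3 * C ^+ 4 + 2 * C ^+ 4 * (n%:R^-1 * kmin)).
Proof.
have b0 : bnd (fun _ : U => 0 : R) by exact: bnd_cst.
have e (f : U -> R) : (fun x => f x - 0) = f by apply/funext => x; rewrite subr0.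
have := E_bilinear_le mX X_law bphi1 bphi2 ophi1 ophi2 bA bY bp bb regA regY
  AC YC n0 c b0 b0.
rewrite !e => h.
have -> : \int[Q]_D0 \int[Q]_D1 ((<| phat D0, bhat D1 |> - c) ^+ 2) =
  \int[Q]_D0 \int[Q]_D1 ((<| fun x => phat D0 x - 0, fun x => bhat D1 x - 0 |> - c) ^+ 2).
  by apply: E_eq => D0; apply: E_eq => D1; rewrite !e.
apply: le_trans h _.
rewrite -addrA lerD2l -mulrDr ler_wpM2l//.
have -> : <| fun=> 0, fun=> 0 |> = 0.
  by rewrite /dot; under eq_Rintegral do rewrite mulr0; rewrite E_cst.
have h1 := le_trans (proj_sqr_le bphi2 ophi2 bb) bb_le.
have := ler_wpM2l C2_ge0 h1; have := ler_wpM2l C2_ge0 pp_le.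
rewrite C4; nra.
Qed.

(** Exact integration keeps the noise bilinear, so that the smaller of the two
    dimensions is the only one to enter. *)
Lemma mse_INT_le : mse est_INT <= (<| Pi1 p, Pi2 b |> - <| p, b |>) ^+ 2
  + n%:R^-1 * (4 * C ^+ 4 + 2 * C ^+ 4 * (n%:R^-1 * kmin)).
Proof.
rewrite mse_INT; have := E_dot_hat_le <| p, b |>.
have /andP[_ V1] := VAY_le; have := ler_wpM2l n_ge0 V1; lra.
Qed.

Section SupNormBounds.
Variables (B kap1 kap2 : R).
Hypotheses (B1 : forall x, `|Pi1 p x| <= B) (B2 : forall x, `|Pi2 b x| <= B).
Hypotheses (K1 : forall x, repr_kernel phi1 x x <= kap1).
Hypotheses (K2 : forall x, repr_kernel phi2 x x <= kap2).

Let bEP : bnd (fun x => \int[Q]_D (phat D x ^+ 2)).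
Proof.
have := bnd_series2 mX bphi1 bA n => bP2.
by apply: (bnd_E1 Q mu (f := fun z => phat z.1 z.2 ^+ 2)); bnd_tac.
Qed.

Let bEB : bnd (fun x => \int[Q]_D (bhat D x ^+ 2)).
Proof.
have := bnd_series2 mX bphi2 bY n => bP2.
by apply: (bnd_E1 Q mu (f := fun z => bhat z.1 z.2 ^+ 2)); bnd_tac.
Qed.

Lemma E_quartic_le (s t : R) : 0 <= s -> 0 <= t ->
  \int[Q]_D0 \int[Q]_D1
    \int[mu]_x ((s + t * phat D0 x ^+ 2) * (s + t * bhat D1 x ^+ 2)) <=
  (s + t * (B ^+ 2 + n%:R^-1 * (C ^+ 2 * kap1))) *
  (s + t * (B ^+ 2 + n%:R^-1 * (C ^+ 2 * kap2))).
Proof.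
move=> s0 t0; rewrite (E_quartic P mu mX bphi1 bphi2 bA bY)//.
rewrite -[leRHS](E_cst mu); apply: E_le; [by bnd_tac|by bnd_tac|move=> x].
have hP := E_series_sqr_le mX X_law bphi1 ophi1 bA bp regA AC n0 (B1 x).
have hB := E_series_sqr_le mX X_law bphi2 ophi2 bY bb regY YC n0 (B2 x).
have k1 := ler_wpM2l n_ge0 (ler_wpM2l C2_ge0 (K1 x)).
have k2 := ler_wpM2l n_ge0 (ler_wpM2l C2_ge0 (K2 x)).
have P0 : 0 <= \int[Q]_D (phat D x ^+ 2) by apply: E_ge0 => D; exact: sqr_ge0.
have B0 : 0 <= \int[Q]_D (bhat D x ^+ 2) by apply: E_ge0 => D; exact: sqr_ge0.
apply: ler_pM; rewrite ?addr_ge0 ?mulr_ge0//; rewrite lerD2l ler_wpM2l//.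
  by apply: le_trans hP _; rewrite lerD2l.
by apply: le_trans hB _; rewrite lerD2l.
Qed.

(** Sampling the integral adds the mean of [phat ^+ 2 * bhat ^+ 2], to which
    both kernels contribute, divided by the sample size. *)
Lemma mse_MC_le : mse est_MC <= (<| Pi1 p, Pi2 b |> - <| p, b |>) ^+ 2
  + n%:R^-1 * (4 * C ^+ 4 + 2 * C ^+ 4 * (n%:R^-1 * kmin))
  + n%:R^-1 * ((B ^+ 2 + n%:R^-1 * (C ^+ 2 * kap1)) *
               (B ^+ 2 + n%:R^-1 * (C ^+ 2 * kap2))).
Proof.
rewrite mse_MC; apply: lerD; first exact: mse_INT_le.
apply: ler_wpM2l => //.
have := E_quartic_le (lexx 0) ler01; rewrite !add0r !mul1r; apply: le_trans.
have bq := bnd_quartic P mu mX bphi1 bphi2 bA bY n 0 1.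
apply: E_le; [exact: (bnd_E2 Q Q bMC2)|exact: (bnd_E2 Q Q bq)|move=> D0].
apply: E_le; [exact: (bnd_section1 D0 bMC2)|exact: (bnd_section1 D0 bq)|move=> D1].
rewrite lerBlDr -[leLHS]addr0 lerD ?sqr_ge0// le_eqVlt.
by apply/orP; left; apply/eqP; apply: E_eq => x; rewrite !add0r !mul1r exprMn.
Qed.

Lemma mse_IF_le : mse est_IF <=
  <| fun x => Pi1 p x - p x, fun x => Pi2 b x - b x |> ^+ 2
  + n%:R^-1 * (5 * C ^+ 4 + 2 * C ^+ 4 * (n%:R^-1 * kmin))
  + n%:R^-1 * ((2 * C ^+ 2 + 2 * (B ^+ 2 + n%:R^-1 * (C ^+ 2 * kap1))) *
               (2 * C ^+ 2 + 2 * (B ^+ 2 + n%:R^-1 * (C ^+ 2 * kap2)))).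
Proof.
rewrite mse_IF.
have bq := bnd_quartic P mu mX bphi1 bphi2 bA bY n (2 * C ^+ 2) 2.
have bd := bnd_dot_DD P mu mX bphi1 bphi2 bA bY n bp bb.
have bF : bnd (fun z : n.-tuple T * n.-tuple T * T =>
    (A z.2 - phat z.1.1 (X z.2)) * (Y z.2 - bhat z.1.2 (X z.2))).
  have mzX : measurable_fun setT (fun z : n.-tuple T * n.-tuple T * T => (z.1, X z.2)).
    by apply: measurable_fun_pair => //; apply: measurableT_comp.
  have := bnd_comp mzX (bnd_phat_x mX bphi1 bA n).
  have := bnd_comp mzX (bnd_bhat_x mX bphi2 bY n).
  have := bnd_comp (h := @snd (n.-tuple T * n.-tuple T) T) measurable_snd bA.
  have := bnd_comp (h := @snd (n.-tuple T * n.-tuple T) T) measurable_snd bY.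
  by move=> *; bnd_tac.
have bV := bnd_E2 (Q \x Q)%E P (bndX 2 bF); have bM := bnd_E2 (Q \x Q)%E P bF.
have bG1 : bnd (fun z : n.-tuple T * n.-tuple T =>
    (<| fun x => phat z.1 x - p x, fun x => bhat z.2 x - b x |> - 0) ^+ 2) by bnd_tac.
apply: (@le_trans _ _ (\int[Q]_D0 \int[Q]_D1
   ((<| fun x => phat D0 x - p x, fun x => bhat D1 x - b x |> - 0) ^+ 2
   + n%:R^-1 * \int[mu]_x ((2 * C ^+ 2 + 2 * phat D0 x ^+ 2) *
                           (2 * C ^+ 2 + 2 * bhat D1 x ^+ 2))))).
  apply: E_le.
  - apply: (bnd_E2 Q Q (f := fun z =>
      <| fun x => phat z.1 x - p x, fun x => bhat z.2 x - b x |> ^+ 2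
      + n%:R^-1 * (\int[P]_o (((A o - phat z.1 (X o)) * (Y o - bhat z.2 (X o))) ^+ 2)
       - (\int[P]_o ((A o - phat z.1 (X o)) * (Y o - bhat z.2 (X o)))) ^+ 2))).
    by bnd_tac.
  - apply: (bnd_E2 Q Q (f := fun z =>
      (<| fun x => phat z.1 x - p x, fun x => bhat z.2 x - b x |> - 0) ^+ 2
      + n%:R^-1 * \int[mu]_x ((2 * C ^+ 2 + 2 * phat z.1 x ^+ 2) *
                              (2 * C ^+ 2 + 2 * bhat z.2 x ^+ 2)))).
    exact: (bndD bG1 (bndM (bnd_cst _ _) bq)).
  move=> D0; apply: E_le.
  - exact: (bndD (bndX 2 (bnd_section1 D0 bd)) (bndM (bnd_cst _ _)
      (bndB (bnd_section1 D0 bV) (bndX 2 (bnd_section1 D0 bM))))).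
  - exact: (bndD (bnd_section1 D0 bG1) (bndM (bnd_cst _ _) (bnd_section1 D0 bq))).
  move=> D1; rewrite subr0 lerD2l ler_wpM2l//.
  rewrite lerBlDr -[leLHS]addr0 lerD ?sqr_ge0//.
  have bphX := bphat D0; have bbhX := bbhat D1.
  rewrite -(@X_law (fun x => (2 * C ^+ 2 + 2 * phat D0 x ^+ 2) *
                           (2 * C ^+ 2 + 2 * bhat D1 x ^+ 2))); last by bnd_tac.
  have bphX' := bnd_comp mX (bphat D0); have bbhX' := bnd_comp mX (bbhat D1).
  apply: E_le; [by bnd_tac|by bnd_tac|move=> o].
  (* [(a - x) ^+ 2 <= 2 * a ^+ 2 + 2 * x ^+ 2] for each factor. *)
  have sq (x C' : R) : `|x| <= C' -> x ^+ 2 <= C' ^+ 2.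
    by move=> xC; rewrite -real_normK ?num_real// lerXn2r// nnegrE// (le_trans _ xC).
  rewrite exprMn; apply: ler_pM; rewrite ?sqr_ge0//.
    have := sqr_ge0 (A o + phat D0 (X o)); have := sq _ _ (AC o); nra.
  have := sqr_ge0 (Y o + bhat D1 (X o)); have := sq _ _ (YC o); nra.
rewrite (_ : \int[Q]_D0 _ = \int[Q]_D0 (\int[Q]_D1
   ((<| fun x => phat D0 x - p x, fun x => bhat D1 x - b x |> - 0) ^+ 2)
   + n%:R^-1 * \int[Q]_D1 \int[mu]_x ((2 * C ^+ 2 + 2 * phat D0 x ^+ 2) *
                           (2 * C ^+ 2 + 2 * bhat D1 x ^+ 2)))); last first.
  apply: E_eq => D0.
  rewrite -E_scale; last exact: (bnd_section1 D0 bq).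
  rewrite E_add//; first exact: (bnd_section1 D0 bG1).
  exact: (bndM (bnd_cst _ _) (bnd_section1 D0 bq)).
rewrite E_add; [|exact: (bnd_E2 Q Q bG1)|exact: (bndM (bnd_cst _ _) (bnd_E2 Q Q bq))].
rewrite E_scale; last exact: (bnd_E2 Q Q bq).
apply: lerD; last first.
  by apply: ler_wpM2l => //; apply: E_quartic_le => //; rewrite mulr_ge0.
have := E_bilinear_le mX X_law bphi1 bphi2 ophi1 ophi2 bA bY bp bb regA regY
  AC YC n0 0 bp bb.
rewrite [X in _ <= X ^+ 2 + _ + _]subr0 => /le_trans; apply.
rewrite -addrA lerD2l -mulrDr ler_wpM2l//.
have h1 : <| fun x => Pi2 b x - b x, fun x => Pi2 b x - b x |> <= C ^+ 2.
  apply: le_trans (le_trans (proj_residual_le bphi2 ophi2 bb) bb_le).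
  by rewrite le_eqVlt; apply/orP; left; apply/eqP; apply: E_eq => x; ring.
have := ler_wpM2l C2_ge0 h1; have := ler_wpM2l C2_ge0 pp_le.
rewrite C4; nra.
Qed.

End SupNormBounds.

(** Neither sampling noise nor Monte Carlo integration can reduce the error
    below the squared bias. *)
Lemma mse_MC_ge_bias : (<| Pi1 p, Pi2 b |> - <| p, b |>) ^+ 2 <= mse est_MC.
Proof.
rewrite mse_MC mse_INT.
have := E_bilinear_ge mX bphi1 bphi2 bA bY bp bb regA regY n0 <| p, b |>.
have /andP[V0 _] := VAY_le; have := mulr_ge0 n_ge0 V0.
have : 0 <= \int[Q]_D0 \int[Q]_D1 (\int[mu]_x ((phat D0 x * bhat D1 x) ^+ 2)
     - <| phat D0, bhat D1 |> ^+ 2).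
  apply: E_ge0 => D0; apply: E_ge0 => D1; rewrite subr_ge0; apply: E_sqr_le.
  by bnd_tac.
move=> /(mulr_ge0 n_ge0); lra.
Qed.

(** When both resolutions exceed the sample size, the noise in the two
    estimated regressions dominates the Monte Carlo integral. *)
Lemma mse_MC_ge_var (a0 kap1 kap2 : R) : 0 <= a0 -> 0 <= kap1 -> 0 <= kap2 ->
  (forall h, bnd h -> (forall y, 0 <= h y) ->
     a0 * \int[mu]_y h y <= \int[P]_o (A o ^+ 2 * h (X o))) ->
  (forall h, bnd h -> (forall y, 0 <= h y) ->
     a0 * \int[mu]_y h y <= \int[P]_o (Y o ^+ 2 * h (X o))) ->
  {ae mu, forall x, kap1 <= repr_kernel phi1 x x} ->
  {ae mu, forall x, kap2 <= repr_kernel phi2 x x} ->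
  n%:R^-1 * (n%:R^-1 ^+ 2 * a0 ^+ 2 * (kap1 * kap2)
     - C ^+ 4 * (4 + 2 * (n%:R^-1 * kmin))) <= mse est_MC.
Proof.
move=> a00 kap10 kap20 A2 Y2 K1 K2.
have INT0 : 0 <= mse est_INT by apply: E_ge0 => D; exact: sqr_ge0.
(* Only the variance added by the fourth subsample is kept. *)
rewrite mse_MC; apply: le_trans (lerD INT0 (lexx _)); rewrite add0r.
apply: ler_wpM2l => //.
have bq := bnd_quartic P mu mX bphi1 bphi2 bA bY n 0 1.
have bd : bnd (fun z : n.-tuple T * n.-tuple T => (<| phat z.1, bhat z.2 |> - 0) ^+ 2).
  by have := bnd_dot_hat; bnd_tac.
rewrite (_ : \int[Q]_D0 _ = \int[Q]_D0 \int[Q]_D1 \int[mu]_x ((0 + 1 * phat D0 x ^+ 2) *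
    (0 + 1 * bhat D1 x ^+ 2)) - \int[Q]_D0 \int[Q]_D1 ((<| phat D0, bhat D1 |> - 0) ^+ 2));
    last first.
  rewrite -E_sub; [|exact: (bnd_E2 Q Q bq)|exact: (bnd_E2 Q Q bd)].
  apply: E_eq => D0.
  rewrite -E_sub; [|exact: (bnd_section1 D0 bq)|exact: (bnd_section1 D0 bd)].
  apply: E_eq => D1; rewrite subr0; congr (_ - _).
  by apply: E_eq => x; rewrite !add0r !mul1r exprMn.
apply: lerB; last first.
  apply: le_trans (E_dot_hat_le 0) _; rewrite subr0.
  have n1 : n%:R^-1 <= 1 :> R by rewrite invf_le1 ?ltr0n// ler1n.
  have CS := dot_CauchySchwarz mu (bPi1 p) (bPi2 b).
  have h1 := le_trans (proj_sqr_le bphi1 ophi1 bp) pp_le.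
  have h2 := le_trans (proj_sqr_le bphi2 ophi2 bb) bb_le.
  have h3 : <| Pi1 p, Pi2 b |> ^+ 2 <= C ^+ 4.
    by rewrite C4; apply: le_trans CS _; rewrite ler_pM// dot_ge0.
  have k0 : 0 <= n%:R^-1 * kmin :> R by rewrite mulr_ge0.
  have C40 : 0 <= C ^+ 4 by rewrite exprn_ge0.
  have h4 : 0 <= 3 * C ^+ 4 + 2 * C ^+ 4 * (n%:R^-1 * kmin).
    by rewrite addr_ge0// !mulr_ge0.
  have := ler_wpM2r h4 n1; nra.
rewrite (E_quartic P mu mX bphi1 bphi2 bA bY)//.
have bEP : bnd (fun x => \int[Q]_D (phat D x ^+ 2)).
  have := bnd_series2 mX bphi1 bA n => bP2.
  by apply: (bnd_E1 Q mu (f := fun z => phat z.1 z.2 ^+ 2)); bnd_tac.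
have bEB : bnd (fun x => \int[Q]_D (bhat D x ^+ 2)).
  have := bnd_series2 mX bphi2 bY n => bP2.
  by apply: (bnd_E1 Q mu (f := fun z => bhat z.1 z.2 ^+ 2)); bnd_tac.
rewrite -[leLHS](E_cst mu); apply: E_le_ae; [by bnd_tac|by bnd_tac|].
apply: filterS2 K1 K2 => x K1x K2x; rewrite !add0r !mul1r.
have hP := E_series_sqr_ge mX bphi1 ophi1 bA bp regA x n0 A2.
have hB := E_series_sqr_ge mX bphi2 ophi2 bY bb regY x n0 Y2.
have := ler_pM _ _ (le_trans (ler_wpM2l n_ge0 (ler_wpM2l a00 K1x)) hP)
  (le_trans (ler_wpM2l n_ge0 (ler_wpM2l a00 K2x)) hB).
rewrite !mulr_ge0// => /(_ isT isT); apply: le_trans.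
by rewrite le_eqVlt; apply/orP; left; apply/eqP; ring.
Qed.

End Estimators.

(** * The cube and tensor products *)

Section UnitCube.
Variable R : realType.

Lemma unif01E (B : set R) : unif01 R B = uniform_prob (@ltr01 R) B.
Proof. by []. Qed.

Lemma unif01_ge0_integral (f : R -> \bar R) : measurable_fun setT f ->
  (forall x, 0 <= f x)%E ->
  (\int[unif01 R]_x f x = \int[lebesgue_measure]_(x in `[0%R, 1%R]) f x)%E.
Proof.
move=> mf f0; rewrite /unif01 ge0_integral_distribution//.
rewrite (integral_uniform (@ltr01 R) (f := f \o @idTR R))//.
by rewrite subr0 invr1 mul1e.
Qed.

Lemma unif01_itv : unif01 R `[0, 1]%classic = 1%E.
Proof. by rewrite unif01E /uniform_prob integral_uniform_pdf1. Qed.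

Lemma unif01_small (a r : R) : 0 <= r ->
  \int[unif01 R]_t \1_(`[a - r, a + r]%classic) t <= 2 * r.
Proof.
move=> r0; rewrite -lee_fin -EFin_E; last exact: bnd_indic.
rewrite unif01_ge0_integral; last 2 first.
- by apply/measurable_EFinP; exact: measurable_indic.
- by move=> x; rewrite lee_fin indicE.
rewrite integral_indic//.
apply: (@le_trans _ _ (lebesgue_measure `[a - r, a + r]%classic)).
  by apply: le_measure; rewrite ?inE//; first [exact: subIsetl|exact: measurableI].
rewrite lebesgue_measure_itv/=; case: ifPn => _; last by rewrite lee_fin mulr_ge0.
by rewrite -EFinB lee_fin; lra.
Qed.

Variable d : nat.

Lemma measurable_cube : measurable (@cube R d).
Proof.
rewrite (_ : @cube R d = [set t | forall i, `[0, 1]%classic (tnth t i)]).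
  by apply: (@measurable_box _ R d (fun=> `[0, 1]%classic)) => i.
by apply/seteqP; split => x /= h i; have := h i; rewrite in_itv.
Qed.

Lemma ae_cube : {ae unif R d, forall x, cube x}.
Proof.
have := @iid_ae_all _ R R (unif01 R) d `[0, 1]%classic.
move=> /(_ (measurable_itv _) unif01_itv); apply: filterS => x h i.
by have := h i; rewrite /= in_itv.
Qed.

Lemma Rintegral_cube (f : d.-tuple R -> R) : measurable_fun setT f ->
  \int[unif R d]_(x in @cube R d) f x = \int[unif R d]_x f x.
Proof.
move=> mf; rewrite Rintegral_mkcond; apply: E_ae => //.
  apply/(measurable_restrictT _ measurable_cube).
  exact: measurable_funS mf.
by apply: filterS ae_cube => x cx; rewrite patchE mem_set.
Qed.

Lemma ipE (f h : d.-tuple R -> R) : measurable_fun setT f -> measurable_fun setT h ->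
  ip f h = dot (unif R d) f h.
Proof. by move=> mf mh; rewrite /ip Rintegral_cube//; exact: measurable_funM. Qed.

End UnitCube.

Lemma E_iid_prod dd (T : measurableType dd) (R : realType) (P : probability T R)
    d (f : 'I_d -> T -> R) : (forall i, bnd (f i)) ->
  \int[iid P d]_x (\prod_(i < d) f i (tnth x i)) = \prod_(i < d) \int[P]_t f i t.
Proof.
elim: d f => [|d IH] f bf.
  by rewrite big_ord0 -[RHS](E_cst (iid P 0)); apply: E_eq => t; rewrite big_ord0.
rewrite E_iidS; last by apply: bnd_prod => i _; exact: bnd_tnth.
rewrite big_ord_recl -(IH (fun i => f (lift ord0 i)))//.
rewrite -E_scaler//; apply: E_eq => x; rewrite -E_scale.
  apply: E_eq => t; rewrite big_ord_recl tnth_cons0; congr (_ * _).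
  by apply: eq_bigr => i _; rewrite tnth_consS.
by apply: bnd_prod => i _; exact: bnd_tnth.
Qed.

Lemma sum_prod_ffun (R : realType) (d n : nat) (F : 'I_d -> 'I_n -> R) :
  \sum_(m : {ffun 'I_d -> 'I_n}) \prod_i F i (m i) = \prod_i \sum_k F i k.
Proof. by rewrite bigA_distr_bigA. Qed.

(** * Size, support and overlap of the wavelets *)

Lemma card_diam n (S : {set 'I_n}) K :
  (forall m m', m \in S -> m' \in S -> (m' - m <= K)%N) -> (#|S| <= K.+1)%N.
Proof.
move=> diam; have [->|[m1 m1S]] := set_0Vmem S; first by rewrite cards0.
pose m0 := [arg min_(m < m1 | m \in S) (m : nat)].
have [m0S m0min] : m0 \in S /\ forall m, m \in S -> (m0 <= m)%N.
  by rewrite /m0; case: arg_minnP => // m mS mmin; split.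
rewrite -[leqRHS]card_ord -(card_in_imset (f := fun m : 'I_n => inord (m - m0) : 'I_K.+1)).
  exact: max_card.
move=> m m' mS m'S /(congr1 val); rewrite /= !inordK ?ltnS ?diam// => h.
by apply/val_inj => /=; rewrite -(subnK (m0min _ mS)) -(subnK (m0min _ m'S)) h.
Qed.

(** Heights, support lengths and numbers of overlaps, in the units of the
    level. *)
Definition size_bound (R : realType) (g : cdv_generators R) (A : R) :=
  1 <= A /\
  (forall e j m t, (m < 2 ^ j)%N -> `|cdv1 g e j m t| <= A * Num.sqrt (2 ^+ j)) /\
  (forall e j m, (m < 2 ^ j)%N -> exists t0 : R, forall t,
     cdv1 g e j m t != 0 -> 2 ^+ j * `|t - t0| <= A) /\
  (forall e j t, \sum_(m < 2 ^ j) (cdv1 g e j m t != 0)%:R <= A).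

Section WaveletSize.
Variables (R : realType) (d S J0 : nat) (g : cdv_generators R).
Hypothesis g_cdv : cdv_basis d g S J0.

Local Notation sq j := (Num.sqrt (2 ^+ j : R)).

Lemma sq_sqr j : sq j ^+ 2 = 2 ^+ j.
Proof. by rewrite sqr_sqrtr// exprn_ge0. Qed.

Lemma sq_gt0 j : 0 < sq j.
Proof. by rewrite sqrtr_gt0 exprn_gt0. Qed.

Lemma pow2_gt0 j : 0 < 2 ^+ j :> R.
Proof. by rewrite exprn_gt0. Qed.

Lemma generators_bound : exists2 A : R, 1 <= A & forall e,
  (forall t, `|Defs.interior g e t| <= A /\ (A < `|t| -> Defs.interior g e t = 0)) /\
  (forall k, (k < n_left g)%N ->
    forall t, `|left_edge g e k t| <= A /\ (A < `|t| -> left_edge g e k t = 0)) /\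
  (forall k, (k < n_right g)%N ->
    forall t, `|right_edge g e k t| <= A /\ (A < `|t| -> right_edge g e k t = 0)).
Proof.
have fam (I : finType) (f : I -> R -> R) :
    (forall i, bounded_compact_support (f i)) ->
    exists2 A : R, 1 <= A & forall i t, `|f i t| <= A /\ (A < `|t| -> f i t = 0).
  move=> h; pose a i := xget 0 [set A | forall t, `|f i t| <= A /\ (A < `|t| -> f i t = 0)].
  have aP i t : `|f i t| <= a i /\ (a i < `|t| -> f i t = 0).
    have [_ [A hA]] := h i.
    have := @xgetPex _ 0 [set A | forall t, `|f i t| <= A /\ (A < `|t| -> f i t = 0)].
    by apply; exists A.
  exists (1 + \sum_i `|a i|); first by rewrite lerDl sumr_ge0.
  move=> i t; have le_a : a i <= 1 + \sum_i `|a i|.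
    rewrite (le_trans (ler_norm _))// (bigD1 i)//= addrCA lerDl addr_ge0//.
    by rewrite sumr_ge0.
  have [h1 h2] := aP i t; split; first exact: le_trans le_a.
  by move=> h3; apply: h2; exact: le_lt_trans h3.
have [Ai Ai1 hAi] := fam _ (Defs.interior g) (cdv_interior g_cdv).
have [Al Al1 hAl] := fam _ (fun ek : bool * 'I_(n_left g) => left_edge g ek.1 ek.2)
  (fun ek => cdv_left g_cdv ek.1 (ltn_ord ek.2)).
have [Ar Ar1 hAr] := fam _ (fun ek : bool * 'I_(n_right g) => right_edge g ek.1 ek.2)
  (fun ek => cdv_right g_cdv ek.1 (ltn_ord ek.2)).
have weak (f : R -> R) (A A' : R) t : A <= A' ->
   `|f t| <= A /\ (A < `|t| -> f t = 0) -> `|f t| <= A' /\ (A' < `|t| -> f t = 0).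
  move=> AA' [h1 h2]; split; first exact: le_trans AA'.
  by move=> h3; apply: h2; exact: le_lt_trans h3.
exists (Ai + Al + Ar); first by lra.
move=> e; split; [|split].
- by move=> t; apply: weak (hAi e t); lra.
- by move=> k kn t; apply: weak (hAl (e, Ordinal kn) t); lra.
- by move=> k kn t; apply: weak (hAr (e, Ordinal kn) t); lra.
Qed.

Lemma bcs_bnd (f : R -> R) : bounded_compact_support f -> bnd f.
Proof. by move=> [mf [A hA]]; split => //; exists A => t; have [] := hA t. Qed.

Let right_index j m : (m < 2 ^ j)%N -> (2 ^ j - n_right g <= m)%N ->
  ((2 ^ j - m).-1 < n_right g)%N.
Proof.
by move=> mj mr; lia.
Qed.

Lemma bnd_cdv1 e j m : (m < 2 ^ j)%N -> bnd (cdv1 g e j m).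
Proof.
move=> mj; have aff (a b : R) : measurable_fun setT (fun t : R => a * t + b).
  by apply: measurable_funD => //; exact: mulrl_measurable.
apply: (bndM (bnd_cst _ (Num.sqrt (2 ^+ j)))).
case: (ltnP m (n_left g)) => [ml|_] /=.
  apply: (bnd_comp (h := fun t : R => 2 ^+ j * t) _ (bcs_bnd (cdv_left g_cdv e ml))).
  exact: mulrl_measurable.
case: (ltnP m (2 ^ j - n_right g)) => [_|mr] /=.
  apply: (bnd_comp (h := fun t : R => 2 ^+ j * t - m%:R) _
    (bcs_bnd (cdv_interior g_cdv e))).
  exact: aff.
apply: (bnd_comp (h := fun t : R => 2 ^+ j * (1 - t)) _
  (bcs_bnd (cdv_right g_cdv e (right_index mj mr)))).
rewrite (_ : (fun t => _) = (fun t => - 2 ^+ j * t + 2 ^+ j)); first exact: aff.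
by apply/funext => t; ring.
Qed.

(** The edge functions are finitely many, and a point lies in the supports of
    boundedly many integer translates of the interior generator. *)
Lemma cdv1_size : exists A, size_bound g A.
Proof.
have [A A1 hA] := generators_bound.
have A0 : 0 <= A by lra.
pose K := (Num.truncn (2 * A)).+1.
pose N := (K.+1 + (n_left g).+1 + (n_right g).+1)%N.
exists (A + N%:R); split; first by rewrite (le_trans A1)// lerDl.
have le_A : A <= A + N%:R by rewrite lerDl.
split; [|split].
- move=> e j m t mj; have [hi [hl hr]] := hA e.
  have s0 := ltW (sq_gt0 j).
  rewrite /cdv1 normrM (ger0_norm s0) mulrC ler_wpM2r//.
  apply: le_trans le_A.
  case: (ltnP m (n_left g)) => [ml|_]; first by have [] := hl _ ml (2 ^+ j * t).
  case: (ltnP m (2 ^ j - n_right g)) => [_|mr]; first by have [] := hi (2 ^+ j * t - m%:R).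
  by have [] := hr _ (right_index mj mr) (2 ^+ j * (1 - t)).
- move=> e j m mj; have [hi [hl hr]] := hA e.
  have p0 := pow2_gt0 j.
  have nz (f : R -> R) u : (`|f u| <= A /\ (A < `|u| -> f u = 0)) -> f u != 0 -> `|u| <= A.
    by move=> [_ h2]; apply: contraNle => /h2 ->.
  rewrite /cdv1; case: (ltnP m (n_left g)) => [ml|_] /=.
    exists 0 => t; rewrite mulf_eq0 negb_or => /andP[_ /(nz _ _ (hl _ ml _))].
    by rewrite subr0 normrM gtr0_norm// => h; exact: le_trans le_A.
  case: (ltnP m (2 ^ j - n_right g)) => [_|mr] /=.
    exists (m%:R / 2 ^+ j) => t; rewrite mulf_eq0 negb_or => /andP[_ /(nz _ _ (hi _))].
    move=> h; apply: le_trans le_A; apply: le_trans h.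
    rewrite -{1}(gtr0_norm p0) -normrM mulrBr mulrCA divff ?mulr1//.
  exists 1 => t; rewrite mulf_eq0 negb_or => /andP[_ /(nz _ _ (hr _ (right_index mj mr) _))].
  move=> h; apply: le_trans le_A; apply: le_trans h.
  by rewrite normrM gtr0_norm// distrC.
- move=> e j t; have [hi [hl hr]] := hA e.
  apply: (@le_trans _ _ N%:R); last by rewrite lerDr.
  pose L : {set 'I_(2 ^ j)} := [set m : 'I_(2 ^ j) | (m < n_left g)%N]%SET.
  pose I : {set 'I_(2 ^ j)} := [set m : 'I_(2 ^ j) | `|2 ^+ j * t - m%:R| <= A]%SET.
  pose Q : {set 'I_(2 ^ j)} := [set m : 'I_(2 ^ j) | (2 ^ j - n_right g <= m)%N]%SET.
  pose V : {set 'I_(2 ^ j)} := [set m : 'I_(2 ^ j) | cdv1 g e j m t != 0]%SET.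
  have -> : \sum_(m < 2 ^ j) (cdv1 g e j m t != 0)%:R = #|V|%:R :> R.
    rewrite -sum1_card natr_sum [RHS]big_mkcond/=; apply: eq_bigr => m _.
    by rewrite inE; case: (_ != _).
  rewrite ler_nat.
  have VLIQ : V \subset (I :|: L :|: Q)%SET.
    apply/fintype.subsetP => m; rewrite !inE => nz.
    case: (ltnP m (n_left g)) => ml; first by rewrite orbT.
    case: (leqP (2 ^ j - n_right g) m) => mr; first by rewrite !orbT.
    rewrite !orbF; move: nz; rewrite /cdv1 ltnNge ml mr/= mulf_eq0 negb_or.
    by move=> /andP[_]; have [_ h] := hi (2 ^+ j * t - m%:R); apply: contraNle => /h ->.
  apply: leq_trans (subset_leq_card VLIQ) _.
  apply: leq_trans (leq_card_setU _ _) _; apply: leq_add.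
    apply: leq_trans (leq_card_setU _ _) _; apply: leq_add.
      apply: card_diam => m m'; rewrite !inE => h h'.
      have : (m'%:R - m%:R <= 2 * A :> R).
        by move: h h'; rewrite !ler_norml => /andP[? ?] /andP[? ?]; lra.
      case: (leqP m m') => mm'; last by move/ltnW: mm'; rewrite -subn_eq0 => /eqP ->.
      move=> h2; apply: ltnW; rewrite -(ltr_nat R) natrB//.
      exact: le_lt_trans h2 (truncnS_gt _).
    by apply: card_diam => m m'; rewrite !inE => h h'; rewrite leq_subLR (leq_trans (ltnW h'))// leq_addl.
  apply: card_diam => m m'; rewrite !inE => h h'.
  have := ltn_ord m'; move: h; rewrite !leq_subLR => h /ltnW h2.
  by rewrite (leq_trans h2)// addnC.
Qed.

End WaveletSize.

(** * Tensor product wavelets *)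

(** [Phi] as an indexed family of functions, the form in which projections and
    kernels take an orthonormal system. *)
Definition scal (R : realType) d (g : cdv_generators R) j (m : Zidx d j) :
  d.-tuple R -> R := Phi g m.
Arguments scal {R d} g j m x.

Section TensorWavelets.
Variables (R : realType) (d S J0 : nat) (g : cdv_generators R).
Hypothesis g_cdv : cdv_basis d g S J0.
Variable A : R.
Hypothesis A_size : size_bound g A.

Local Notation sq j := (Num.sqrt (2 ^+ j : R)).
Local Notation mu := (unif R d).
Local Notation scal := (@scal R d g).
Local Notation "<| f , h |>" := (dot mu f h) (at level 0, f, h at level 200).

Let A_ge1 : 1 <= A. Proof. by have [] := A_size. Qed.
Let A_ge0 : 0 <= A. Proof. exact: le_trans ler01 A_ge1. Qed.
Let sq0 j : 0 < sq j. Proof. exact: sq_gt0. Qed.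
Let cdv1_le e j m t : (m < 2 ^ j)%N -> `|cdv1 g e j m t| <= A * sq j.
Proof. by have [_ [h _]] := A_size; exact: h. Qed.

Let cdv1_overlap e j t : \sum_(m < 2 ^ j) (cdv1 g e j m t != 0)%:R <= A.
Proof. by have [_ [_ [_ h]]] := A_size; exact: h. Qed.

(** The support of a wavelet has length at most [2 A / 2 ^ j]. *)
Lemma cdv1_supp_integral e j m (F : R -> R) (B : R) : (m < 2 ^ j)%N -> bnd F ->
  0 <= B -> (forall t, cdv1 g e j m t != 0 -> `|F t| <= B) ->
  (forall t, cdv1 g e j m t = 0 -> F t = 0) ->
  \int[unif01 R]_t `|F t| <= B * (2 * A / 2 ^+ j).
Proof.
move=> mj bF B0 FB F0; have [_ [_ [supp _]]] := A_size.
have [t0 ht0] := supp e j m mj; have p0 := pow2_gt0 R j.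
pose r := A / 2 ^+ j; have r0 : 0 <= r by rewrite divr_ge0// ltW.
have bi : bnd (\1_(`[t0 - r, t0 + r]%classic) : R -> R).
  by apply: bnd_indic; exact: measurable_itv.
apply: (@le_trans _ _ (\int[unif01 R]_t (B * \1_(`[t0 - r, t0 + r]%classic) t))).
  apply: E_le; [by bnd_tac|by bnd_tac|move=> t].
  have [c0|cn0] := eqVneq (cdv1 g e j m t) 0.
    by rewrite F0// normr0 mulr_ge0// indicE.
  rewrite indicE mem_set ?mulr1; first exact: FB.
  have := ht0 t cn0; rewrite mulrC -ler_pdivlMr// -/r ler_norml /= in_itv /=.
  by move=> /andP[? ?]; apply/andP; split; lra.
rewrite E_scale//; apply: ler_wpM2l => //.
by have := unif01_small t0 r0; rewrite /r; lra.
Qed.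

Lemma cdv1_L1 e j m : (m < 2 ^ j)%N ->
  \int[unif01 R]_t `|cdv1 g e j m t| <= 2 * A ^+ 2 / sq j.
Proof.
move=> mj; have bc := bnd_cdv1 g_cdv e mj.
have := @cdv1_supp_integral e j m (cdv1 g e j m) (A * sq j) mj bc.
rewrite mulr_ge0// ?(ltW (sq0 j))// => /(_ isT).
move=> /(_ (fun t _ => cdv1_le e t mj) (fun t h => h)) /le_trans; apply.
rewrite le_eqVlt; apply/orP; left; apply/eqP.
have := sq_sqr R j; have := sq0 j; set s := sq j => s0 <-; field.
by rewrite lt0r_neq0.
Qed.

Lemma bnd_wav io j (m : Zidx d j) : bnd (wav g io m).
Proof. by apply: bnd_prod => i _; apply: bnd_tnth; exact: (bnd_cdv1 g_cdv). Qed.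

Lemma wav_L1 io j (m : Zidx d j) :
  \int[mu]_x `|wav g io m x| <= (2 * A ^+ 2 / sq j) ^+ d.
Proof.
have -> : \int[mu]_x `|wav g io m x| =
    \prod_(i < d) \int[unif01 R]_t `|cdv1 g (io i) j (m i) t|.
  rewrite -E_iid_prod; last by move=> i; apply: bnd_abs; exact: (bnd_cdv1 g_cdv).
  by apply: E_eq => x; rewrite /wav normr_prod.
rewrite -[d in leRHS]card_ord -prodr_const; apply: ler_prod => i _.
by rewrite cdv1_L1// andbT; apply: E_ge0.
Qed.

Lemma dot_wav_le io j (m : Zidx d j) f (C : R) : bnd f -> (forall x, `|f x| <= C) ->
  `|<| f, wav g io m |>| <= C * (2 * A ^+ 2 / sq j) ^+ d.
Proof.
move=> bf fC; have bw := bnd_wav io m.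
have C0 : 0 <= C by apply: le_trans (fC point).
apply: le_trans (le_normr_Rintegral _ (bnd_integrable mu (bndM bf bw))) _ => //.
apply: (@le_trans _ _ (\int[mu]_x (C * `|wav g io m x|))).
  by apply: E_le; [bnd_tac|bnd_tac|move=> x; rewrite normrM ler_wpM2r].
by rewrite E_scale; [rewrite ler_wpM2l// wav_L1|bnd_tac].
Qed.

Lemma bnd_scal j m : bnd (scal j m).
Proof. exact: bnd_wav. Qed.

Lemma card_Zidx j : #|Zidx d j| = ((2 ^ j) ^ d)%N.
Proof. by rewrite card_ffun !card_ord. Qed.

Lemma ip_dot f h : bnd f -> bnd h -> ip f h = <| f, h |>.
Proof. by move=> bf bh; apply: ipE; [exact: bf.1|exact: bh.1]. Qed.

Lemma scal_orthonormal j : (J0 <= j)%N -> orthonormal mu predT (scal j).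
Proof.
move=> J0j m m' _ _; rewrite -ip_dot; [|exact: bnd_scal|exact: bnd_scal].
exact: (cdv_orthonormal_Phi g_cdv J0j).
Qed.

(** Sums over the scaling functions factor over the coordinates. *)
Lemma sum_scal (F : R -> R) j x : (forall a b, F (a * b) = F a * F b) -> F 1 = 1 ->
  \sum_m F (scal j m x) =
  \prod_(i < d) \sum_(k < 2 ^ j) F (cdv1 g false j k (tnth x i)).
Proof.
move=> FM F1; rewrite -sum_prod_ffun; apply: eq_bigr => m _.
rewrite (big_morph F FM F1); apply: eq_bigr => i _.
by rewrite ffunE.
Qed.

Lemma sum_scal_le (F : R -> R) (B : R) j x :
  (forall a b, F (a * b) = F a * F b) -> F 1 = 1 -> (forall a, 0 <= F a) -> F 0 = 0 ->
  0 <= B -> (forall k t, (k < 2 ^ j)%N -> F (cdv1 g false j k t) <= B) ->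
  \sum_m F (scal j m x) <= (A * B) ^+ d.
Proof.
move=> FM F1 F0 F00 B0 FB; rewrite sum_scal// -[d in leRHS]card_ord -prodr_const.
apply: ler_prod => i _; rewrite sumr_ge0//=.
apply: (@le_trans _ _ (\sum_(k < 2 ^ j) ((cdv1 g false j k (tnth x i) != 0)%:R * B))).
  apply: ler_sum => k _; case: eqP => [->|_]; first by rewrite F00 mul0r.
  by rewrite mul1r FB.
by rewrite -mulr_suml ler_wpM2r.
Qed.

Lemma scal_kernel_le j x : repr_kernel (scal j) x x <= (A ^+ 3) ^+ d * (2 ^+ j) ^+ d.
Proof.
have -> : repr_kernel (scal j) x x = \sum_m (scal j m x) ^+ 2.
  by apply: eq_bigr => m _; rewrite expr2.
rewrite -exprMn.
have -> : A ^+ 3 * 2 ^+ j = A * (A * sq j) ^+ 2.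
  by have := sq_sqr R j; set s := sq j => <-; ring.
apply: (@sum_scal_le (fun a => a ^+ 2)) => //.
- by move=> a b; rewrite exprMn.
- by rewrite expr1n.
- by move=> a; exact: sqr_ge0.
- by rewrite expr0n.
- by rewrite sqr_ge0.
- move=> k t kj; rewrite -real_normK ?num_real// lerXn2r//; last exact: cdv1_le.
  by rewrite nnegrE mulr_ge0// ltW.
Qed.

Lemma sum_abs_scal_le j x : \sum_m `|scal j m x| <= (A * (A * sq j)) ^+ d.
Proof.
apply: (@sum_scal_le (fun a => `|a|)) => //.
- by move=> a b; rewrite normrM.
- by rewrite normr1.
- by rewrite normr0.
- by rewrite mulr_ge0// ltW.
- by move=> k t kj; exact: cdv1_le.
Qed.

(** The coefficients are bounded by the integrals of the scaling functions, and
    only boundedly many of these are nonzero at a point. *)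
Lemma proj_scal_sup j f (C : R) x : bnd f -> (forall x, `|f x| <= C) ->
  `|proj mu (scal j) f x| <= C * (2 * A ^+ 4) ^+ d.
Proof.
move=> bf fC; apply: le_trans (ler_norm_sum _ _ _) _.
have C0 : 0 <= C by apply: le_trans (fC point).
apply: (@le_trans _ _ (\sum_m (C * (2 * A ^+ 2 / sq j) ^+ d) * `|scal j m x|)).
  by apply: ler_sum => m _; rewrite normrM ler_wpM2r// dot_wav_le.
rewrite -mulr_sumr -mulrA ler_wpM2l//.
have s1 : 0 <= (2 * A ^+ 2 / sq j) ^+ d.
  by rewrite exprn_ge0// divr_ge0// ?mulr_ge0// ?exprn_ge0// ltW.
apply: le_trans (ler_wpM2l s1 (sum_abs_scal_le j x)) _.
rewrite -exprMn le_eqVlt; apply/orP; left; apply/eqP; congr (_ ^+ d).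
by field; rewrite lt0r_neq0.
Qed.

Lemma in_V1 : (1 <= S)%N -> in_V g J0 (fun _ : d.-tuple R => 1).
Proof.
move=> S1; have := cdv_regular g_cdv (leqnn J0) (a := [ffun=> 0%N]).
rewrite big1 => [/(_ S1)|i _]; last by rewrite ffunE.
move=> [c hc]; exists c; apply: filterS hc => x <-.
by rewrite big1// => i _; rewrite ffunE expr0.
Qed.

Lemma in_VD j (f h : d.-tuple R -> R) : in_V g j f -> in_V g j h ->
  in_V g j (fun x : d.-tuple R => f x + h x).
Proof.
move=> [c hc] [e he]; exists (fun m => c m + e m); apply: filterS2 hc he => x -> ->.
by rewrite -big_split; apply: eq_bigr => m _; rewrite /= mulrDl.
Qed.

Lemma in_VZ j a (f : d.-tuple R -> R) : in_V g j f -> in_V g j (fun x : d.-tuple R => a * f x).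
Proof.
move=> [c hc]; exists (fun m => a * c m); apply: filterS hc => x ->.
by rewrite mulr_sumr; apply: eq_bigr => m _; rewrite mulrA.
Qed.

Lemma in_V0 j : in_V g j (fun _ : d.-tuple R => 0).
Proof.
by exists (fun=> 0); apply: aeW => x; rewrite big1// => m _; rewrite mul0r.
Qed.

Lemma in_V_sum j (I : Type) (r : seq I) (P : pred I) (F : I -> d.-tuple R -> R) :
  (forall i, P i -> in_V g j (F i)) -> in_V g j (fun x => \sum_(i <- r | P i) F i x).
Proof.
move=> hF; elim: r => [|i r IH].
  by under eq_fun do rewrite big_nil; exact: in_V0.
case Pi : (P i); last by under eq_fun do rewrite big_cons Pi.
by under eq_fun do rewrite big_cons Pi; apply: in_VD => //; exact: hF.
Qed.

Lemma in_V_ae j (f h : d.-tuple R -> R) : {ae mu, forall x, f x = h x} -> in_V g j h -> in_V g j f.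
Proof. by move=> fh [c hc]; exists c; apply: filterS2 fh hc => x -> ->. Qed.

Lemma in_V_mono j j' (f : d.-tuple R -> R) : (J0 <= j <= j')%N -> in_V g j f -> in_V g j' f.
Proof.
move=> /andP[J0j]; elim: j' => [|j' IH]; first by rewrite leqn0 => /eqP <-.
rewrite leq_eqVlt => /predU1P[<-//|jj'] fV.
have [c hc] := IH jj' fV; apply: in_V_ae hc _.
apply: in_V_sum => m _; apply: in_VZ; apply: (cdv_nested g_cdv).
exact: (leq_trans J0j jj').
Qed.

Lemma scal_nested j j' : (J0 <= j <= j')%N -> nested mu (scal j) (scal j').
Proof.
move=> jj' m; have [J0j] := andP jj'.
rewrite leq_eqVlt => /predU1P[e|lt_jj'].
  by subst j'; exists (fun k => (k == m)%:R); apply: aeW => x; rewrite (bigD1 m)//= eqxx mul1r big1 ?addr0// => k /negbTE ->; rewrite mul0r.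
have h := cdv_nested g_cdv (iota0 d) m J0j.
by apply: (in_V_mono (j := j.+1)) h; rewrite ltnW ?ltnS.
Qed.

End TensorWavelets.

(** * Approximation by the scaling spaces *)

Lemma bnd_Lfun2 dd (T : measurableType dd) (R : realType) (P : probability T R)
  (f : T -> R) : bnd f -> f \in Lfun P 2%:E.
Proof.
move=> bf; rewrite inE; apply/andP; split; rewrite inE /=; first exact: bf.1.
rewrite /finite_norm unlock poweR_lty//.
have -> : (\int[P]_x (`|(EFin \o f) x| `^ 2) = (\int[P]_x (`|f x| ^+ 2))%:E)%E.
  rewrite -EFin_E; last by bnd_tac.
  by apply: eq_integral => x _; rewrite /= powR_mulrn.
exact: ltry.
Qed.

Section Approximation.
Variables (R : realType) (d S J0 : nat) (g : cdv_generators R).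
Hypothesis g_cdv : cdv_basis d g S J0.
Variable A : R.
Hypothesis A_size : size_bound g A.

Local Notation sq j := (Num.sqrt (2 ^+ j : R)).
Local Notation mu := (unif R d).
Local Notation "<| f , h |>" := (dot mu f h) (at level 0, f, h at level 200).
Local Notation scal := (@scal R d g).

Let A_ge1 : 1 <= A. Proof. by have [] := A_size. Qed.
Let A_ge0 : 0 <= A. Proof. exact: le_trans ler01 A_ge1. Qed.
Let A_gt0 : 0 < A. Proof. exact: lt_le_trans ltr01 A_ge1. Qed.
Let sq0 j : 0 < sq j. Proof. exact: sq_gt0. Qed.
Let bscal j m : bnd (scal j m). Proof. exact: (bnd_scal g_cdv). Qed.
Let bwav io j (m : Zidx d j) : bnd (wav g io m). Proof. exact: (bnd_wav g_cdv). Qed.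
Let oscal j : (J0 <= j)%N -> orthonormal mu predT (scal j).
Proof. exact: (scal_orthonormal g_cdv). Qed.

(** The constant [1] lies in every scaling space: at almost every point it is a
    sum of boundedly many terms with coefficients of order [a], so the scaling
    functions cannot all be small there. *)
Lemma scal_kernel_ge j : (1 <= S)%N -> (J0 <= j)%N ->
  {ae mu, forall x, ((4 * A ^+ 5) ^+ d)^-1 * (2 ^+ j) ^+ d <= repr_kernel (scal j) x x}.
Proof.
move=> S1 J0j.
have [c hc] : in_V g j (fun _ : d.-tuple R => 1).
  by apply: (in_V_mono g_cdv (j := J0)) (in_V1 g_cdv S1); rewrite leqnn.
pose a := (2 * A ^+ 2 / sq j) ^+ d.
have a0 : 0 < a by rewrite exprn_gt0// divr_gt0// mulr_gt0// exprn_gt0.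
have ca m : `|c m| <= a.
  have -> : c m = <| fun=> 1, scal j m |>.
    rewrite (dot_ae (bnd_cst _ 1) (bnd_comb (@bscal j) predT c) (bscal m) hc).
    rewrite (dot_suml mu predT c (@bscal j) (bscal m)) (bigD1 m)//=.
    rewrite oscal// eqxx mulr1 big1 ?addr0// => k /negbTE km.
    by rewrite oscal// km mulr0.
  have := dot_wav_le g_cdv A_size (iota0 d) m (C := 1) (bnd_cst _ 1).
  by rewrite mul1r; apply => x; rewrite normr1.
pose th := a ^+ 2 * A ^+ d.
have th0 : 0 < th by rewrite mulr_gt0// exprn_gt0.
apply: filterS hc => x hx.
have -> : ((4 * A ^+ 5) ^+ d)^-1 * (2 ^+ j) ^+ d = th^-1.
  rewrite /th /a (exprAC _ d 2) -[X in _ = X^-1]exprMn -!exprVn -exprMn; congr (_ ^+ d).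
  have := sq_sqr R j; have := sq0 j; set s := sq j => s0 <-; field.
  by rewrite !lt0r_neq0.
have ov : \sum_m (scal j m x != 0)%:R <= A ^+ d.
  have := @sum_scal_le R d g A A_size (fun a => (a != 0)%:R) 1 j x.
  rewrite mulr1; apply => //.
  - by move=> u v; rewrite mulf_eq0 negb_or; case: (u == 0); case: (v == 0); rewrite /= ?mulr0 ?mulr1.
  - by rewrite oner_eq0.
  - by rewrite eqxx.
  - by move=> k t _; case: (_ != 0).
(* Each term obeys [a * `|u| <= (th * u ^+ 2 + a ^+ 2 / th) / 2]; this [th]
   makes the sum of the second parts equal to [1]. *)
have : 1 <= 2^-1 * (th * repr_kernel (scal j) x x + a ^+ 2 / th * A ^+ d).
  rewrite [leLHS]hx.
  apply: (@le_trans _ _ (\sum_m (2^-1 * (th * (scal j m x * scal j m x)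
      + a ^+ 2 / th * (scal j m x != 0)%:R)))).
    apply: ler_sum => m _; set u := scal j m x.
    have -> : Phi g m x = u by [].
    apply: le_trans (ler_norm _) _; rewrite normrM.
    have [->|u0] := eqVneq u 0; first by rewrite normr0 !mulr0 addr0 mulr0.
    apply: (@le_trans _ _ (a * `|u|)); first by rewrite ler_wpM2r.
    rewrite mulr1 -[u * u]expr2 -[u ^+ 2]real_normK ?num_real//.
    have := sqr_ge0 (th * `|u| - a) => h.
    rewrite -subr_ge0.
    have -> : 2^-1 * (th * `|u| ^+ 2 + a ^+ 2 / th) - a * `|u| =
       (2 * th)^-1 * (th * `|u| - a) ^+ 2 by field; rewrite lt0r_neq0.
    by rewrite mulr_ge0// invr_ge0 mulr_ge0// ltW.
  rewrite -mulr_sumr big_split/= -!mulr_sumr ler_pM2l ?invr_gt0// lerD2l.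
  by rewrite ler_wpM2l// divr_ge0 ?sqr_ge0// ltW.
have -> : a ^+ 2 / th * A ^+ d = 1.
  by rewrite mulrAC divff// lt0r_neq0.
move=> h; rewrite -[leLHS]mul1r ler_pdivrMr// mulrC; lra.
Qed.

(** Orthogonality to the coarsest scaling space: polynomials of degree less than
    [S] lie in it, so these are the vanishing moments. *)
Lemma in_V_dot_wav0 l io (m : Zidx d l) h : (J0 <= l)%N -> io != iota0 d ->
  bnd h -> in_V g J0 h -> <| h, wav g io m |> = 0.
Proof.
move=> J0l io0 bh [c hc].
rewrite (dot_ae bh (bnd_comb (@bscal J0) predT c) (bwav io m) hc).
rewrite (dot_suml mu predT c (@bscal J0) (bwav io m)) big1// => k _.
rewrite -(ip_dot (bscal k) (bwav io m)).
by rewrite (cdv_orthogonal_Phi_Psi g_cdv J0l io0) mulr0.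
Qed.

Lemma poly_in_V (T : {poly R}) (i : 'I_d) : (size T <= S)%N ->
  in_V g J0 (fun x : d.-tuple R => T.[tnth x i]).
Proof.
move=> sT; apply: (in_V_ae (h := fun x => \sum_(k < size T) T`_k * tnth x i ^+ k)).
  by apply: aeW => x; rewrite horner_coef.
apply: in_V_sum => k _; apply: in_VZ.
have := cdv_regular g_cdv (leqnn J0) (a := [ffun i' => if i' == i then k : nat else 0%N]).
rewrite (bigD1 i)//= ffunE eqxx big1 => [|i' /negbTE ii']; last by rewrite ffunE ii'.
rewrite addn0 => /(_ (leq_trans (ltn_ord k) sT)).
apply: in_V_ae; apply: aeW => x.
rewrite (bigD1 i)//= ffunE eqxx big1 ?mulr1// => i' /negbTE ii'.
by rewrite ffunE ii' expr0.
Qed.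

Section Family.
Variable N : nat.

(** A single finite index type lets Pythagoras' theorem treat the coarse and the
    fine part of an expansion together; the indices that are not [live] stand
    for no basis function. *)
Definition idx : finType :=
  (Zidx d J0 + {l : 'I_N & ({ffun 'I_d -> bool} * Zidx d l)%type})%type.

Definition fam (u : idx) : d.-tuple R -> R :=
  match u with inl m => Phi g m | inr v => wav g (tagged v).1 (tagged v).2 end.

Definition live (u : idx) : bool :=
  match u with
  | inl _ => true
  | inr v => (J0 <= tag v)%N && ((tagged v).1 != iota0 d)
  end.

Lemma bnd_fam u : bnd (fam u).
Proof. by case: u => [m|v]; [exact: bscal|exact: bwav]. Qed.

Lemma fam_orthonormal : orthonormal mu live fam.
Proof.
move=> [m|[l [io m]]] [m'|[l' [io' m']]] /=; rewrite -ip_dot; try exact: bwav.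
- by move=> _ _; exact: (cdv_orthonormal_Phi g_cdv (leqnn J0)).
- by move=> _ /andP[J0l io0]; rewrite (cdv_orthogonal_Phi_Psi g_cdv J0l io0).
- move=> /andP[J0l io0] _; rewrite ip_dot; try exact: bwav.
  by rewrite dotC -ip_dot; [exact: (cdv_orthogonal_Phi_Psi g_cdv J0l io0)|exact: bwav|exact: bwav].
move=> /andP[J0l io0] /andP[J0l' io0'].
rewrite (cdv_orthonormal_Psi g_cdv J0l J0l' io0 io0').
congr (_ %:R); congr nat_of_bool.
have -> : (inr (Tagged (fun l : 'I_N => ({ffun 'I_d -> bool} * Zidx d l)%type) (io, m)) ==
  inr (Tagged _ (io', m')) :> idx) =
  (Tagged (fun l : 'I_N => ({ffun 'I_d -> bool} * Zidx d l)%type) (io, m) == Tagged _ (io', m')) by [].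
case: (eqVneq l l') => [e|ll'].
  subst l'; rewrite eqxx eq_Tagged /= xpair_eqE; congr (_ && _).
  apply/forallP/eqP => [h|-> //]; apply/ffunP => i; apply/val_inj.
  exact/eqP/h.
have -> : (l == l' :> nat) = false by apply/negbTE; rewrite -val_eqE in ll'.
by apply/esym/negbTE; apply: contra ll' => /eqP /(congr1 tag) /= ->.
Qed.

Lemma sum_fam (F : Zidx d J0 -> R)
    (G : {ffun 'I_d -> bool} -> forall l, Zidx d l -> R) :
  \sum_(u | live u) (match u with
     | inl m => F m | inr v => G (tagged v).1 (tag v) (tagged v).2 end) =
  \sum_m F m + \sum_(J0 <= l < N) \sum_(io | io != iota0 d) \sum_m G io l m.
Proof.
rewrite big_sumType /=; congr (_ + _).
rewrite big_geq_mkord/=.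
under [RHS]eq_bigr => l _ do rewrite pair_big /=.
rewrite (sig_big_dep (fun l : 'I_N => J0 <= l)%N
  (fun l (v : {ffun 'I_d -> bool} * Zidx d l) => (v.1 != iota0 d) && true)
  (fun l (v : {ffun 'I_d -> bool} * Zidx d l) => G v.1 l v.2)).
by apply: eq_bigl => v; rewrite andbT.
Qed.

End Family.

Definition level_energy (f : d.-tuple R -> R) l : R :=
  \sum_(io | io != iota0 d) \sum_(m : Zidx d l) <| f, wav g io m |> ^+ 2.

Lemma fam_residual N f (a : Zidx d J0 -> R)
    (c : {ffun 'I_d -> bool} -> forall l, Zidx d l -> R) : bnd f ->
  let r x := f x - \sum_(m : Zidx d J0) a m * Phi g m x
      - \sum_(J0 <= l < N) \sum_(io | io != iota0 d) \sum_(m : Zidx d l)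
          c io l m * wav g io m x in
  bnd r /\
  <| r, r |> = <| f, f |>
   - (\sum_(m : Zidx d J0) <| f, Phi g m |> ^+ 2 + \sum_(J0 <= l < N) level_energy f l)
   + (\sum_(m : Zidx d J0) (a m - <| f, Phi g m |>) ^+ 2 +
      \sum_(J0 <= l < N) \sum_(io | io != iota0 d) \sum_(m : Zidx d l)
        (c io l m - <| f, wav g io m |>) ^+ 2).
Proof.
move=> bf r.
pose coef (u : idx N) := match u with
  | inl m => a m | inr v => c (tagged v).1 (tag v) (tagged v).2 end.
have rE : r = fun x => f x - \sum_(u | live u) coef u * fam u x.
  apply/funext => x; rewrite /r -addrA -opprD; congr (_ - _).
  rewrite -(sum_fam N (fun m : Zidx d J0 => a m * Phi g m x)
    (fun io l (m : Zidx d l) => c io l m * wav g io m x)).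
  by apply: eq_bigr => -[].
have := residual_sqr (@bnd_fam N) coef (@fam_orthonormal N) bf.
rewrite -rE => ->; split.
  by rewrite rE; apply: bndB => //; exact: (bnd_comb (@bnd_fam N)).
congr (_ - _ + _).
  rewrite -(sum_fam N (fun m : Zidx d J0 => <| f, Phi g m |> ^+ 2)
    (fun io l (m : Zidx d l) => <| f, wav g io m |> ^+ 2)).
  by apply: eq_bigr => -[].
rewrite -(sum_fam N (fun m : Zidx d J0 => (a m - <| f, Phi g m |>) ^+ 2)
  (fun io l (m : Zidx d l) => (c io l m - <| f, wav g io m |>) ^+ 2)).
by apply: eq_bigr => -[].
Qed.

Lemma level_energy_ge0 f l : 0 <= level_energy f l.
Proof. by apply: sumr_ge0 => io _; apply: sumr_ge0 => m _; exact: sqr_ge0. Qed.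

(** Completeness provides a combination close to [f]; the Fourier coefficients
    do at least as well. *)
Lemma Parseval_le f (eps : R) : bnd f -> 0 < eps -> exists N,
  <| f, f |> < eps + (\sum_m <| f, @Phi R d g J0 m |> ^+ 2
    + \sum_(J0 <= l < N) level_energy f l).
Proof.
move=> bf eps0.
have [N [a [c h]]] := cdv_total g_cdv (bnd_Lfun2 mu bf) eps0.
exists N; have [br rr] := fam_residual N a c bf.
move: h; cbv zeta; rewrite (ip_dot br br) rr => h.
rewrite -ltrBlDr; apply: le_lt_trans h; rewrite lerDl addr_ge0//.
  by apply: sumr_ge0 => m _; exact: sqr_ge0.
apply: sumr_ge0 => l _; apply: sumr_ge0 => io _; apply: sumr_ge0 => m _.
exact: sqr_ge0.
Qed.

(** The wavelets below level [j] lie in the scaling space of level [j], on which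
    the projection is the best approximation. *)
Lemma scal_residual_energy j f : (J0 <= j)%N -> bnd f ->
  <| fun x => f x - proj mu (scal j) f x, fun x => f x - proj mu (scal j) f x |> <=
  <| f, f |> - (\sum_m <| f, @Phi R d g J0 m |> ^+ 2
    + \sum_(J0 <= l < j) level_energy f l).
Proof.
move=> J0j bf.
pose a m := <| f, @Phi R d g J0 m |>.
pose c io l (m : Zidx d l) := <| f, wav g io m |>.
pose q (x : d.-tuple R) := \sum_(m : Zidx d J0) a m * Phi g m x
      + \sum_(J0 <= l < j) \sum_(io | io != iota0 d) \sum_(m : Zidx d l)
          c io l m * wav g io m x.
have [br rr] := fam_residual j a c bf.
have [e qE] : in_V g j q.
  apply: in_VD.
    apply: in_V_sum => m _; apply: in_VZ.
    apply: (in_V_mono g_cdv (j := J0)); first by rewrite leqnn.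
    exists (fun k => (k == m)%:R); apply: aeW => x.
    by rewrite (bigD1 m)//= eqxx mul1r big1 ?addr0// => k /negbTE ->; rewrite mul0r.
  rewrite (_ : (fun x => _) = fun x => \sum_(J0 <= l < j | (J0 <= l < j)%N)
    \sum_(io | io != iota0 d) \sum_(m : Zidx d l) c io l m * wav g io m x); last first.
    by apply/funext => x; rewrite big_nat.
  apply: in_V_sum => l /andP[J0l lj]; apply: in_V_sum => io _.
  apply: in_V_sum => m _; apply: in_VZ.
  apply: (in_V_mono g_cdv (j := l.+1)); first by rewrite lj (leqW J0l).
  exact: (cdv_nested g_cdv).
apply: le_trans (proj_best (@bscal j) (oscal J0j) e bf) _.
have bs := bnd_comb (@bscal j) predT e.
have bq : bnd q.
  have -> : q = fun x => f x - (f x - \sum_(m : Zidx d J0) a m * Phi g m x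
      - \sum_(J0 <= l < j) \sum_(io | io != iota0 d) \sum_(m : Zidx d l)
          c io l m * wav g io m x) by apply/funext => x; rewrite /q; ring.
  exact: bndB.
rewrite le_eqVlt; apply/orP; left; apply/eqP.
transitivity (<| fun x => f x - q x, fun x => f x - q x |>).
  apply: E_ae.
  - by have [] : bnd (fun x => (f x - \sum_i e i * scal j i x) *
      (f x - \sum_i e i * scal j i x)) by bnd_tac.
  - by have [] : bnd (fun x => (f x - q x) * (f x - q x)) by bnd_tac.
  - by apply: filterS qE => x ->.
transitivity (<| fun x => f x - \sum_(m : Zidx d J0) a m * Phi g m x
      - \sum_(J0 <= l < j) \sum_(io | io != iota0 d) \sum_(m : Zidx d l)
          c io l m * wav g io m x,
    fun x => f x - \sum_(m : Zidx d J0) a m * Phi g m x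
      - \sum_(J0 <= l < j) \sum_(io | io != iota0 d) \sum_(m : Zidx d l)
          c io l m * wav g io m x |>).
  by apply: E_eq => x; rewrite /q opprD addrA.
rewrite rr -[RHS]addr0; congr (_ + _); rewrite big1 ?add0r => [|m _].
  by rewrite big1// => l _; rewrite big1// => io _; rewrite big1// => m _; rewrite subrr expr0n.
by rewrite subrr expr0n.
Qed.

Lemma sum_geometric_le (rho : R) j n : 0 <= rho -> rho < 1 ->
  \sum_(j <= l < n) rho ^+ l <= rho ^+ j / (1 - rho).
Proof.
move=> r0 r1; have r1' : 0 < 1 - rho by rewrite subr_gt0.
rewrite ler_pdivlMr//.
have [jn|nj] := leqP j n; last first.
  by rewrite big_geq ?mul0r ?exprn_ge0// ltnW.
rewrite mulr_suml.
under eq_bigr => l _ do rewrite mulrBr mulr1 -exprSr.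
rewrite (telescope_sumr_eq (fun k => - rho ^+ k))//; last first.
  by move=> k _; rewrite opprK addrC.
by rewrite opprK addrC gerBl exprn_ge0.
Qed.

(** Level [l] has at most [2 ^ d * (2 ^ l) ^ d] wavelets, so its energy is of order
    [rho ^ l] and the levels from [j] on form a geometric series. *)
Lemma scal_residual_le j f (M rho : R) : 0 <= M -> 0 <= rho -> rho < 1 -> (J0 <= j)%N -> bnd f ->
  (forall l io (m : Zidx d l), (J0 <= l)%N -> io != iota0 d ->
     <| f, wav g io m |> ^+ 2 * (2 ^+ l) ^+ d <= M * rho ^+ l) ->
  <| fun x => f x - proj mu (scal j) f x, fun x => f x - proj mu (scal j) f x |> <=
  2 ^+ d * M / (1 - rho) * rho ^+ j.
Proof.
move=> M0 r0 r1 J0j bf coef; have r1' : 0 < 1 - rho by rewrite subr_gt0.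
have E l : (J0 <= l)%N -> level_energy f l <= 2 ^+ d * M * rho ^+ l.
  move=> J0l; have p0 : 0 < (2 ^+ l) ^+ d :> R by rewrite !exprn_gt0.
  apply: (@le_trans _ _ (\sum_(io : {ffun 'I_d -> bool}) M * rho ^+ l)); last first.
    rewrite sumr_const card_ffun card_bool card_ord.
    by rewrite -[_ *+ (2 ^ d)%N]mulr_natl natrX mulrA.
  apply: (@le_trans _ _ (\sum_(io | io != iota0 d) M * rho ^+ l)); last first.
    rewrite [leRHS](bigID (fun io => io != iota0 d))/= lerDl sumr_ge0// => io _.
    by rewrite mulr_ge0// exprn_ge0.
  apply: ler_sum => io io0.
  apply: (@le_trans _ _ (\sum_(m : Zidx d l) M * rho ^+ l / (2 ^+ l) ^+ d)).
    by apply: ler_sum => m _; rewrite ler_pdivlMr// coef.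
  rewrite sumr_const card_Zidx -[_ *+ ((2 ^ l) ^ d)%N]mulr_natl !natrX mulrCA divff ?mulr1//.
apply/ler_addgt0Pr => eps eps0.
have [N hN] := Parseval_le bf eps0.
apply: le_trans (scal_residual_energy J0j bf) _.
set a := \sum_m _ in hN *.
have mono : \sum_(J0 <= l < N) level_energy f l <=
   \sum_(J0 <= l < maxn N j) level_energy f l.
  case: (leqP J0 N) => h; last first.
    rewrite big_geq ?sumr_ge0//; last exact: ltnW.
    by move=> l _; exact: level_energy_ge0.
  rewrite [leRHS](big_cat_nat h (leq_maxl _ _))/= lerDl sumr_ge0// => l _.
  exact: level_energy_ge0.
have spl : \sum_(J0 <= l < maxn N j) level_energy f l =
   \sum_(J0 <= l < j) level_energy f l + \sum_(j <= l < maxn N j) level_energy f l.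
  by rewrite (big_cat_nat J0j (leq_maxr _ _)).
have tail : \sum_(j <= l < maxn N j) level_energy f l <=
    2 ^+ d * M / (1 - rho) * rho ^+ j.
  apply: (@le_trans _ _ (\sum_(j <= l < maxn N j) 2 ^+ d * M * rho ^+ l)).
    rewrite big_nat [leRHS]big_nat; apply: ler_sum => l /andP[jl _].
    by apply: E; exact: leq_trans jl.
  rewrite -mulr_sumr -[leRHS]mulrA ler_wpM2l//.
    by rewrite mulr_ge0// exprn_ge0.
  by rewrite [leRHS]mulrC; exact: sum_geometric_le.
lra.
Qed.

End Approximation.

(** * Regression functions *)

Lemma nat_floor_sum (R : realType) (y : R) K : 0 <= y -> y <= K%:R ->
  `|y - \sum_(k < K) (k.+1%:R <= y)%R%:R| <= 1.
Proof.
move=> y0 yK; set t := Num.truncn y.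
have tK : (t <= K)%N by rewrite -(ler_nat R) (le_trans _ yK)// truncn_le.
have -> : \sum_(k < K) (k.+1%:R <= y)%R%:R = t%:R :> R.
  rewrite -[t in RHS]card_ord -sum1_card natr_sum.
  rewrite (big_ord_widen K (fun=> 1%:R))// [RHS]big_mkcond/=.
  by apply: eq_bigr => k _; rewrite -truncn_gt_nat; case: ifP.
have /andP[h1 h2] := truncn_itv y0; rewrite -/t in h1 h2.
by rewrite ger0_norm ?subr_ge0// lerBlDr addrC natr1 ltW.
Qed.

Section RegressionOfIndicators.
Context d d' (T : measurableType d) (U : measurableType d') (R : realType).
Variables (P : probability T R) (mu : probability U R) (X : T -> U).
Hypothesis mX : measurable_fun setT X.
Variables (W : T -> R) (w : U -> R).
Hypotheses (bW : bnd W) (bw : bnd w).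
Hypothesis indic : forall B, measurable B ->
  \int[P]_o (W o * \1_B (X o)) = \int[mu]_x (w x * \1_B x).

(** Both sides are linear and continuous for the supremum norm, and bounded
    functions are uniform limits of staircases of indicators. *)
Lemma regression_of_indic : regression P mu X W w.
Proof.
move=> h bh; have [C C0 hC] := bnd_le bh; have [D D0 WD] := bnd_le bW.
have [D' D'0 wD] := bnd_le bw.
(* The difference of the two sides. *)
pose L f := \int[P]_o (W o * f (X o)) - dot mu w f.
have bX (f : U -> R) : bnd f -> bnd (fun o => f (X o)) by move=> bf; exact: (bnd_comp mX bf).
have LD (f f' : U -> R) : bnd f -> bnd f' -> L (fun x => f x + f' x) = L f + L f'.
  move=> bf bf'; rewrite /L dotDr//.
  have -> : \int[P]_o (W o * (f (X o) + f' (X o))) =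
    \int[P]_o (W o * f (X o)) + \int[P]_o (W o * f' (X o)).
    have := bX _ bf; have := bX _ bf' => ? ?.
    rewrite -E_add; try bnd_tac.
    by apply: E_eq => o; ring.
  by ring.
have LZ a (f : U -> R) : bnd f -> L (fun x => a * f x) = a * L f.
  move=> bf; rewrite /L dotZr// mulrBr -(E_scale P a); last by have := bX _ bf => ?; bnd_tac.
  by congr (_ - _); apply: E_eq => o; ring.
have Li B : measurable B -> L \1_B = 0.
  by move=> mB; rewrite /L indic// subrr.
have L1 : L (fun=> 1) = 0.
  by rewrite -(Li _ measurableT); congr L; apply/funext => x; rewrite indicT.
have Labs (f : U -> R) e : bnd f -> (forall x, `|f x| <= e) -> `|L f| <= (D + D') * e.
  move=> bf fe; have e0 : 0 <= e by apply: le_trans (fe point).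
  rewrite mulrDl (le_trans (ler_normB _ _))// lerD//; apply: E_abs_le.
  - by have := bX _ bf => ?; bnd_tac.
  - by move=> o; rewrite normrM ler_pM.
  - by bnd_tac.
  - by move=> x; rewrite normrM ler_pM.
(* A staircase with [K] steps approximates [h] to within one step. *)
have key K : (0 < K)%N -> `|L h| <= (D + D') * (2 * (C + 1)) / K%:R.
  move=> K0; pose C' := C + 1; have C'0 : 0 < C' by rewrite /C'; lra.
  have K0' : 0 < K%:R :> R by rewrite ltr0n.
  pose de := 2 * C' / K%:R; have de0 : 0 < de by rewrite divr_gt0// mulr_gt0.
  pose B (k : 'I_K) := [set x | k.+1%:R <= (h x + C') / de].
  have mB k : measurable (B k).
    have h1 := (bndM (bndD bh (bnd_cst _ C')) (bnd_cst _ de^-1)).1.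
    have := h1 measurableT `[k.+1%:R, +oo[%classic (measurable_itv _); rewrite setTI.
    by congr measurable; apply/seteqP; split => x; rewrite /= in_itv/= andbT.
  pose s x := - C' * 1 + de * \sum_(k < K) \1_(B k) x.
  have bi k : bnd (\1_(B k) : U -> R) by exact: bnd_indic.
  have bs : bnd s by rewrite /s; bnd_tac.
  have Ls : L s = 0.
    rewrite /s LD; [|by bnd_tac|by bnd_tac].
    rewrite (LZ _ (fun=> 1)) ?L1 ?mulr0 ?add0r; last by bnd_tac.
    rewrite LZ; last by bnd_tac.
    suff : forall r : seq 'I_K, L (fun x => \sum_(k <- r) \1_(B k) x) = 0.
      by move=> ->; rewrite mulr0.
    elim=> [|k r IH].
      transitivity (L (fun x => 0 * 1)); last by rewrite (LZ _ (fun=> 1)) ?mul0r//; bnd_tac.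
      by congr L; apply/funext => x; rewrite big_nil mul0r.
    transitivity (L (fun x => \1_(B k) x + \sum_(j <- r) \1_(B j) x)).
      by congr L; apply/funext => x; rewrite big_cons.
    by rewrite LD ?IH ?Li ?addr0//; bnd_tac.
  have -> : L h = L (fun x => s x + (h x - s x)).
    by congr L; apply/funext => x; ring.
  rewrite LD; [|by []|by bnd_tac]; rewrite Ls add0r.
  have -> : (D + D') * (2 * (C + 1)) / K%:R = (D + D') * de by rewrite /de /C'; ring.
  apply: Labs; first by bnd_tac.
  move=> x; pose y := (h x + C') / de.
  have := hC x; rewrite ler_norml => /andP[h1 h2].
  have y0 : 0 <= y by rewrite divr_ge0 ?(ltW de0)// /C'; lra.
  have yK : y <= K%:R.
    rewrite ler_pdivrMr//; have -> : K%:R * de = 2 * C'.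
      by rewrite /de; field; rewrite lt0r_neq0.
    by rewrite /C'; lra.
  have := nat_floor_sum y0 yK.
  have -> : \sum_(k < K) (k.+1%:R <= y)%R%:R = \sum_(k < K) \1_(B k) x :> R.
    apply: eq_bigr => k _; rewrite indicE; congr (nat_of_bool _)%:R.
    by apply/idP/idP => [|/set_mem//]; move=> ?; apply/mem_set.
  move=> h3; have -> : h x - s x = de * (y - \sum_(k < K) \1_(B k) x).
    by rewrite /s /y; field; rewrite lt0r_neq0.
  by rewrite normrM (gtr0_norm de0) -[leRHS]mulr1 ler_pM2l.
apply/eqP; rewrite -subr_eq0 -normr_eq0 -/(L h) eq_le normr_ge0 andbT.
apply/ler_addgt0Pr => e e0; rewrite add0r.
set c := (D + D') * (2 * (C + 1)) in key.
have c0 : 0 <= c by rewrite mulr_ge0 ?addr_ge0// mulr_ge0// addr_ge0.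
pose K := (Num.truncn (c / e)).+1.
apply: le_trans (key K isT) _.
by rewrite ler_pdivrMr ?ltr0n// mulrC -ler_pdivrMr// ltW// truncnS_gt.
Qed.

End RegressionOfIndicators.

Lemma ae_bnd_integrable d (T : measurableType d) (R : realType) (P : probability T R)
    (f : T -> R) (C : R) : measurable_fun setT f -> {ae P, forall x, `|f x| <= C} ->
  P.-integrable setT (EFin \o f).
Proof.
move=> mf fC; apply/integrableP; split; first exact/measurable_EFinP.
apply: (@le_lt_trans _ _ (\int[P]_x `|C|%:E)%E).
  apply: ae_ge0_le_integral => //.
  - by apply: measurableT_comp => //; exact/measurable_EFinP.
  - by move: fC; apply: filterS => x h _; rewrite /= lee_fin (le_trans h)// ler_norm.
by rewrite (EFin_E P (bnd_cst T `|C|)) ltry.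
Qed.

(** The Radon-Nikodym derivative, with respect to the law of the design, of the
    image of the charge with density [W]. *)
Lemma cond_exp_exists d (R : realType) (P : probability (obs R d) R)
    (W : obs R d -> R) : P.-integrable setT (EFin \o W) ->
  exists f, is_cond_exp P W f.
Proof.
move=> iW.
have mX : measurable_fun setT (@X_ R d) by exact: measurableT_comp.
pose X' : {mfun obs R d >-> d.-tuple R} := HB.pack (@X_ R d)
  (isMeasurableFun.Build _ _ _ _ (@X_ R d) mX).
pose mu := distribution P X'.
pose nu0 : {charge set (obs R d) -> \bar R} := induced_charge iW.
pose nu := measure_function_pushforward__canonical__charge_Charge nu0 mX.
have numu : nu `<< mu.
  apply/null_content_dominatesP => B mB muB.
  have mXB : measurable (@X_ R d @^-1` B).
    by rewrite -[X in measurable X]setTI; exact: (mX measurableT B mB).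
  have := @null_set_integral _ _ _ P (@X_ R d @^-1` B) (EFin \o W) mXB.
  apply; last exact: muB.
  by apply: (measurable_funS measurableT) => //; exact: measurable_int iW.
pose f x := fine (Radon_Nikodym nu mu x).
have fE x : (f x)%:E = Radon_Nikodym nu mu x.
  by rewrite /f fineK//; exact: Radon_Nikodym_fin_num.
have fi : mu.-integrable setT (EFin \o f).
  have -> : EFin \o f = Radon_Nikodym nu mu by apply/funext => x; exact: fE.
  exact: Radon_Nikodym_integrable.
have mf : measurable_fun setT f by apply/measurable_EFinP; exact: measurable_int fi.
have fXi : P.-integrable setT (EFin \o (f \o @X_ R d)).
  apply/integrableP; split.
    by apply/measurable_EFinP; exact: measurableT_comp.
  case/integrableP : fi => _; rewrite ge0_integral_distribution//.
  by apply: measurableT_comp => //; exact/measurable_EFinP.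
exists f; split => // B mB.
have mXB : measurable (@X_ R d @^-1` B).
  by rewrite -[X in measurable X]setTI; exact: (mX measurableT B mB).
congr fine.
transitivity (nu B); first by [].
rewrite (Radon_Nikodym_integral numu mB).
transitivity (\int[mu]_(x in B) (f x)%:E)%E; first by apply: eq_integral => x _; rewrite fE.
rewrite /mu /distribution integral_pushforward//.
  exact/measurable_EFinP.
exact: integrableS fXi.
Qed.

(** * The model *)

Section Clamp.
Variables (R : realType) (C1 C2 : R).

(** Truncation at the two ends of the range of the responses: bounded everywhere,
    while the responses themselves are so almost surely only. *)
Definition clamp (t : R) : R := Num.max C1 (Num.min C2 t).

Lemma measurable_clamp : measurable_fun setT clamp.
Proof.
apply: measurable_maxr; first exact: measurable_cst.
apply: measurable_minr; [exact: measurable_cst|exact: measurable_id].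
Qed.

Lemma clamp_id t : C1 <= t <= C2 -> clamp t = t.
Proof. by move=> /andP[h1 h2]; rewrite /clamp (min_idPr h2) (max_idPr h1). Qed.

Lemma clamp_Lipschitz s t : `|clamp s - clamp t| <= `|s - t|.
Proof.
have maxL c x y : `|Num.max c x - Num.max c y| <= `|x - y| :> R.
  have [cx|xc] := leP c x; have [cy|yc] := leP c y; rewrite ?subrr ?normr0//.
    by rewrite !ger0_norm; lra.
  by rewrite !ler0_norm; lra.
have minL c x y : `|Num.min c x - Num.min c y| <= `|x - y| :> R.
  have [cx|xc] := leP c x; have [cy|yc] := leP c y; rewrite ?subrr ?normr0//.
    by rewrite !ger0_norm; lra.
  by rewrite !ler0_norm; lra.
exact: le_trans (maxL _ _ _) (minL _ _ _).
Qed.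

Hypothesis C12 : C1 <= C2.

Lemma clamp_range t : C1 <= clamp t <= C2.
Proof. by rewrite /clamp le_max lexx/= ge_max C12/= ge_min lexx. Qed.

Lemma clamp_abs t : `|clamp t| <= `|C1| + `|C2|.
Proof.
have /andP[h1 h2] := clamp_range t; rewrite ler_norml; apply/andP; split.
  have := ler_norm (- C1); rewrite normrN; have := normr_ge0 C2; lra.
have := ler_norm C2; have := normr_ge0 C1; lra.
Qed.

Lemma bnd_clamp dd (T : measurableType dd) (f : T -> R) :
  measurable_fun setT f -> bnd (fun x => clamp (f x)).
Proof.
move=> mf; split; first exact: measurableT_comp measurable_clamp mf.
by exists (`|C1| + `|C2|) => x; exact: clamp_abs.
Qed.

End Clamp.

Section EstimatorCongruence.
Context d d' (T : measurableType d) (U : measurableType d') (R : realType).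
Variables (mu : probability U R) (X : T -> U).
Variables (I1 I2 : finType) (phi1 : I1 -> U -> R) (phi2 : I2 -> U -> R).
Variable n : nat.
Local Notation samples := (4.-tuple (n.-tuple T)).

(** What allows responses to be replaced by truncated ones when these agree on
    the subsamples. *)
Definition response_based (est : (T -> R) -> (T -> R) -> samples -> R) :=
  forall A Y A' Y' D,
  (forall k i, A (tnth (tnth D k) i) = A' (tnth (tnth D k) i)) ->
  (forall k i, Y (tnth (tnth D k) i) = Y' (tnth (tnth D k) i)) ->
  est A Y D = est A' Y' D.

Lemma eq_series (I : finType) (phi : I -> U -> R) (W W' : T -> R) (D : n.-tuple T) :
  (forall i, W (tnth D i) = W' (tnth D i)) -> series X phi W D = series X phi W' D.
Proof.
move=> WW'; apply/funext => x; congr (_ * _).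
by apply: eq_bigr => i _; rewrite WW'.
Qed.

Lemma eq_mean_AY (A Y A' Y' : T -> R) (D : n.-tuple T) :
  (forall i, A (tnth D i) = A' (tnth D i)) -> (forall i, Y (tnth D i) = Y' (tnth D i)) ->
  mean_AY A Y D = mean_AY A' Y' D.
Proof. by move=> AA YY; congr (_ * _); apply: eq_bigr => i _; rewrite AA YY. Qed.

Lemma est_INT_response :
  response_based (fun A Y => est_INT mu X phi1 phi2 A Y (n := n)).
Proof.
move=> A Y A' Y' D hA hY; rewrite /est_INT; congr (_ - _).
  exact: eq_mean_AY.
by congr dot; exact: eq_series.
Qed.

Lemma est_MC_response :
  response_based (fun A Y => est_MC X phi1 phi2 A Y (n := n)).
Proof.
move=> A Y A' Y' D hA hY; rewrite /est_MC; congr (_ - _).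
  exact: eq_mean_AY.
by rewrite (eq_series phi1 (hA _)) (eq_series phi2 (hY _)).
Qed.

Lemma est_IF_response :
  response_based (fun A Y => est_IF X phi1 phi2 A Y (n := n)).
Proof.
move=> A Y A' Y' D hA hY; rewrite /est_IF; congr (_ * _).
apply: eq_bigr => i _.
by rewrite (eq_series phi1 (hA _)) (eq_series phi2 (hY _)) hA hY.
Qed.

(** An estimator that is measurable for bounded responses is measurable for all
    of them: truncate the responses at increasing levels. *)
Lemma measurable_est est (A Y : T -> R) : response_based est ->
  (forall A Y, bnd A -> bnd Y -> bnd (est A Y)) ->
  measurable_fun setT A -> measurable_fun setT Y ->
  measurable_fun setT (est A Y).
Proof.
move=> resp best mA mY.
pose cut (N : nat) := clamp (- N%:R) N%:R : R -> R.
pose h N D := est (fun o => cut N (A o)) (fun o => cut N (Y o)) D.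
have NN N : - N%:R <= N%:R :> R by rewrite -subr_ge0 opprK addr_ge0.
apply: (@measurable_fun_cvg _ _ _ _ h).
  by move=> N; have [] := best _ _ (bnd_clamp (NN N) mA) (bnd_clamp (NN N) mY).
move=> D _; apply: cvg_near_cst.
pose B := \sum_k \sum_i (`|A (tnth (tnth D k) i)| + `|Y (tnth (tnth D k) i)|).
have le_B k i : `|A (tnth (tnth D k) i)| + `|Y (tnth (tnth D k) i)| <= B.
  rewrite /B (bigD1 k)//= (bigD1 i)//= -addrA lerDl addr_ge0//.
    by rewrite sumr_ge0// => i' _; rewrite addr_ge0.
  by rewrite sumr_ge0// => k' _; rewrite sumr_ge0// => i' _; rewrite addr_ge0.
exists (Num.truncn B).+1 => // N /= BN.
have {}BN : B <= N%:R.
  by rewrite (le_trans (ltW (truncnS_gt B)))// ler_nat.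
by apply: resp => k i; rewrite /cut clamp_id// -ler_norml (le_trans _ BN)//;
  apply: le_trans (le_B k i); rewrite ?lerDl ?lerDr.
Qed.

End EstimatorCongruence.

Section CondExp.
Variables (R : realType) (d : nat) (P : probability (obs R d) R) (C1 C2 : R).
Hypothesis P_X : forall B, measurable B -> P (@X_ R d @^-1` B) = unif R d B.
Hypothesis C12 : C1 <= C2.

Local Notation mu := (unif R d).
Local Notation X := (@X_ R d).
Local Notation cl := (clamp C1 C2).

Lemma measurable_X : measurable_fun setT X.
Proof. exact: measurableT_comp. Qed.

Lemma measurable_A : measurable_fun setT (@A_ R d).
Proof. exact: measurableT_comp. Qed.

Lemma measurable_Y : measurable_fun setT (@Y_ R d).
Proof. exact: measurable_snd. Qed.

Let mXB B : measurable B -> measurable (X @^-1` B).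
Proof. by move=> mB; rewrite -[S in measurable S]setTI; exact: (measurable_X measurableT mB). Qed.

Lemma unif_law h : bnd h -> \int[P]_o h (X o) = \int[mu]_x h x.
Proof. by apply: E_transfer => //; exact: measurable_X. Qed.

Lemma ae_X (Q : d.-tuple R -> Prop) : {ae mu, forall x, Q x} -> {ae P, forall o, Q (X o)}.
Proof.
move=> [N [mN N0 QN]]; exists (X @^-1` N); split.
- exact: mXB.
- by rewrite -N0; exact: P_X.
- by move=> o /= nQ; apply: QN.
Qed.

Section OneResponse.
Variables (W : obs R d -> R) (f : d.-tuple R -> R).
Hypothesis mW : measurable_fun setT W.
Hypothesis W_range : {ae P, forall o, C1 <= W o <= C2}.
Hypothesis cexp : is_cond_exp P W f.

Lemma Rintegral_indic (G : obs R d -> R) B : 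
  \int[P]_(o in X @^-1` B) G o = \int[P]_o (G o * \1_B (X o)).
Proof.
rewrite Rintegral_mkcond; apply: E_eq => o; rewrite patchE indicE.
have -> : (o \in X @^-1` B) = (X o \in B) by apply/idP/idP => /set_mem h; apply/mem_set.
by case: ifP; rewrite ?mulr1 ?mulr0.
Qed.

(** Taking [s = 1] and [s = -1] yields both bounds. Where [c < s * f x] the mean
    of the positive function [s * f x - c] would be that of [s * W - c], which is
    nonpositive. *)
Let one_sided (s c : R) : {ae P, forall o, s * W o <= c} ->
  {ae mu, forall x, s * f x <= c}.
Proof.
move=> Wc; have [mf iW ifX eqf] := cexp.
pose B := [set x | c < s * f x].
have msf : measurable_fun setT (fun x => s * f x) by exact: measurable_funM.
have mB : measurable B.
  have := msf measurableT `]c, +oo[%classic (measurable_itv _); rewrite setTI.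
  by congr measurable; apply/seteqP; split => x; rewrite /= in_itv/= andbT.
have mXB' := mXB mB.
have iB (G : obs R d -> R) : P.-integrable setT (EFin \o G) ->
    P.-integrable (X @^-1` B) (EFin \o G).
  exact: integrableS.
pose G o := s * f (X o) - c.
have iG : P.-integrable (X @^-1` B) (EFin \o G).
  have h1 := integrableZl mXB' s (iB _ ifX).
  have h2 := integrableB mXB' h1 (iB _ (bnd_integrable P (bnd_cst _ c))).
  by apply: eq_integrable h2.
have mG : measurable_fun (X @^-1` B) (EFin \o G) by exact: measurable_int iG.
have G0 : \int[P]_(o in X @^-1` B) G o = 0.
  apply/eqP; rewrite eq_le; apply/andP; split; last first.
    by apply: Rintegral_ge0 => o /= h; rewrite /G subr_ge0 ltW.
  rewrite /G RintegralB//; last 2 first.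
    by have := integrableZl mXB' s (iB _ ifX).
    by have := iB _ (bnd_integrable P (bnd_cst _ c)).
  rewrite RintegralZl//; last exact: iB.
  rewrite -eqf// -RintegralZl//; last exact: iB.
  rewrite -RintegralB//; last 2 first.
    by have := integrableZl mXB' s (iB _ iW).
    by have := iB _ (bnd_integrable P (bnd_cst _ c)).
  rewrite Rintegral_indic.
  have bi : bnd (fun o => \1_B (X o) : R) by exact: (bnd_comp measurable_X (bnd_indic _ mB)).
  have bcl := bnd_clamp C12 mW.
  have bG : bnd (fun o => (s * cl (W o) - c) * \1_B (X o)) by bnd_tac.
  rewrite (E_ae (g := fun o => (s * cl (W o) - c) * \1_B (X o))).
  - rewrite -(E_cst P 0); apply: E_le_ae; [exact: bG|exact: bnd_cst|].
    apply: filterS2 W_range Wc => o Wo Wo'; rewrite clamp_id//.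
    by apply: mulr_le0_ge0; [rewrite subr_le0|rewrite indicE].
  - apply: measurable_funM; last exact: bi.1.
    by apply: measurable_funB => //; exact: measurable_funM.
  - exact: bG.1.
  - by apply: filterS W_range => o Wo; rewrite clamp_id.
have aeG : ae_eq P (X @^-1` B) (EFin \o G) (cst 0%E).
  apply/ae_eq_integral_abs => //.
  transitivity (\int[P]_(o in X @^-1` B) (G o)%:E)%E.
    by apply: eq_integral => o /set_mem /= h; rewrite ger0_norm// /G subr_ge0 ltW.
  by rewrite -[LHS]fineK ?(integrable_fin_num _ iG)//; congr EFin; exact: G0.
have nB : P (X @^-1` B) = 0%E.
  have [N [mN N0 hN]] := aeG; apply/eqP; rewrite -measure_le0.
  rewrite -N0; apply: le_measure; rewrite ?inE// => o Bo; apply: hN => /= h.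
  have := h Bo; rewrite /G => -[]; move: Bo; rewrite /B /= -subr_gt0 => /lt0r_neq0.
  by move=> /eqP.
exists B; split => //; first by rewrite -nB; exact/esym/P_X.
by move=> x /= /negP; rewrite -ltNge.
Qed.

Lemma cond_exp_range : {ae mu, forall x, C1 <= f x <= C2}.
Proof.
have h1 := one_sided (s := 1) (c := C2).
have h2 := one_sided (s := -1) (c := - C1).
have {}h1 : {ae mu, forall x, 1 * f x <= C2}.
  by apply: h1; apply: filterS W_range => o /andP[_]; rewrite mul1r.
have {}h2 : {ae mu, forall x, -1 * f x <= - C1}.
  by apply: h2; apply: filterS W_range => o /andP[+ _]; rewrite mulN1r lerN2.
by apply: filterS2 h1 h2 => x; rewrite mul1r mulN1r lerN2 => -> ->.
Qed.

(** Up to null sets truncation changes neither the response nor its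
    regression function. *)
Lemma cond_exp_regression : regression P mu X (fun o => cl (W o)) (fun x => cl (f x)).
Proof.
have [mf iW ifX eqf] := cexp.
have bcW := bnd_clamp C12 mW; have bcf := bnd_clamp C12 mf.
refine (regression_of_indic measurable_X bcW bcf _) => B mB.
have bi : bnd (\1_B : d.-tuple R -> R) by exact: bnd_indic.
have biX := bnd_comp measurable_X bi.
have bcfX := bnd_comp measurable_X bcf.
rewrite -(unif_law (h := fun x => cl (f x) * \1_B x)); last by bnd_tac.
transitivity (\int[P]_(o in X @^-1` B) W o).
  rewrite Rintegral_indic; apply: E_ae.
  - exact: (bndM bcW biX).1.
  - by apply: measurable_funM => //; exact: biX.1.
  - by apply: filterS W_range => o Wo; rewrite clamp_id.
rewrite eqf// Rintegral_indic; apply: E_ae.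
- by apply: measurable_funM; [exact: measurableT_comp mf measurable_X|exact: biX.1].
- exact: (bndM bcfX biX).1.
- by apply: filterS (ae_X cond_exp_range) => o fo; rewrite clamp_id.
Qed.

End OneResponse.
End CondExp.

Section ModelFacts.
Variables (R : realType) (d J0 : nat) (g : cdv_generators R).
Variables (alpha beta C1 C2 M : R) (P : probability (obs R d) R).
Hypothesis P_model : model g J0 alpha beta C1 C2 M P.

Local Notation mu := (unif R d).
Local Notation X := (@X_ R d).
Local Notation cl := (clamp C1 C2).
Local Notation clA := (fun o : obs R d => cl (A_ o)).
Local Notation clY := (fun o : obs R d => cl (Y_ o)).

Lemma model_law B : measurable B -> P (X @^-1` B) = mu B.
Proof. by have [h _ _ _] := P_model; exact: h. Qed.

Lemma model_range : {ae P, forall o, C1 <= A_ o <= C2 /\ C1 <= Y_ o <= C2}.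
Proof. by have [] := P_model. Qed.

Lemma model_C12 : C1 <= C2.
Proof.
have [N [mN N0 hN]] := model_range.
have [ob Nob] : exists ob, ~ N ob.
  apply: contrapT => /forallNP h.
  have NT : N = setT by apply/seteqP; split => // o _; exact: contrapT (h o).
  by have := probability_setT P; rewrite -NT N0 => /eqP; rewrite eq_sym onee_eq0.
have : C1 <= A_ ob <= C2 /\ C1 <= Y_ ob <= C2.
  by apply: contrapT => h; apply: Nob; exact: hN.
by move=> [/andP[h1 h2] _]; exact: le_trans h2.
Qed.

Let A_range : {ae P, forall o, C1 <= A_ o <= C2}.
Proof. by apply: filterS model_range => o []. Qed.

Let Y_range : {ae P, forall o, C1 <= Y_ o <= C2}.
Proof. by apply: filterS model_range => o []. Qed.

Let C12 := model_C12.

(** [psi] is defined from some versions of the regression functions, but any two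
    versions have the same inner products with bounded functions. *)
Lemma psiE p b : is_cond_exp P (@A_ R d) p -> is_cond_exp P (@Y_ R d) b ->
  psi P = target P mu clA clY (fun x => cl (p x)) (fun x => cl (b x)).
Proof.
move=> hp hb.
pose pt := cond_exp P (@A_ R d); pose bt := cond_exp P (@Y_ R d).
have hpt : is_cond_exp P (@A_ R d) pt by apply: xgetPex; exists p.
have hbt : is_cond_exp P (@Y_ R d) bt by apply: xgetPex; exists b.
have mA := @measurable_A R d; have mY := @measurable_Y R d.
have regA f (hf : is_cond_exp P (@A_ R d) f) := cond_exp_regression model_law C12 mA A_range hf.
have regY f (hf : is_cond_exp P (@Y_ R d) f) := cond_exp_regression model_law C12 mY Y_range hf.
have mf W f : is_cond_exp P W f -> measurable_fun setT f by case.
have bcl f : measurable_fun setT f -> bnd (fun x : d.-tuple R => cl (f x)) by exact: bnd_clamp.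
have bclX f : measurable_fun setT f -> bnd (fun o : obs R d => cl (f (X o))).
  by move=> h; exact: (bnd_comp (@measurable_X R d) (bcl _ h)).
have bA : bnd clA by exact: bnd_clamp.
have bY : bnd clY by exact: bnd_clamp.
pose W o := (A_ o - pt (X o)) * (Y_ o - bt (X o)).
pose W' o := (cl (A_ o) - cl (pt (X o))) * (cl (Y_ o) - cl (bt (X o))).
have WW' : {ae P, forall o, W o = W' o}.
  have h1 := ae_X model_law (cond_exp_range model_law C12 mA A_range hpt).
  have h2 := ae_X model_law (cond_exp_range model_law C12 mY Y_range hbt).
  apply: filterS3 model_range h1 h2 => o [Ao Yo] po bo.
  by rewrite /W /W' !clamp_id.
have mW : measurable_fun setT W.
  apply: measurable_funM; apply: measurable_funB => //.
    exact: measurableT_comp (mf _ _ hpt) (@measurable_X R d).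
  exact: measurableT_comp (mf _ _ hbt) (@measurable_X R d).
have bpt := bclX _ (mf _ _ hpt); have bbt := bclX _ (mf _ _ hbt).
have bW' : bnd W' by rewrite /W'; bnd_tac.
have iW : P.-integrable setT (EFin \o W).
  have [C _ hC] := bnd_le bW'; apply: (ae_bnd_integrable (C := C)) => //.
  by apply: filterS WW' => o ->.
have [f0 hf0] := cond_exp_exists iW.
have [_ _ _ hc] : is_cond_exp P W (cond_exp P W) by apply: xgetPex; exists f0.
have -> : psi P = \int[P]_o W o.
  have := hc setT measurableT; rewrite preimage_setT => ->.
  by [].
rewrite (E_ae mW bW'.1 WW').
transitivity (\int[P]_o (((cl (A_ o) * cl (Y_ o) - cl (A_ o) * cl (bt (X o)))
   - cl (Y_ o) * cl (pt (X o))) + cl (pt (X o)) * cl (bt (X o)))).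
  by apply: E_eq => o; rewrite /W'; ring.
rewrite E_add; try bnd_tac.
rewrite E_sub; try bnd_tac.
rewrite E_sub; try bnd_tac.
have bp := bcl _ (mf _ _ hp); have bb := bcl _ (mf _ _ hb).
have bp' := bcl _ (mf _ _ hpt); have bb' := bcl _ (mf _ _ hbt).
rewrite (unif_law model_law (h := fun x => cl (pt x) * cl (bt x))); last by bnd_tac.
rewrite (regA _ hpt (fun x => cl (bt x)))// (regY _ hbt (fun x => cl (pt x)))//.
rewrite /target.
have e1 : dot mu (fun x => cl (pt x)) (fun x => cl (bt x)) =
          dot mu (fun x => cl (p x)) (fun x => cl (bt x)).
  by rewrite -(regA _ hpt (fun x => cl (bt x)))// (regA _ hp (fun x => cl (bt x))).
have e2 : dot mu (fun x => cl (bt x)) (fun x => cl (p x)) =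
          dot mu (fun x => cl (b x)) (fun x => cl (p x)).
  by rewrite -(regY _ hbt (fun x => cl (p x)))// (regY _ hb (fun x => cl (p x))).
have e : dot mu (fun x => cl (pt x)) (fun x => cl (bt x)) =
         dot mu (fun x => cl (p x)) (fun x => cl (b x)).
  by rewrite e1 dotC e2 dotC.
rewrite (dotC mu (fun x => cl (bt x))) -e /dot; ring.
Qed.

Lemma ae_samples n : {ae iid (iid P n) 4, forall D, forall k i,
  C1 <= A_ (tnth (tnth D k) i) <= C2 /\ C1 <= Y_ (tnth (tnth D k) i) <= C2}.
Proof.
pose G := [set o : obs R d | C1 <= A_ o <= C2 /\ C1 <= Y_ o <= C2].
have mG : measurable G.
  have mA := @measurable_A R d measurableT `[C1, C2]%classic (measurable_itv _).
  have mY := @measurable_Y R d measurableT `[C1, C2]%classic (measurable_itv _).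
  have -> : G = (setT `&` @A_ R d @^-1` `[C1, C2]) `&` (setT `&` @Y_ R d @^-1` `[C1, C2]).
    by apply/seteqP; split => o; rewrite !setTI /= !in_itv.
  exact: measurableI.
have PG : P G = 1%E.
  have [N [mN N0 hN]] := model_range.
  have PGC : P (~` G) = 0%E.
    apply/eqP; rewrite -measure_le0 -N0; apply: le_measure; rewrite ?inE//.
    exact: measurableC.
  by have := probability_setC P (measurableC mG); rewrite setCK PGC sube0.
have mGn : measurable [set t : n.-tuple (obs R d) | forall i, G (tnth t i)].
  exact: (measurable_box (fun _ : 'I_n => mG)).
have PGn : iid P n [set t | forall i, G (tnth t i)] = 1%E.
  by rewrite (iid_box P (fun _ : 'I_n => mG)) big1.
by apply: filterS (iid_ae_all 4 mGn PGn) => D h k i; exact: h.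
Qed.

(** Almost surely truncation leaves the observed responses unchanged, so the
    bounds for bounded responses apply. *)
Lemma risk_clamp n (est : (obs R d -> R) -> (obs R d -> R) -> samples R d n -> R)
    p b : response_based est ->
  (forall A Y, bnd A -> bnd Y -> bnd (est A Y)) ->
  is_cond_exp P (@A_ R d) p -> is_cond_exp P (@Y_ R d) b ->
  'E_(iid (iid P n) 4)[fun D => ((est (@A_ R d) (@Y_ R d) D - psi P) ^+ 2)%R]%E =
  (mse P mu clA clY (fun x => cl (p x)) (fun x => cl (b x)) (est clA clY))%:E.
Proof.
move=> resp best hp hb; have bA : bnd clA by exact: (bnd_clamp C12 (@measurable_A R d)).
have bY : bnd clY by exact: (bnd_clamp C12 (@measurable_Y R d)).
rewrite unlock /mse -(psiE hp hb) -EFin_E; last first.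
  by apply: bndX; apply: bndB; [exact: best|exact: bnd_cst].
apply: ae_eq_integral => //.
- apply/measurable_EFinP; apply: measurable_funX; apply: measurable_funB => //.
  exact: (measurable_est resp best (@measurable_A R d) (@measurable_Y R d)).
- apply/measurable_EFinP; apply: measurable_funX; apply: measurable_funB => //.
  exact: (best _ _ bA bY).1.
- apply: filterS (ae_samples n) => D hD _ /=; congr ((_ - _) ^+ 2)%:E.
  by apply: resp => k i; rewrite clamp_id//; have [] := hD k i.
Qed.

End ModelFacts.

Section ConcreteEstimators.
Variables (R : realType) (d S J0 : nat) (g : cdv_generators R).
Hypothesis g_cdv : cdv_basis d g S J0.

Lemma psi_INTE j1 j2 n : @psi_INT R d g j1 j2 n =
  est_INT (unif R d) (@X_ R d) (scal g j1) (scal g j2) (@A_ R d) (@Y_ R d) (n := n).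
Proof.
apply/funext => D; congr (_ - _); apply: Rintegral_cube.
have bs j := bnd_scal g_cdv (j := j).
apply: (bndM _ _).1; [exact: (bnd_series _ (bs j1))|exact: (bnd_series _ (bs j2))].
Qed.

Lemma psi_MCE j1 j2 n : @psi_MC R d g j1 j2 n =
  est_MC (@X_ R d) (scal g j1) (scal g j2) (@A_ R d) (@Y_ R d) (n := n).
Proof. by []. Qed.

Lemma psi_IFE j1 j2 n : @psi_IF R d g j1 j2 n =
  est_IF (@X_ R d) (scal g j1) (scal g j2) (@A_ R d) (@Y_ R d) (n := n).
Proof. by []. Qed.

End ConcreteEstimators.

(** * Worst-case risk: upper bounds *)

Section UpperBounds.
Variables (R : realType) (d S J0 : nat) (g : cdv_generators R).
Hypothesis g_cdv : cdv_basis d g S J0.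
Variable A : R.
Hypothesis A_size : size_bound g A.

Local Notation mu := (unif R d).
Local Notation "<| f , h |>" := (dot mu f h) (at level 0, f, h at level 200).
Local Notation scal := (@scal R d g).
Local Notation Pi j := (proj mu (scal j)).
Let bscal j m : bnd (scal j m). Proof. exact: (bnd_scal g_cdv). Qed.
Let oscal j : (J0 <= j)%N -> orthonormal mu predT (scal j).
Proof. exact: (scal_orthonormal g_cdv). Qed.

Definition dim (j : nat) : R := 2 ^+ (j * d).

Lemma dim_gt0 j : 0 < dim j.
Proof. by rewrite /dim exprn_gt0. Qed.

Lemma dimE j : (2 ^+ j) ^+ d = dim j.
Proof. by rewrite /dim exprM. Qed.

Lemma dim_powR j (s : R) : (0 < d)%N -> dim j `^ (- (2 * s / d%:R)) = 2 `^ (- (2 * s)) ^+ j.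
Proof.
move=> d0; have d1 : d%:R != 0 :> R by rewrite pnatr_eq0 -lt0n.
rewrite /dim -(powR_mulrn (j * d) (ler0n R 2)) -(powR_mulrn j (powR_ge0 2 _)).
by rewrite -!powRrM; congr (_ `^ _); rewrite natrM; field.
Qed.

Lemma dim_min j1 j2 : dim (minn j1 j2) = Num.min (dim j1) (dim j2).
Proof.
rewrite /dim; case: leqP => h.
  by rewrite (min_idPl _)// ler_eXn2l ?ltr1n// leq_mul2r h orbT.
by rewrite (min_idPr _)// ler_eXn2l ?ltr1n// leq_mul2r (ltnW h) orbT.
Qed.

Lemma dim_max j1 j2 : dim (maxn j1 j2) = Num.max (dim j1) (dim j2).
Proof.
rewrite /dim; case: leqP => h.
  by rewrite (max_idPr _)// ler_eXn2l ?ltr1n// leq_mul2r h orbT.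
by rewrite (max_idPl _)// ler_eXn2l ?ltr1n// leq_mul2r (ltnW h) orbT.
Qed.

Lemma card_dim_min j1 j2 : (minn #|Zidx d j1| #|Zidx d j2|)%:R = dim (minn j1 j2).
Proof. by rewrite dim_min !card_Zidx natr_min !natrX !dimE. Qed.

(** The coarser space alone decides the bias of a plug-in product, the finer
    one that of a product of residuals. *)
Lemma bias_min j1 j2 f h : (J0 <= j1)%N -> (J0 <= j2)%N -> bnd f -> bnd h ->
  let j := minn j1 j2 in
  <| Pi j1 f, Pi j2 h |> - <| f, h |> =
  - <| fun x => f x - Pi j f x, fun x => h x - Pi j h x |>.
Proof.
move=> J1 J2 bf bh j; rewrite /j; case: (leqP j1 j2) => j12.
  rewrite (dot_residuals (@bscal j1) (oscal J1) bf bh) opprB; congr (_ - _).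
  apply: (dot_proj_nested (@bscal j1) (@bscal j2) (oscal J1) (oscal J2)) => //.
  by apply: (scal_nested g_cdv); rewrite J1.
rewrite (dot_residuals (@bscal j2) (oscal J2) bf bh) opprB; congr (_ - _).
rewrite dotC [RHS]dotC.
apply: (dot_proj_nested (@bscal j2) (@bscal j1) (oscal J2) (oscal J1)) => //.
by apply: (scal_nested g_cdv); rewrite J2 ltnW.
Qed.

Let bias_max_le j1 j2 f h : (J0 <= j1)%N -> (j1 <= j2)%N -> bnd f -> bnd h ->
  <| fun x => Pi j1 f x - f x, fun x => Pi j2 h x - h x |> =
  <| fun x => f x - Pi j2 f x, fun x => h x - Pi j2 h x |>.
Proof.
move=> J1 j12 bf bh; have J2 := leq_trans J1 j12.
rewrite (dot_residuals (@bscal j2) (oscal J2) bf bh).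
have bP j f' : bnd (Pi j f') by exact: bnd_proj.
rewrite dotBl; try bnd_tac; try exact: bP.
rewrite !dotBr; try bnd_tac; try exact: bP.
rewrite (dot_proj_nested (@bscal j1) (@bscal j2) (oscal J1) (oscal J2)) //; last first.
  by apply: (scal_nested g_cdv); rewrite J1.
rewrite (dot_proj_proj (@bscal j1) (oscal J1) bf bh).
rewrite (dot_proj_proj (@bscal j2) (oscal J2) bf bh).
by rewrite (dot_projC mu (@bscal j2) bf bh); ring.
Qed.

Lemma bias_max j1 j2 f h : (J0 <= j1)%N -> (J0 <= j2)%N -> bnd f -> bnd h ->
  let j := maxn j1 j2 in
  <| fun x => Pi j1 f x - f x, fun x => Pi j2 h x - h x |> =
  <| fun x => f x - Pi j f x, fun x => h x - Pi j h x |>.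
Proof.
move=> J1 J2 bf bh j; rewrite /j; case: (leqP j1 j2) => j12.
  exact: bias_max_le.
rewrite (dotC mu) bias_max_le//; first exact: dotC.
exact: ltnW.
Qed.

Section HoelderCoefficients.
Variables (C1 C2 : R).
Hypothesis C12 : C1 <= C2.

(** The coarse part of the norm is nonnegative, so the bound holds for each fine
    coefficient separately. *)
Lemma hoelder_coef (a M : R) f l io (m : Zidx d l) :
  hoelder_ball g J0 a M f -> (J0 <= l)%N -> io != iota0 d ->
  2 `^ (l%:R * (a + d%:R / 2)) * `|ip f (wav g io m)| <= M.
Proof.
move=> [_ h] J0l io0; rewrite -lee_fin; apply: le_trans h.
set s := ereal_sup _; set c := (_ * \big[_/_]_(_ : _) _).
have c0 : 0 <= c.
  by rewrite mulr_ge0 ?powR_ge0// bigmax_ge_id.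
apply: (@le_trans _ _ s); last by rewrite leeDr// lee_fin.
by apply: ereal_sup_ubound; exists l, io, m.
Qed.

(** The normalisation of the coefficients makes the energy of level [l] of the
    order [2 ^ (- 2 a l)]; the energies of the levels not resolved form a
    geometric series. *)
Lemma hoelder_residual_le (a M : R) : 0 < a -> exists2 K : R, 0 <= K &
  forall f j, (J0 <= j)%N -> hoelder_ball g J0 a M f -> measurable_fun setT f ->
  {ae mu, forall x, C1 <= f x <= C2} ->
  let cf x := clamp C1 C2 (f x) in
  <| fun x => cf x - Pi j cf x, fun x => cf x - Pi j cf x |> <=
  K * (2 `^ (- (2 * a))) ^+ j.
Proof.
move=> a0; set rho := 2 `^ (- (2 * a)).
have rho0 : 0 <= rho by exact: powR_ge0.
have rho1 : rho < 1.
  rewrite /rho powRN invf_lt1 ?powR_gt0//.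
  rewrite [ltLHS](_ : _ = 1 `^ (2 * a)); last by rewrite powR1.
  by apply: gt0_ltr_powR; rewrite ?nnegrE ?mulr_gt0// ltr1n.
exists (2 ^+ d * M ^+ 2 / (1 - rho)).
  have r1 : 0 <= 1 - rho by rewrite subr_ge0 ltW.
  by apply: divr_ge0 => //; apply: mulr_ge0; [exact: exprn_ge0|exact: sqr_ge0].
move=> f j J0j hf mf fC; cbv zeta.
set cf := fun x : d.-tuple R => clamp C1 C2 (f x).
have bcf : bnd cf by exact: (bnd_clamp C12 mf).
apply: (scal_residual_le g_cdv) => //; first exact: sqr_ge0.
move=> l io m J0l io0.
have -> : <| cf, wav g io m |> = ip f (wav g io m).
  have bw := bnd_wav g_cdv io m.
  rewrite ipE//; last exact: bw.1.
  apply: E_ae; first exact: (bndM bcf bw).1.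
    exact: measurable_funM mf bw.1.
  by apply: filterS fC => x fx; rewrite /cf clamp_id.
have h := hoelder_coef m hf J0l io0.
set c := ip f _ in h *; set q := 2 `^ _ in h.
have q0 : 0 < q by rewrite powR_gt0.
have -> : rho ^+ l = (2 ^+ l) ^+ d * (q ^+ 2)^-1.
  rewrite /q -powR_mulrn// -powRrM /rho -powR_mulrn ?powR_ge0// -powRrM.
  rewrite -exprM -powR_mulrn// -powRN -powRD; last by rewrite implybE pnatr_eq0 orbT.
  by congr (_ `^ _); rewrite natrM; field.
have -> : M ^+ 2 * ((2 ^+ l) ^+ d * (q ^+ 2)^-1) = (M / q) ^+ 2 * (2 ^+ l) ^+ d.
  by field; rewrite lt0r_neq0.
rewrite ler_wpM2r ?exprn_ge0//.
have h2 : `|c| <= M / q by rewrite ler_pdivlMr// mulrC.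
by rewrite -real_normK ?num_real// lerXn2r// nnegrE// (le_trans _ h2).
Qed.

End HoelderCoefficients.

Lemma weighted_sum_le (a b c e t u v w : R) :
  0 <= a -> 0 <= b -> 0 <= c -> 0 <= e -> 0 <= t -> 0 <= u -> 0 <= v -> 0 <= w ->
  a * t + b * u + c * v + e * w <= (a + b + c + e) * (t + u + v + w).
Proof.
move=> a0 b0 c0 e0 t0 u0 v0 w0; rewrite -subr_ge0.
have -> : (a + b + c + e) * (t + u + v + w) - (a * t + b * u + c * v + e * w) =
  a * (u + v + w) + b * (t + v + w) + c * (t + u + w) + e * (t + u + v) by ring.
by rewrite !addr_ge0// mulr_ge0// !addr_ge0.
Qed.

Section WorstRisk.
Variables (alpha beta C1 C2 M : R).
Hypotheses (d_gt0 : (0 < d)%N) (alpha_gt0 : 0 < alpha) (beta_gt0 : 0 < beta).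

Local Notation s := (alpha + beta).
Local Notation bias2 j := (dim j `^ (- (2 * s / d%:R))).
Local Notation cl := (clamp C1 C2).
Local Notation Model := (model g J0 alpha beta C1 C2 M).

(** Cauchy-Schwarz for the product of the two approximation errors. *)
Lemma bias_bound : exists2 K : R, 0 <= K &
  forall P p b j, (J0 <= j)%N -> Model P ->
  hoelder_ball g J0 alpha M p -> is_cond_exp P (@A_ R d) p ->
  hoelder_ball g J0 beta M b -> is_cond_exp P (@Y_ R d) b ->
  let p' x := cl (p x) in let b' x := cl (b x) in
  <| fun x => p' x - Pi j p' x, fun x => b' x - Pi j b' x |> ^+ 2 <= K * bias2 j.
Proof.
have [C12|/negP C12] := boolP (C1 <= C2); last first.
  by exists 0 => // P p b j _ /model_C12 /C12.
have [Ka Ka0 ha] := hoelder_residual_le C12 M alpha_gt0.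
have [Kb Kb0 hb] := hoelder_residual_le C12 M beta_gt0.
exists (Ka * Kb); first exact: mulr_ge0.
move=> P p b j J0j PM hp cp hbb cb; cbv zeta.
set p' := fun x : d.-tuple R => cl (p x); set b' := fun x : d.-tuple R => cl (b x).
have law := model_law PM.
have rA : {ae P, forall o, C1 <= A_ o <= C2}.
  by apply: filterS (model_range PM) => o [].
have rY : {ae P, forall o, C1 <= Y_ o <= C2}.
  by apply: filterS (model_range PM) => o [].
have [mp _ _ _] := cp; have [mb _ _ _] := cb.
have rp := cond_exp_range law C12 (@measurable_A R d) rA cp.
have rb := cond_exp_range law C12 (@measurable_Y R d) rY cb.
have bp' : bnd p' by exact: (bnd_clamp C12 mp).
have bb' : bnd b' by exact: (bnd_clamp C12 mb).
have bP f : bnd (Pi j f) by exact: bnd_proj.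
have := dot_CauchySchwarz mu (f := fun x => p' x - Pi j p' x)
  (g := fun x => b' x - Pi j b' x).
move=> /(_ (bndB bp' (bP _)) (bndB bb' (bP _))) /le_trans; apply.
rewrite dim_powR//.
have -> : Ka * Kb * 2 `^ (- (2 * s)) ^+ j =
  (Ka * 2 `^ (- (2 * alpha)) ^+ j) * (Kb * 2 `^ (- (2 * beta)) ^+ j).
  rewrite mulrACA -exprMn -powRD; last by rewrite implybE pnatr_eq0 orbT.
  by congr (_ * _ `^ _ ^+ _); ring.
by apply: ler_pM; rewrite ?dot_ge0//; [exact: ha|exact: hb].
Qed.

(** The hypotheses of the risk bounds for a general design. *)
Lemma model_setup P : Model P -> exists p b,
  let A' := fun o => cl (A_ o) in let Y' := fun o => cl (Y_ o) in
  let p' := fun x => cl (p x) in let b' := fun x => cl (b x) in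
  let C := `|C1| + `|C2| in
  [/\ [/\ hoelder_ball g J0 alpha M p, is_cond_exp P (@A_ R d) p,
      hoelder_ball g J0 beta M b & is_cond_exp P (@Y_ R d) b],
    [/\ bnd A', bnd Y', bnd p' & bnd b'],
    regression P mu (@X_ R d) A' p', regression P mu (@X_ R d) Y' b' &
    [/\ forall o, `|A' o| <= C, forall o, `|Y' o| <= C,
        forall x, `|p' x| <= C & forall x, `|b' x| <= C]].
Proof.
move=> PM; have C12 := model_C12 PM.
have [_ _ [p hp cp] [b hb cb]] := PM; exists p, b => A' Y' p' b' C.
have [mp _ _ _] := cp; have [mb _ _ _] := cb.
have rA : {ae P, forall o, C1 <= A_ o <= C2}.
  by apply: filterS (model_range PM) => o [].
have rY : {ae P, forall o, C1 <= Y_ o <= C2}.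
  by apply: filterS (model_range PM) => o [].
split => //.
- split; [exact: (bnd_clamp C12 (@measurable_A R d))
    |exact: (bnd_clamp C12 (@measurable_Y R d))|exact: (bnd_clamp C12 mp)
    |exact: (bnd_clamp C12 mb)].
- exact: (cond_exp_regression (model_law PM) C12 (@measurable_A R d) rA cp).
- exact: (cond_exp_regression (model_law PM) C12 (@measurable_Y R d) rY cb).
- by split => x; exact: clamp_abs.
Qed.

Local Notation risk est := (worst_risk g J0 alpha beta C1 C2 M (est : estimator R d)).

Let C := `|C1| + `|C2|.
Let C0 : 0 <= C. Proof. by rewrite addr_ge0. Qed.
Let A_ge1 : 1 <= A. Proof. by have [] := A_size. Qed.
Let A_ge0 : 0 <= A. Proof. exact: le_trans ler01 A_ge1. Qed.
Let B := C * (2 * A ^+ 4) ^+ d.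
Let kap := (A ^+ 3) ^+ d.
Let kap0 : 0 <= kap. Proof. by rewrite !exprn_ge0. Qed.

Let Piclamp_sup j f x : C1 <= C2 -> measurable_fun setT f ->
  `|Pi j (fun x => cl (f x)) x| <= B.
Proof.
move=> C12 mf; apply: (proj_scal_sup g_cdv A_size); first exact: (bnd_clamp C12 mf).
by move=> y; exact: clamp_abs.
Qed.

Let kernel_sup j x : repr_kernel (scal j) x x <= kap * dim j.
Proof. by rewrite -dimE; exact: (scal_kernel_le A_size). Qed.

Theorem worst_risk_INT_le : exists2 K : R, 0 < K & forall j1 j2 n,
  levels J0 j1 -> levels J0 j2 -> (0 < n)%N ->
  (risk (psi_INT g) j1 j2 n <=
   (K * (bias2 (minn (j1 n) (j2 n)) + n%:R^-1
      + n%:R^-1 ^+ 2 * dim (minn (j1 n) (j2 n))))%:E)%E.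
Proof.
have [Kb Kb0 hb] := bias_bound.
exists (Kb + 4 * C ^+ 4 + 2 * C ^+ 4 + 1).
  by rewrite ltr_wpDl// !addr_ge0// mulr_ge0// exprn_ge0.
move=> j1 j2 n L1 L2 n0; set j := minn _ _.
have J0j : (J0 <= j)%N by rewrite leq_min L1 L2.
apply: ge_ereal_sup => _ [P PM <-].
have [p [b [[hp cp hbb cb] [bA bY bp bb] regA regY [AC YC pC bC]]]] := model_setup PM.
rewrite (psi_INTE g_cdv) (risk_clamp PM (est := fun A Y => est_INT mu (@X_ R d) (scal (j1 n)) (scal (j2 n)) A Y (n := n)) _ _ cp cb); last 2 first.
- exact: est_INT_response.
- move=> A' Y' bA' bY'; exact: (bnd_est_INT P mu (@measurable_X R d) (@bscal _) (@bscal _) bA' bY').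
rewrite lee_fin.
have := mse_INT_le (@measurable_X R d) (unif_law (model_law PM)) (@bscal (j1 n))
  (@bscal (j2 n)) (oscal (L1 n)) (oscal (L2 n)) bA bY bp bb regA regY AC YC pC bC n0.
move=> /le_trans; apply; rewrite card_dim_min -/j.
rewrite bias_min// sqrrN -/j.
have := hb P p b j J0j PM hp cp hbb cb; cbv zeta.
set x := _ ^+ 2 => hx; set u := n%:R^-1.
have u0 : 0 <= u by rewrite invr_ge0.
have b0 : 0 <= bias2 j by exact: powR_ge0.
have k0 := ltW (dim_gt0 j).
have C40 : 0 <= C ^+ 4 by rewrite exprn_ge0.
have := @weighted_sum_le Kb (4 * C ^+ 4) (2 * C ^+ 4) 1 (bias2 j) u (u ^+ 2 * dim j) 0.
rewrite !mulr_ge0 ?sqr_ge0// addr0 mulr0 addr0 => /(_ Kb0 isT isT ler01 b0 u0 isT (lexx 0)).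
apply: le_trans; rewrite -/C -addrA; apply: lerD => //.
by rewrite le_eqVlt; apply/orP; left; apply/eqP; rewrite /C; ring.
Qed.

(** The noise in both regression estimates, multiplied, costs
    [dim j1 * dim j2 / n ^ 3]. *)
Lemma noise_expand (Kb a b c x y u k k1 k2 : R) : 0 <= Kb -> 0 <= a -> 0 <= b ->
  0 <= c -> 0 <= y -> 0 <= u -> 0 <= k1 -> 0 <= k2 -> x <= Kb * y -> k <= k1 + k2 ->
  x + u * (5 * c + 2 * c * (u * k)) + u * ((a + u * (b * k1)) * (a + u * (b * k2))) <=
  (Kb + (5 * c + a ^+ 2) + (2 * c + a * b) + b ^+ 2 + 1) *
    (y + u + u ^+ 2 * (k1 + k2) + u ^+ 3 * (k1 * k2)).
Proof.
move=> Kb0 a0 b0 c0 y0 u0 k10 k20 xy kk.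
have T0 : 0 <= y + u + u ^+ 2 * (k1 + k2) + u ^+ 3 * (k1 * k2).
  by rewrite !addr_ge0// mulr_ge0 ?exprn_ge0// ?addr_ge0// mulr_ge0.
have := @weighted_sum_le Kb (5 * c + a ^+ 2) (2 * c + a * b) (b ^+ 2) y u
  (u ^+ 2 * (k1 + k2)) (u ^+ 3 * (k1 * k2)) Kb0.
have e1 : 0 <= 5 * c + a ^+ 2 by rewrite addr_ge0 ?sqr_ge0// mulr_ge0.
have e2 : 0 <= 2 * c + a * b by rewrite addr_ge0// mulr_ge0.
have e3 : 0 <= u ^+ 2 * (k1 + k2) by rewrite mulr_ge0 ?sqr_ge0// addr_ge0.
have e4 : 0 <= u ^+ 3 * (k1 * k2) by rewrite mulr_ge0 ?exprn_ge0// mulr_ge0.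
move=> /(_ e1 e2 (sqr_ge0 b) y0 u0 e3 e4) h.
rewrite [leRHS]mulrDl mul1r; apply: le_trans (lerD h T0); rewrite addr0.
have h2 : 2 * c * u ^+ 2 * k <= 2 * c * u ^+ 2 * (k1 + k2).
  by rewrite ler_wpM2l// mulr_ge0 ?sqr_ge0// mulr_ge0.
have -> : u * (5 * c + 2 * c * (u * k)) = 5 * c * u + 2 * c * u ^+ 2 * k by ring.
have -> : u * ((a + u * (b * k1)) * (a + u * (b * k2))) =
  a ^+ 2 * u + a * b * (u ^+ 2 * (k1 + k2)) + b ^+ 2 * (u ^+ 3 * (k1 * k2)) by ring.
by nra.
Qed.

Let min_le j1 j2 : dim (minn j1 j2) <= dim j1 + dim j2.
Proof.
by rewrite dim_min ge_min lerDl (ltW (dim_gt0 j2)).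
Qed.

Theorem worst_risk_MC_le : exists2 K : R, 0 < K & forall j1 j2 n,
  levels J0 j1 -> levels J0 j2 -> (0 < n)%N ->
  (risk (psi_MC g) j1 j2 n <=
   (K * (bias2 (minn (j1 n) (j2 n)) + n%:R^-1
      + n%:R^-1 ^+ 2 * (dim (j1 n) + dim (j2 n))
      + n%:R^-1 ^+ 3 * (dim (j1 n) * dim (j2 n))))%:E)%E.
Proof.
have [Kb Kb0 hb] := bias_bound.
have C40 : 0 <= C ^+ 4 by rewrite exprn_ge0.
have b0 : 0 <= C ^+ 2 * kap by rewrite mulr_ge0 ?sqr_ge0.
exists (Kb + (5 * C ^+ 4 + (B ^+ 2) ^+ 2) + (2 * C ^+ 4 + B ^+ 2 * (C ^+ 2 * kap))
   + (C ^+ 2 * kap) ^+ 2 + 1).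
  by rewrite ltr_wpDl// !addr_ge0// ?sqr_ge0// mulr_ge0 ?sqr_ge0.
move=> j1 j2 n L1 L2 n0; set j := minn _ _.
have J0j : (J0 <= j)%N by rewrite leq_min L1 L2.
apply: ge_ereal_sup => _ [P PM <-].
have C12 := model_C12 PM.
have [p [b [[hp cp hbb cb] [bA bY bp bb] regA regY [AC YC pC bC]]]] := model_setup PM.
have [mp _ _ _] := cp; have [mb _ _ _] := cb.
rewrite psi_MCE (risk_clamp PM (est := fun A Y => est_MC (@X_ R d) (scal (j1 n)) (scal (j2 n)) A Y (n := n)) _ _ cp cb); last 2 first.
- exact: est_MC_response.
- move=> A' Y' bA' bY'.
  exact: (bnd_est_MC (@measurable_X R d) (@bscal _) (@bscal _) bA' bY').
rewrite lee_fin.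
have := mse_MC_le (@measurable_X R d) (unif_law (model_law PM)) (@bscal (j1 n))
  (@bscal (j2 n)) (oscal (L1 n)) (oscal (L2 n)) bA bY bp bb regA regY AC YC pC bC n0
  (fun x => Piclamp_sup _ x C12 mp) (fun x => Piclamp_sup _ x C12 mb)
  (kernel_sup _) (kernel_sup _).
move=> /le_trans; apply; rewrite card_dim_min -/j.
rewrite bias_min// sqrrN -/j.
have hx := hb P p b j J0j PM hp cp hbb cb.
have u0 : 0 <= n%:R^-1 :> R by rewrite invr_ge0.
have := noise_expand Kb0 (sqr_ge0 B) b0 C40 (powR_ge0 _ _) u0
  (ltW (dim_gt0 (j1 n))) (ltW (dim_gt0 (j2 n))) hx (min_le _ _).
rewrite -/j -!(mulrA (C ^+ 2)); apply: le_trans; rewrite lerD2r lerD2l ler_wpM2l//.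
by rewrite lerD2r ler_wpM2r// ler_nat.
Qed.

Theorem worst_risk_IF_le : exists2 K : R, 0 < K & forall j1 j2 n,
  levels J0 j1 -> levels J0 j2 -> (0 < n)%N ->
  (risk (psi_IF g) j1 j2 n <=
   (K * (bias2 (maxn (j1 n) (j2 n)) + n%:R^-1
      + n%:R^-1 ^+ 2 * (dim (j1 n) + dim (j2 n))
      + n%:R^-1 ^+ 3 * (dim (j1 n) * dim (j2 n))))%:E)%E.
Proof.
have [Kb Kb0 hb] := bias_bound.
have C40 : 0 <= C ^+ 4 by rewrite exprn_ge0.
pose a := 2 * C ^+ 2 + 2 * B ^+ 2; pose e := 2 * (C ^+ 2 * kap).
have a0 : 0 <= a by rewrite addr_ge0// mulr_ge0// sqr_ge0.
have b0 : 0 <= e by rewrite mulr_ge0// mulr_ge0 ?sqr_ge0.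
exists (Kb + (5 * C ^+ 4 + a ^+ 2) + (2 * C ^+ 4 + a * e) + e ^+ 2 + 1).
  by rewrite ltr_wpDl// !addr_ge0// ?sqr_ge0// mulr_ge0.
move=> j1 j2 n L1 L2 n0; set j := maxn _ _.
have J0j : (J0 <= j)%N by rewrite leq_max L1.
apply: ge_ereal_sup => _ [P PM <-].
have C12 := model_C12 PM.
have [p [b [[hp cp hbb cb] [bA bY bp bb] regA regY [AC YC pC bC]]]] := model_setup PM.
have [mp _ _ _] := cp; have [mb _ _ _] := cb.
rewrite psi_IFE (risk_clamp PM (est := fun A Y => est_IF (@X_ R d) (scal (j1 n)) (scal (j2 n)) A Y (n := n)) _ _ cp cb); last 2 first.
- exact: est_IF_response.
- move=> A' Y' bA' bY'.
  exact: (bnd_est_IF (@measurable_X R d) (@bscal _) (@bscal _) bA' bY').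
rewrite lee_fin.
have := mse_IF_le (@measurable_X R d) (unif_law (model_law PM)) (@bscal (j1 n))
  (@bscal (j2 n)) (oscal (L1 n)) (oscal (L2 n)) bA bY bp bb regA regY AC YC pC bC n0
  (fun x => Piclamp_sup _ x C12 mp) (fun x => Piclamp_sup _ x C12 mb)
  (kernel_sup _) (kernel_sup _).
move=> /le_trans; apply; rewrite card_dim_min.
rewrite bias_max// -/j.
have hx := hb P p b j J0j PM hp cp hbb cb.
have u0 : 0 <= n%:R^-1 :> R by rewrite invr_ge0.
have := noise_expand Kb0 a0 b0 C40 (powR_ge0 _ _) u0
  (ltW (dim_gt0 (j1 n))) (ltW (dim_gt0 (j2 n))) hx (min_le _ _).
apply: le_trans; rewrite le_eqVlt; apply/orP; left; apply/eqP.
by rewrite /a /e /C; ring.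
Qed.

End WorstRisk.
End UpperBounds.

(** * Cosines: orthogonality and local polynomial approximation *)

Section Cosines.
Variable R : realType.

Lemma sin_natpi n : sin (n%:R * pi) = 0 :> R.
Proof.
elim: n => [|n IH]; first by rewrite mul0r sin0.
by rewrite -natr1 mulrDl mul1r sinD IH sinpi mul0r mulr0 addr0.
Qed.

Let is_derive_lin (a b x : R) : is_derive x 1 (fun t : R => a * t + b) a.
Proof.
have -> : (fun t : R => a * t + b) = horner (a *: 'X + b%:P).
  by apply/funext => t; rewrite !hornerE.
have := is_derive_poly (a *: 'X + b%:P) x.
by rewrite derivD derivZ derivX derivC addr0 hornerZ hornerC mulr1.
Qed.

Let is_derive_sin_lin (a b x : R) :
  is_derive x 1 (fun t : R => sin (a * t + b)) (a * cos (a * x + b)).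
Proof.
rewrite mulrC; exact: (is_derive1_comp (f := sin) (g := fun t => a * t + b)).
Qed.

Let is_derive_cos_lin (a b x : R) :
  is_derive x 1 (fun t : R => cos (a * t + b)) (- (a * sin (a * x + b))).
Proof.
rewrite mulrC -mulNr; exact: (is_derive1_comp (f := cos) (g := fun t => a * t + b)).
Qed.

Let derive_continuous (f df : R -> R) :
  (forall x : R, is_derive x 1 f (df x)) -> continuous f.
Proof.
move=> h x; apply: differentiable_continuous; apply/derivable1_diffP.
by have [] := h x.
Qed.

Lemma bnd_cos (a b : R) : bnd (fun t : R => cos (a * t + b)).
Proof.
split.
  apply: continuous_measurable_fun.
  exact: (derive_continuous (is_derive_cos_lin a b)).
by exists 1 => t; exact: cos_max.
Qed.

(** Nonnegativity is what the fundamental theorem of calculus for the measure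
    needs; a cosine is first shifted by [1]. *)
Lemma E_unif01_derive (f F : R -> R) : bnd f -> continuous f ->
  (forall x : R, is_derive x 1 F (f x)) -> (forall x, 0 <= f x) ->
  \int[unif01 R]_t f t = F 1 - F 0.
Proof.
move=> bf cf dF f0.
have cF : continuous F := derive_continuous dF.
apply/EFin_inj; rewrite -EFin_E// unif01_ge0_integral; last 2 first.
- by apply/measurable_EFinP; exact: bf.1.
- by move=> x; rewrite lee_fin.
rewrite EFinB; apply: continuous_FTC2 => //.
- exact: continuous_subspaceT.
- split.
  + by move=> x _; have [] := dF x.
  + by apply: cvg_at_right_filter; exact: cF.
  + by apply: cvg_at_left_filter; exact: cF.
- by move=> x _; rewrite derive1E; have [_ ->] := dF x.
Qed.

Lemma E_cos_natpi n : (0 < n)%N -> \int[unif01 R]_t cos (n%:R * pi * t + 0) = 0.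
Proof.
move=> n0; set w := n%:R * pi.
have w0 : w != 0 by rewrite mulf_neq0 ?gt_eqF ?pi_gt0// ltr0n.
have bc := bnd_cos w 0.
have cc : continuous (fun t : R => cos (w * t + 0)).
  exact: (derive_continuous (is_derive_cos_lin w 0)).
pose F (t : R) := w^-1 * sin (w * t + 0) + (1 * t + 0).
have dF (x : R) : is_derive x 1 F (cos (w * x + 0) + 1).
  have := is_deriveD (is_deriveZ w^-1 (is_derive_sin_lin w 0 x)) (is_derive_lin 1 0 x).
  by rewrite /GRing.scale /= mulKf.
have bf : bnd (fun t => cos (w * t + 0) + 1) by exact: (bndD bc (bnd_cst _ 1)).
have cf : continuous (fun t : R => cos (w * t + 0) + 1).
  by move=> x; apply: cvgD; [exact: cc|exact: cvg_cst].
have f0 (x : R) : 0 <= cos (w * x + 0) + 1.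
  by have := cos_max (w * x + 0); rewrite ler_norml => /andP[]; lra.
have := E_unif01_derive bf cf dF f0.
rewrite E_add//; last exact: bnd_cst.
rewrite E_cst /F mulr0 mulr1 !addr0 sin0 /w sin_natpi; lra.
Qed.

(** The phase [+ 0] puts the argument in the affine form of the lemmas above; the
    family is orthonormal on the unit interval from [q = 1] on. *)
Definition cosine (q : nat) (t : R) : R := Num.sqrt 2 * cos (q%:R * pi * t + 0).

Lemma bnd_cosine q : bnd (cosine q).
Proof. by apply: bndM; [exact: bnd_cst|exact: bnd_cos]. Qed.

Lemma cosine_max q t : `|cosine q t| <= Num.sqrt 2.
Proof. by rewrite normrM ger0_norm ?sqrtr_ge0// ler_piMr ?sqrtr_ge0// cos_max. Qed.

Lemma cosine_dot q q' : (0 < q)%N -> (0 < q')%N ->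
  dot (unif01 R) (cosine q) (cosine q') = (q == q')%:R.
Proof.
wlog qq' : q q' / (q' <= q)%N.
  move=> h q0 q'0; case: (leqP q' q) => [|/ltnW] qq'; first exact: h.
  by rewrite dotC h// eq_sym.
move=> q0 q'0.
have b1 := bnd_cos ((q + q')%N%:R * pi) 0; have b2 := bnd_cos ((q - q')%N%:R * pi) 0.
have -> : dot (unif01 R) (cosine q) (cosine q') =
    \int[unif01 R]_t (cos ((q + q')%N%:R * pi * t + 0) + cos ((q - q')%N%:R * pi * t + 0)).
  apply: E_eq => t; rewrite /cosine !addr0 natrD natrB//.
  set a := q%:R * pi * t; set b := q'%:R * pi * t.
  have -> : (q%:R + q'%:R) * pi * t = a + b by rewrite /a /b; ring.
  have -> : (q%:R - q'%:R) * pi * t = a - b by rewrite /a /b; ring.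
  rewrite cosB cosD; have : Num.sqrt 2 ^+ 2 = 2 :> R by rewrite sqr_sqrtr.
  by move=> h; transitivity (Num.sqrt 2 ^+ 2 * (cos a * cos b)); [ring|rewrite h; ring].
rewrite E_add// E_cos_natpi ?addn_gt0 ?q0// add0r.
case: (eqVneq q q') => [<-|ne].
  rewrite subnn; rewrite -[RHS](E_cst (unif01 R)); apply: E_eq => t.
  by rewrite !mul0r addr0 cos0.
by rewrite E_cos_natpi// subn_gt0 ltn_neqAle eq_sym ne.
Qed.

Let vanish_bound (f df : R -> R) n : (forall x : R, is_derive x 1 f (df x)) -> f 0 = 0 ->
  (forall x, `|df x| <= `|x| ^+ n) -> forall x, `|f x| <= `|x| ^+ n.+1.
Proof.
move=> hd f0 hdf x; have cf := derive_continuous hd.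
have cw a b : {within `[a, b], continuous f} by exact: continuous_subspaceT.
have [x0|x0] := leP 0 x.
  have [c] := MVT_segment x0 (fun y _ => hd y) (cw _ _).
  rewrite in_itv/= => /andP[c0 cx]; rewrite f0 !subr0 => ->.
  rewrite normrM exprSr ler_wpM2r// (le_trans (hdf c))// lerXn2r ?nnegrE//.
  by rewrite !ger0_norm// (le_trans c0).
have [c] := MVT_segment (ltW x0) (fun y _ => hd y) (cw _ _).
rewrite in_itv/= => /andP[c0 cx]; rewrite f0 !sub0r => h.
rewrite -[f x]opprK h normrN normrM normrN exprSr ler_wpM2r//.
rewrite (le_trans (hdf c))// lerXn2r ?nnegrE//.
by rewrite !ler0_norm ?lerN2// ltW.
Qed.

(** Taylor polynomials; the induction runs over all phases since a derivative
    shifts the phase by a quarter of a period. *)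
Lemma cos_Taylor n (th : R) : exists2 T : {poly R}, (size T <= n)%N &
  forall x, `|cos (th + x) - T.[x]| <= `|x| ^+ n.
Proof.
elim: n th => [|n IH] th.
  by exists 0; rewrite ?size_poly0// => x; rewrite horner0 subr0 expr0 cos_max.
have [T sT hT] := IH (th + pi / 2).
pose U := (cos th)%:P + \poly_(i < n.+1) (T`_i.-1 / i%:R).
exists U.
  rewrite (leq_trans (size_polyD _ _))// geq_max size_poly andbT.
  by rewrite (leq_trans (size_polyC_leq1 _)).
have dU : U^`() = T.
  apply/polyP => i; rewrite coef_deriv /U coefD coefC /= add0r coef_poly ltnS.
  case: ltnP => [lt_in|le_ni]; last by rewrite mul0rn nth_default// (leq_trans sT).
  by rewrite /= -[LHS]mulr_natr divfK// pnatr_eq0.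
have U0 : U.[0] = cos th.
  rewrite /U hornerD hornerC horner_coef0 coef_poly/= invr0 mulr0 addr0 //.
pose f (x : R) := cos (1 * x + th) - U.[x].
have := @vanish_bound f (fun x => cos (th + pi / 2 + x) - T.[x]) n.
have df (x : R) : is_derive x 1 f (cos (th + pi / 2 + x) - T.[x]).
  have := is_deriveB (is_derive_cos_lin 1 th x) (is_derive_poly U x).
  rewrite dU mul1r mul1r -cosDpihalf.
  by have -> : x + th + pi / 2 = th + pi / 2 + x by ring.
move=> /(_ df); rewrite {1}/f mulr0 add0r U0 subrr => /(_ erefl hT) h x.
by have := h x; rewrite /f mul1r [x + th]addrC.
Qed.

End Cosines.

(** * Oscillating members of the Hoelder balls *)

Section Waves.
Variables (R : realType) (d S J0 : nat) (g : cdv_generators R).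
Hypothesis g_cdv : cdv_basis d g S J0.
Variable A : R.
Hypothesis A_size : size_bound g A.
Hypothesis S_ge1 : (1 <= S)%N.
Variable i0 : 'I_d.

Local Notation sq j := (Num.sqrt (2 ^+ j : R)).
Local Notation mu := (unif R d).
Local Notation "<| f , h |>" := (dot mu f h) (at level 0, f, h at level 200).
Local Notation scal := (@scal R d g).
Local Notation Pi j := (proj mu (scal j)).
Let bscal j m : bnd (scal j m). Proof. exact: (bnd_scal g_cdv). Qed.
Let oscal j : (J0 <= j)%N -> orthonormal mu predT (scal j).
Proof. exact: (scal_orthonormal g_cdv). Qed.
Let A_ge1 : 1 <= A. Proof. by have [] := A_size. Qed.
Let A_ge0 : 0 <= A. Proof. exact: le_trans ler01 A_ge1. Qed.
Let sq0 j : 0 < sq j. Proof. exact: sq_gt0. Qed.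

Let line j (k : 'I_(2 ^ j)) : R -> R := cdv1 g false j k.

Let bline j k : bnd (@line j k).
Proof. exact: (bnd_cdv1 g_cdv). Qed.

Let line_orthonormal j : (J0 <= j)%N -> orthonormal (unif01 R) predT (@line j).
Proof.
move=> J0j k k' _ _.
have e : (dot (unif01 R) (line k) (line k')) ^+ d = (k == k')%:R.
  have := oscal J0j (i := [ffun=> k]) (k := [ffun=> k']) isT isT.
  have -> : ([ffun=> k] == [ffun=> k'] :> Zidx d j) = (k == k').
    by apply/eqP/eqP => [/ffunP/(_ i0)|->//]; rewrite !ffunE.
  move=> <-; rewrite -[d in LHS]card_ord -prodr_const.
  rewrite -(E_iid_prod (unif01 R) (f := fun i t => line k t * line k' t)); last by bnd_tac.
  apply: E_eq => x; rewrite big_split /=.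
  by congr (_ * _); apply: eq_bigr => i _; rewrite !ffunE.
have d0 : (0 < d)%N := leq_ltn_trans (leq0n i0) (ltn_ord i0).
case: (eqVneq k k') => [kk|kk].
  move: e; rewrite -kk eqxx => /eqP; rewrite pexpr_eq1//; last exact: dot_ge0.
  by move=> /eqP.
by move: e; rewrite (negbTE kk) => /eqP; rewrite expf_eq0 d0/= => /eqP.
Qed.

Definition wave q (x : d.-tuple R) : R := cosine q (tnth x i0).

Lemma bnd_wave q : bnd (wave q).
Proof. by apply: bnd_tnth; exact: bnd_cosine. Qed.

Lemma wave_max q x : `|wave q x| <= Num.sqrt 2.
Proof. exact: cosine_max. Qed.

Lemma wave_dot q : (0 < q)%N -> <| wave q, wave q |> = 1.
Proof.
move=> q0; have := cosine_dot R q0 q0; rewrite eqxx; apply: etrans.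
apply: (E_iid_coord (unif01 R) i0 (f := fun t => cosine q t * cosine q t)).
by apply: bndM; exact: bnd_cosine.
Qed.

(** Only the scaling functions on the line matter for a wave in one coordinate.
    They are [2 ^ j] and so carry at most [2 ^ j] of the total energy of the first
    [4 * 2 ^ j] waves; some wave is far from the scaling space. *)
Lemma rough_wave j : (J0 <= j)%N -> exists q, [/\ (0 < q)%N, (q <= 4 * 2 ^ j)%N &
  2^-1 <= <| fun x => wave q x - Pi j (wave q) x, fun x => wave q x - Pi j (wave q) x |>].
Proof.
move=> J0j; pose N := (4 * 2 ^ j)%N.
(* The coefficients of a wave factor over the coordinates. *)
pose a (q : 'I_N) (i : 'I_d) (k : 'I_(2 ^ j)) : R :=
  dot (unif01 R) (if i == i0 then cosine q.+1 else fun=> 1) (line k).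
have coef (q : 'I_N) m : <| wave q.+1, scal j m |> = \prod_i a q i (m i).
  rewrite -(E_iid_prod (unif01 R) (f := fun i t =>
    (if i == i0 then cosine q.+1 else fun=> 1) t * line (m i) t)); last first.
    by move=> i; apply: bndM => //; case: ifP => _; [exact: bnd_cosine|exact: bnd_cst].
  apply: E_eq => x; rewrite big_split/=; congr (_ * _).
    by rewrite (bigD1 i0)//= eqxx big1 ?mulr1// => i /negbTE ->.
  by apply: eq_bigr => i _; rewrite ffunE.
have energy (q : 'I_N) : \sum_m <| wave q.+1, scal j m |> ^+ 2 <=
    \sum_k dot (unif01 R) (cosine q.+1) (@line j k) ^+ 2.
  under eq_bigr => m _ do rewrite coef -prodrXl.
  rewrite (sum_prod_ffun (fun i k => a q i k ^+ 2)) (bigD1 i0)//=.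
  rewrite -[leRHS]mulr1; apply: ler_pM.
  - by apply: sumr_ge0 => k _; exact: sqr_ge0.
  - by apply: prodr_ge0 => i _; apply: sumr_ge0 => k _; exact: sqr_ge0.
  - by rewrite le_eqVlt; apply/orP; left; apply/eqP; apply: eq_bigr => k _; rewrite /a eqxx.
  apply: prodr_ile1 => i ii0; rewrite sumr_ge0 => [/=|k _]; last exact: sqr_ge0.
  have := Bessel (@bline j) (line_orthonormal J0j) (bnd_cst _ 1).
  rewrite (_ : dot _ (fun=> 1) (fun=> 1) = 1); last first.
    by rewrite /dot; under eq_Rintegral do rewrite mulr1; rewrite E_cst.
  by rewrite /a (negbTE ii0).
have total : \sum_(q < N) \sum_m <| wave q.+1, scal j m |> ^+ 2 <= 2 ^+ j.
  apply: (@le_trans _ _ (\sum_(q < N) \sum_k dot (unif01 R) (cosine q.+1) (@line j k) ^+ 2)).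
    by apply: ler_sum => q _; exact: energy.
  rewrite exchange_big/=.
  have -> : 2 ^+ j = \sum_(k < 2 ^ j) 1 :> R by rewrite sumr_const card_ord natrX.
  apply: ler_sum => k _.
  have bc (q : 'I_N) : bnd (@cosine R q.+1) by exact: bnd_cosine.
  have oc : orthonormal (unif01 R) predT (fun q : 'I_N => @cosine R q.+1).
    by move=> q q' _ _; rewrite cosine_dot// eqSS.
  have := Bessel bc oc (@bline j k); rewrite line_orthonormal// eqxx.
  by under eq_bigr => q _ do rewrite dotC.
have [q hq] : exists q : 'I_N, \sum_m <| wave q.+1, scal j m |> ^+ 2 <= 2^-1.
  apply: contrapT => /forallNP h.
  have : N%:R * 2^-1 <= 2 ^+ j :> R.
    apply: le_trans total.
    have -> : N%:R * 2^-1 = \sum_(q < N) 2^-1 :> R by rewrite sumr_const card_ord mulr_natl.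
    by apply: ler_sum => q _; rewrite ltW// ltNge; exact/negP/h.
  by have := pow2_gt0 R j; rewrite /N natrM natrX; lra.
exists q.+1; split => //.
rewrite (proj_residual (@bscal j) (oscal J0j) (bnd_wave _)) wave_dot//.
by lra.
Qed.

Definition clamp01 : R -> R := clamp 0 1.

Let bnd_horner (T : {poly R}) (f : d.-tuple R -> R) : bnd f -> bnd (fun x => T.[f x]).
Proof.
move=> bf; under eq_fun do rewrite horner_coef.
by apply: bnd_sum => i _; bnd_tac.
Qed.

(** Above its own frequency a wave is locally a polynomial of degree less than
    [S] up to a small error, which the vanishing moments pick out. *)
Lemma wave_fine q l io (m : Zidx d l) : (J0 <= l)%N -> io != iota0 d ->
  `|<| wave q, wav g io m |>| <=
  Num.sqrt 2 * (q%:R * pi * (A / 2 ^+ l)) ^+ S * (2 * A ^+ 2 / sq l) ^+ d.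
Proof.
move=> J0l io0; have [_ [_ [supp _]]] := A_size.
have [t0 ht0] := supp (io i0) l (m i0) (ltn_ord _).
pose w := q%:R * pi : R; have w0 : 0 <= w by rewrite mulr_ge0// pi_ge0.
have [T sT hT] := cos_Taylor S (w * t0).
pose V := Num.sqrt 2 *: (T \Po (w *: ('X - t0%:P))).
have VE t : V.[t] = Num.sqrt 2 * T.[w * (t - t0)] by rewrite /V !hornerE horner_comp !hornerE.
have sV : (size V <= S)%N.
  rewrite (leq_trans (size_scale_leq _ _))//.
  rewrite (leq_trans (size_comp_poly_leq _ _))//.
  have s2 : (size (w *: ('X - t0%:P)) <= 2)%N.
    by rewrite (leq_trans (size_scale_leq _ _))// size_XsubC.
  case: (size T) sT => [|sT'] sT; first by rewrite mul0n.
  rewrite /= (leq_trans _ sT)// ltnS -[leqRHS]muln1 leq_mul2l -subn1 leq_subLR addn1.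
  by rewrite s2 orbT.
pose h (x : d.-tuple R) := V.[clamp01 (tnth x i0)].
have bcl : bnd (fun x : d.-tuple R => clamp01 (tnth x i0)).
  by apply: (bnd_tnth i0 (f := clamp01)); exact: (bnd_clamp ler01 (@measurable_id _ _ _)).
have bh : bnd h by exact: bnd_horner.
have hE : {ae mu, forall x, h x = V.[tnth x i0]}.
  by apply: filterS (ae_cube R d) => x cx; rewrite /h /clamp01 clamp_id.
have bw := bnd_wav g_cdv io m; have bq := bnd_wave q.
have -> : <| wave q, wav g io m |> = <| fun x => wave q x - h x, wav g io m |>.
  rewrite dotBl// (in_V_dot_wav0 g_cdv m J0l io0 bh) ?subr0//.
  by apply: in_V_ae hE _; exact: (poly_in_V g_cdv).
have bd : bnd (fun x => (wave q x - h x) * wav g io m x) by bnd_tac.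
apply: le_trans (le_normr_Rintegral _ (bnd_integrable mu bd)) _ => //.
pose e := Num.sqrt 2 * (w * (A / 2 ^+ l)) ^+ S.
have r0 : 0 <= w * (A / 2 ^+ l) by rewrite mulr_ge0// divr_ge0// ltW// pow2_gt0.
have e0 : 0 <= e by rewrite mulr_ge0 ?sqrtr_ge0// exprn_ge0.
apply: (@le_trans _ _ (\int[mu]_x (e * `|wav g io m x|))); last first.
  rewrite E_scale; last by bnd_tac.
  by rewrite ler_wpM2l//; exact: (wav_L1 g_cdv A_size).
apply: E_le_ae; [by bnd_tac|by bnd_tac|].
apply: filterS hE => x hx; rewrite normrM.
have [->|nz] := eqVneq (wav g io m x) 0; first by rewrite normr0 !mulr0.
rewrite ler_wpM2r// hx VE /wave /cosine -mulrBr normrM ger0_norm ?sqrtr_ge0//.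
rewrite /e ler_wpM2l ?sqrtr_ge0//.
have := hT (w * (tnth x i0 - t0)).
have -> : w * t0 + w * (tnth x i0 - t0) = q%:R * pi * tnth x i0 + 0 by rewrite /w; ring.
move=> /le_trans; apply; rewrite lerXn2r ?nnegrE//.
rewrite normrM (ger0_norm w0) ler_wpM2l//.
have c0 : cdv1 g (io i0) l (m i0) (tnth x i0) != 0.
  by apply: contraNneq nz => c0; rewrite /wav (bigD1 i0)//= c0 mul0r.
by rewrite ler_pdivlMr ?pow2_gt0// mulrC; exact: ht0.
Qed.

Lemma wave_coarse q l io (m : Zidx d l) :
  `|<| wave q, wav g io m |>| <= Num.sqrt 2 * (2 * A ^+ 2 / sq l) ^+ d.
Proof. by apply: (dot_wav_le g_cdv A_size io m (bnd_wave q)); exact: wave_max. Qed.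

Lemma pow_level (a : R) l : 2 `^ (l%:R * (a + d%:R / 2)) = (2 `^ a) ^+ l * (sq l) ^+ d.
Proof.
rewrite mulrDr powRD; last by rewrite implybE pnatr_eq0 orbT.
congr (_ * _); first by rewrite mulrC powRrM powR_mulrn// powR_ge0.
rewrite -powR12_sqrt ?exprn_ge0// -powR_mulrn// -powR_mulrn ?powR_ge0// -!powRrM.
by congr (_ `^ _); ring.
Qed.

(** One constant for both regimes of [wave_coef]. *)
Definition Cwave : R := Num.sqrt 2 * (1 + (4 * pi * A) ^+ S) * (2 * A ^+ 2) ^+ d.

Lemma Cwave_ge0 : 0 <= Cwave.
Proof.
rewrite !mulr_ge0 ?sqrtr_ge0 ?exprn_ge0 ?addr_ge0// ?mulr_ge0 ?exprn_ge0//.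
by rewrite !mulr_ge0// pi_ge0.
Qed.

(** Below level [j] the size of the wavelets decides, above it the vanishing
    moments: in both regimes the normalised coefficient is of the order it has at
    level [j]. *)
Lemma wave_coef (a : R) j q l io (m : Zidx d l) : 0 < a -> a <= S%:R ->
  (q <= 4 * 2 ^ j)%N -> (J0 <= l)%N -> io != iota0 d ->
  2 `^ (l%:R * (a + d%:R / 2)) * `|<| wave q, wav g io m |>| <= Cwave * (2 `^ a) ^+ j.
Proof.
move=> a0 aS qj J0l io0; rewrite pow_level.
have p1 : 1 <= 2 `^ a :> R.
  by rewrite -[leLHS](powRr0 2) ler_powR// ?ler1n// ltW.
have p0 : 0 <= 2 `^ a :> R by exact: powR_ge0.
have ss : 0 <= sq l ^+ d by rewrite exprn_ge0// ltW.
pose D := (2 * A ^+ 2) ^+ d; have D0 : 0 <= D by rewrite exprn_ge0// mulr_ge0// exprn_ge0.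
have eD : sq l ^+ d * (2 * A ^+ 2 / sq l) ^+ d = D.
  by rewrite -exprMn mulrC divfK// lt0r_neq0.
have s2 : 0 <= Num.sqrt 2 :> R by exact: sqrtr_ge0.
have P0 : 0 <= (4 * pi * A) ^+ S by rewrite exprn_ge0// !mulr_ge0// pi_ge0.
have [lj|jl] := leqP l j.
  apply: (@le_trans _ _ ((2 `^ a) ^+ l * (Num.sqrt 2 * D))).
    rewrite -mulrA ler_wpM2l ?exprn_ge0// -eD mulrCA ler_wpM2l//.
    exact: wave_coarse.
  rewrite mulrC; apply: ler_pM; [exact: mulr_ge0|exact: exprn_ge0| |].
    rewrite /Cwave -/D -mulrA ler_wpM2l// -[leLHS]mul1r ler_wpM2r// lerDl//.
  by apply: ler_weXn2l.
have := wave_fine q m J0l io0; rewrite -/D => h.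
pose r := q%:R * pi * (A / 2 ^+ l).
have r0 : 0 <= r.
  by rewrite !mulr_ge0// ?pi_ge0// invr_ge0 ltW// pow2_gt0.
have rle : r <= (4 * pi * A) * (2 ^+ (l - j))^-1.
  have -> : (2 ^+ (l - j))^-1 = 2 ^+ j / 2 ^+ l :> R.
    by rewrite -[in RHS](subnK (ltnW jl)) exprD invfM mulrCA mulrV ?mulr1// unitfE lt0r_neq0// pow2_gt0.
  have -> : 4 * pi * A * (2 ^+ j / 2 ^+ l) = (4 * 2 ^+ j) * pi * (A / 2 ^+ l) by ring.
  rewrite /r ler_wpM2r ?divr_ge0 ?exprn_ge0// ler_wpM2r ?pi_ge0//.
  by rewrite -[2]/(2%:R) -[4]/(4%:R) -natrX -natrM ler_nat.
have rS : r ^+ S * (2 `^ a) ^+ (l - j) <= (4 * pi * A) ^+ S.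
  have h1 : r ^+ S <= ((4 * pi * A) * (2 ^+ (l - j))^-1) ^+ S.
    by rewrite lerXn2r ?nnegrE// (le_trans r0 rle).
  have h2 : (2 `^ a) ^+ (l - j) <= (2 ^+ (l - j)) ^+ S.
    rewrite exprAC lerXn2r ?nnegrE ?exprn_ge0// -powR_mulrn//.
    by rewrite ler_powR// ler1n.
  apply: le_trans (ler_pM _ _ h1 h2) _; rewrite ?exprn_ge0//.
  by rewrite -exprMn divfK// lt0r_neq0// pow2_gt0.
apply: (@le_trans _ _ ((2 `^ a) ^+ l * (Num.sqrt 2 * r ^+ S * D))).
  rewrite -mulrA ler_wpM2l ?exprn_ge0// -eD mulrCA ler_wpM2l//.
have -> : (2 `^ a) ^+ l * (Num.sqrt 2 * r ^+ S * D) =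
   Num.sqrt 2 * D * (r ^+ S * (2 `^ a) ^+ (l - j)) * (2 `^ a) ^+ j.
  by rewrite -[in LHS](subnK (ltnW jl)) exprD; ring.
rewrite ler_wpM2r ?exprn_ge0// /Cwave -/D.
have -> : Num.sqrt 2 * (1 + (4 * pi * A) ^+ S) * D =
  Num.sqrt 2 * D * (1 + (4 * pi * A) ^+ S) by ring.
by rewrite ler_wpM2l ?mulr_ge0// (le_trans rS)// lerDr.
Qed.

Lemma cos_Lipschitz (x y : R) : `|cos x - cos y| <= `|x - y|.
Proof.
have [T sT hT] := cos_Taylor 1 y.
have Tc z : T.[z] = cos y.
  have -> : T.[z] = T.[0] by rewrite (size1_polyC sT) !hornerC.
  by have := hT 0; rewrite expr1 normr0 normr_le0 addr0 subr_eq0 => /eqP.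
by have := hT (x - y); rewrite Tc expr1 [y + _]addrC subrK.
Qed.

Lemma uc_wave q : unif_continuous_on_cube (wave q).
Proof.
move=> e e0; pose L := Num.sqrt 2 * (q%:R * pi) + 1 : R.
have L0 : 0 < L by rewrite ltr_wpDl// !mulr_ge0 ?sqrtr_ge0// pi_ge0.
exists (e / L); first exact: divr_gt0.
move=> x y _ _ /(_ i0); rewrite ltr_pdivlMr// => h; apply: le_lt_trans h.
rewrite /wave /cosine -mulrBr normrM ger0_norm ?sqrtr_ge0//.
apply: (@le_trans _ _ (Num.sqrt 2 * (q%:R * pi * `|tnth x i0 - tnth y i0|))).
  rewrite ler_wpM2l ?sqrtr_ge0//; apply: le_trans (cos_Lipschitz _ _) _.
  rewrite [X in `|X|](_ : _ = q%:R * pi * (tnth x i0 - tnth y i0)); last by ring.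
  by rewrite normrM ger0_norm// mulr_ge0// pi_ge0.
by rewrite mulrA mulrC ler_wpM2l// /L lerDl.
Qed.

(** The same for the coarsest scaling functions, which lie below level [j]. *)
Lemma wave_coef0 (a : R) j q (m : Zidx d J0) : 0 < a -> (J0 <= j)%N ->
  2 `^ (J0%:R * (a + d%:R / 2)) * `|<| wave q, scal J0 m |>| <= Cwave * (2 `^ a) ^+ j.
Proof.
move=> a0 J0j; rewrite pow_level.
have p1 : 1 <= 2 `^ a :> R.
  by rewrite -[leLHS](powRr0 2) ler_powR// ?ler1n// ltW.
have s2 : 0 <= Num.sqrt 2 :> R by exact: sqrtr_ge0.
pose D := (2 * A ^+ 2) ^+ d; have D0 : 0 <= D by rewrite exprn_ge0// mulr_ge0// exprn_ge0.
have P0 : 0 <= (4 * pi * A) ^+ S by rewrite exprn_ge0// !mulr_ge0// pi_ge0.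
have p0 : 0 <= 2 `^ a :> R by exact: powR_ge0.
have eD : sq J0 ^+ d * (2 * A ^+ 2 / sq J0) ^+ d = D.
  by rewrite -exprMn mulrC divfK// lt0r_neq0.
apply: (@le_trans _ _ ((2 `^ a) ^+ J0 * (Num.sqrt 2 * D))).
  rewrite -mulrA ler_wpM2l ?exprn_ge0// -eD mulrCA ler_wpM2l//.
  exact: wave_coarse.
rewrite mulrC; apply: ler_pM; [exact: mulr_ge0|exact: exprn_ge0| |].
  rewrite /Cwave -/D -mulrA ler_wpM2l// -[leLHS]mul1r ler_wpM2r// lerDl//.
by apply: ler_weXn2l.
Qed.

End Waves.

(** * Perturbing members of the Hoelder balls *)

Section HoelderBalls.
Variables (R : realType) (d S J0 : nat) (g : cdv_generators R).
Hypothesis g_cdv : cdv_basis d g S J0.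
Variable A : R.
Hypothesis A_size : size_bound g A.
Hypothesis S_ge1 : (1 <= S)%N.
Hypothesis d_gt0 : (0 < d)%N.

Local Notation mu := (unif R d).
Local Notation "<| f , h |>" := (dot mu f h) (at level 0, f, h at level 200).
Local Notation scal := (@scal R d g).
Implicit Types f h u : d.-tuple R -> R.

Lemma uc_add f h : unif_continuous_on_cube f -> unif_continuous_on_cube h ->
  unif_continuous_on_cube (fun x => f x + h x).
Proof.
move=> ucf uch e e0; have e2 : 0 < e / 2 by rewrite divr_gt0.
have [r r0 hr] := ucf _ e2; have [t t0 ht] := uch _ e2.
exists (Num.min r t); first by rewrite lt_min r0.
move=> x y cx cy xy.
have -> : f x + h x - (f y + h y) = (f x - f y) + (h x - h y) by ring.
apply: le_lt_trans (ler_normD _ _) _; rewrite (splitr e); apply: ltrD.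
  by apply: hr => // i; have := xy i; rewrite lt_min => /andP[].
by apply: ht => // i; have := xy i; rewrite lt_min => /andP[].
Qed.

Lemma uc_scale c f : unif_continuous_on_cube f ->
  unif_continuous_on_cube (fun x => c * f x).
Proof.
move=> ucf e e0; have c0 : 0 < `|c| + 1 by rewrite ltr_wpDl.
have [r r0 hr] := ucf _ (divr_gt0 e0 c0); exists r => // x y cx cy xy.
have := hr x y cx cy xy; rewrite ltr_pdivlMr// -mulrBr normrM.
by move=> h; apply: le_lt_trans h; rewrite mulrC ler_wpM2l// lerDl.
Qed.

Lemma uc_cst c : unif_continuous_on_cube (fun _ : d.-tuple R => c).
Proof. by move=> e e0; exists 1 => // x y _ _ _; rewrite subrr normr0. Qed.

Lemma uc_clamp C1 C2 f : unif_continuous_on_cube f ->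
  unif_continuous_on_cube (fun x => clamp C1 C2 (f x)).
Proof.
move=> ucf e e0; have [r r0 hr] := ucf _ e0; exists r => // x y cx cy xy.
exact: le_lt_trans (clamp_Lipschitz _ _ _ _) (hr x y cx cy xy).
Qed.

(** The two parts of the norm get separate bounds, so that a perturbation can be
    charged to each. *)
Lemma hoelder_elim a M f : hoelder_ball g J0 a M f ->
  exists c w, [/\ 0 <= c, 0 <= w, c + w <= M,
    forall m, 2 `^ (J0%:R * (a + d%:R / 2)) * `|ip f (Phi g (j := J0) m)| <= c &
    forall l io (m : Zidx d l), (J0 <= l)%N -> io != iota0 d ->
      2 `^ (l%:R * (a + d%:R / 2)) * `|ip f (wav g io m)| <= w].
Proof.
move=> [_]; set b := \big[_/_]_(_ : _) _; set s := ereal_sup _ => hM.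
pose c := 2 `^ (J0%:R * (a + d%:R / 2)) * b.
have c0 : 0 <= c by rewrite mulr_ge0 ?powR_ge0// bigmax_ge_id.
have sub l io (m : Zidx d l) : (J0 <= l)%N -> io != iota0 d ->
    ((2 `^ (l%:R * (a + d%:R / 2)) * `|ip f (wav g io m)|)%:E <= s)%E.
  by move=> J0l io0; apply: ereal_sup_ubound; exists l, io, m.
have s0 : (0 <= s)%E.
  have k0 : (0 < 2 ^ J0)%N by rewrite expn_gt0.
  pose m : Zidx d J0 := [ffun=> Ordinal k0].
  have io0 : [ffun=> true] != iota0 d.
    by apply/eqP => /ffunP/(_ (Ordinal d_gt0)); rewrite !ffunE.
  by apply: le_trans (sub J0 _ m (leqnn _) io0); rewrite lee_fin mulr_ge0 ?powR_ge0.
have sfin : s \is a fin_num.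
  rewrite fin_numElt (lt_le_trans _ s0) ?ltNy0//=.
  have : (s <= c%:E + s)%E by rewrite leeDr// lee_fin.
  by move=> /le_lt_trans; apply; apply: le_lt_trans hM _; exact: ltry.
exists c, (fine s); split => //.
- by rewrite fine_ge0.
- by move: hM; rewrite -(fineK sfin) -EFinD lee_fin.
- by move=> m; rewrite ler_wpM2l ?powR_ge0//; exact: le_bigmax.
- by move=> l io m J0l io0; rewrite -lee_fin fineK//; exact: sub.
Qed.

Lemma hoelder_intro a M f c w : unif_continuous_on_cube f -> 0 <= c -> c + w <= M ->
  (forall m, 2 `^ (J0%:R * (a + d%:R / 2)) * `|ip f (Phi g (j := J0) m)| <= c) ->
  (forall l io (m : Zidx d l), (J0 <= l)%N -> io != iota0 d ->
      2 `^ (l%:R * (a + d%:R / 2)) * `|ip f (wav g io m)| <= w) ->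
  hoelder_ball g J0 a M f.
Proof.
move=> ucf c0 cw hc hw; split => //; apply: (@le_trans _ _ (c%:E + w%:E)%E); last first.
  by rewrite -EFinD lee_fin.
apply: leeD.
  rewrite lee_fin -ler_pdivlMl ?powR_gt0//; apply: bigmax_le => [|m _].
    by rewrite mulr_ge0// invr_ge0 powR_ge0.
  by rewrite ler_pdivlMl ?powR_gt0.
by apply: ge_ereal_sup => _ [l [io [m [J0l io0 ->]]]]; rewrite lee_fin; exact: hw.
Qed.

Lemma ip_clamp C1 C2 f phi : C1 <= C2 -> measurable_fun setT f -> bnd phi ->
  {ae mu, forall x, C1 <= f x <= C2} -> ip (fun x => clamp C1 C2 (f x)) phi = ip f phi.
Proof.
move=> C12 mf bphi fC; have bcf := bnd_clamp C12 mf.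
rewrite !ipE//; [|exact: bphi.1|exact: bcf.1|exact: bphi.1].
apply: E_ae; first exact: (bndM bcf bphi).1.
  exact: measurable_funM mf bphi.1.
by apply: filterS fC => x fx; rewrite clamp_id.
Qed.


End HoelderBalls.

(** * Two-point responses *)

Section TwoPoint.
Variables (R : realType) (d : nat) (C1 C2 : R).
Hypothesis C12 : C1 < C2.

Local Notation mu := (unif R d).
Local Notation X := (@X_ R d).
Local Notation cl := (clamp C1 C2).

(** The value [C2] with probability [t], for [u] uniform. *)
Definition two_point (t u : R) : R := if u <= t then C2 else C1.

Lemma E_below (t : R) : 0 <= t <= 1 -> \int[unif01 R]_u (u <= t)%R%:R = t.
Proof.
move=> /andP[t0 t1]; rewrite /Rintegral.
rewrite (unif01_ge0_integral (f := fun u => ((u <= t)%R%:R)%:E)); last first.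
- by move=> u; rewrite lee_fin.
- have -> : (fun u : R => ((u <= t)%R%:R)%:E) = EFin \o \1_(`]-oo, t]%classic) :> (R -> \bar R).
    apply/funext => u /=; rewrite indicE; congr (_%:R)%:E.
    by rewrite mem_setE in_itv.
  by apply/measurable_EFinP; exact: measurable_indic.
have -> : (\int[lebesgue_measure]_(x in `[0%R, 1%R]) ((x <= t)%R%:R : R)%:E =
  \int[lebesgue_measure]_(x in `[0%R, 1%R]) (\1_(`[0, t]%classic) x)%:E)%E.
  apply: eq_integral => x /set_mem/=; rewrite in_itv/= => /andP[x0 x1].
  rewrite indicE; congr (_%:R)%:E.
  by rewrite mem_setE in_itv/= x0.
rewrite integral_indic//= setIidl; last first.
  by move=> x /=; rewrite !in_itv/= => /andP[-> /le_trans]; exact.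
by rewrite lebesgue_measure_itv/= lte_fin; case: ltP => /= h; rewrite ?subr0//; lra.
Qed.

Lemma E_two_point (G : R -> R) (t : R) : 0 <= t <= 1 ->
  \int[unif01 R]_u G (two_point t u) = G C1 * (1 - t) + G C2 * t.
Proof.
move=> t01; have bi : bnd (fun u : R => (u <= t)%R%:R : R).
  have -> : (fun u : R => (u <= t)%R%:R) = \1_(`]-oo, t]%classic) :> (R -> R).
    apply/funext => u /=; rewrite indicE; congr (_%:R).
    by rewrite mem_setE in_itv.
  exact: bnd_indic.
transitivity (\int[unif01 R]_u (G C1 + (G C2 - G C1) * (u <= t)%R%:R)).
  by apply: E_eq => u; rewrite /two_point; case: ifP => _; rewrite ?mulr1 ?mulr0; ring.
by rewrite E_add; [|bnd_tac|bnd_tac]; rewrite E_cst E_scale// E_below//; ring.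
Qed.

Variables (pr rh : d.-tuple R -> R).
Hypotheses (mpr : measurable_fun setT pr) (mrh : measurable_fun setT rh).
Hypotheses (pr01 : forall x, 0 <= pr x <= 1) (rh01 : forall x, 0 <= rh x <= 1).

Definition draw (z : obs R d) : obs R d :=
  (z.1.1, two_point (pr z.1.1) z.1.2, two_point (rh z.1.1) z.2).

Let measurable_two (h : obs R d -> R) (t : d.-tuple R -> R) :
  measurable_fun setT h -> measurable_fun setT t ->
  measurable_fun setT (fun z => two_point (t (X z)) (h z)).
Proof.
move=> mh mt; apply: measurable_fun_ifT => //.
by apply: measurable_fun_ler => //; exact: measurableT_comp mt (@measurable_X R d).
Qed.

Lemma measurable_draw : measurable_fun setT draw.
Proof.
apply/measurable_fun_pairP; split.
  apply/measurable_fun_pairP; split; first exact: measurable_X.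
  exact: measurable_two (@measurable_A R d) mpr.
exact: measurable_two (@measurable_Y R d) mrh.
Qed.

Definition draw_mfun : {mfun obs R d >-> obs R d} :=
  HB.pack draw (isMeasurableFun.Build _ _ _ _ draw measurable_draw).

(** The design is uniform and, given it, the responses are independent, each
    taking the values [C1] and [C2]. *)
Definition two_point_law : probability (obs R d) R :=
  distribution ((mu \x unif01 R) \x unif01 R)%E draw_mfun.

Lemma two_point_A (G : R -> R) h : bnd G -> bnd h ->
  \int[two_point_law]_o (G (A_ o) * h (X o)) =
  \int[mu]_x ((G C1 * (1 - pr x) + G C2 * pr x) * h x).
Proof.
move=> bG bh.
have bF : bnd (fun o : obs R d => G (A_ o) * h (X o)).
  by apply: bndM; [exact: (bnd_comp (@measurable_A R d) bG)|exact: (bnd_comp (@measurable_X R d) bh)].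
rewrite (E_distribution _ draw_mfun bF).
have bFd : bnd (fun z => G (A_ (draw z)) * h (X (draw z))).
  exact: (bnd_comp measurable_draw bF).
rewrite (E_prod _ _ bFd).
have bF1 : bnd (fun z : d.-tuple R * R => G (A_ (draw (z, 0))) * h (X (draw (z, 0)))).
  by apply: (bnd_comp (h := fun z : d.-tuple R * R => (z, 0 : R)) _ bFd).
transitivity (\int[(mu \x unif01 R)%E]_z (G (A_ (draw (z, 0))) * h (X (draw (z, 0))))).
  by apply: E_eq => z; rewrite (E_cst (unif01 R) (G (A_ (draw (z, 0))) * h (X (draw (z, 0))))).
rewrite (E_prod _ _ bF1); apply: E_eq => x.
rewrite -E_two_point// -E_scaler//.
apply: (bnd_comp (f := G)) => //.
have mt : measurable_fun setT (fun z : R => two_point (pr x) z).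
  by apply: measurable_fun_ifT => //; apply: measurable_fun_ler.
exact: mt.
Qed.

Lemma two_point_Y (G : R -> R) h : bnd G -> bnd h ->
  \int[two_point_law]_o (G (Y_ o) * h (X o)) =
  \int[mu]_x ((G C1 * (1 - rh x) + G C2 * rh x) * h x).
Proof.
move=> bG bh.
have bF : bnd (fun o : obs R d => G (Y_ o) * h (X o)).
  by apply: bndM; [exact: (bnd_comp (@measurable_Y R d) bG)|exact: (bnd_comp (@measurable_X R d) bh)].
rewrite (E_distribution _ draw_mfun bF).
have bFd : bnd (fun z => G (Y_ (draw z)) * h (X (draw z))).
  exact: (bnd_comp measurable_draw bF).
rewrite (E_prod _ _ bFd).
pose m x := (G C1 * (1 - rh x) + G C2 * rh x) * h x.
have brh : bnd rh.
  by split => //; exists 1 => x; have /andP[h0 h1] := rh01 x; rewrite ger0_norm.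
have bm : bnd m by rewrite /m; bnd_tac.
transitivity (\int[(mu \x unif01 R)%E]_z m z.1).
  apply: E_eq => z; rewrite /m -E_two_point// -E_scaler//.
  apply: (bnd_comp (f := G)) => //.
  by apply: measurable_fun_ifT => //; apply: measurable_fun_ler.
rewrite (E_prod _ _ (bnd_comp (h := fst) measurable_fst bm)).
by apply: E_eq => x; rewrite (E_cst (unif01 R) (m x)).
Qed.

Lemma two_point_X B : measurable B -> two_point_law (X @^-1` B) = mu B.
Proof.
move=> mB; rewrite /two_point_law /distribution /pushforward/=.
have -> : draw @^-1` (X @^-1` B) = (B `*` setT) `*` setT.
  by apply/seteqP; split => z /=; [|case=> -[]].
have U1 : unif01 R setT = 1%E := probability_setT (unif01 R).
transitivity ((mu \x unif01 R)%E (B `*` setT) * unif01 R setT)%E.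
  by apply: product_measure1E => //; exact: measurableX.
rewrite U1 mule1; transitivity (mu B * unif01 R setT)%E.
  by apply: product_measure1E.
by rewrite U1 mule1.
Qed.

Lemma two_point_range (o : obs R d) : C1 <= A_ (draw o) <= C2 /\ C1 <= Y_ (draw o) <= C2.
Proof. by rewrite /draw /A_ /Y_ /= /two_point; split; case: ifP => _; rewrite ?lexx ltW. Qed.

Lemma two_point_ae : {ae two_point_law, forall o, C1 <= A_ o <= C2 /\ C1 <= Y_ o <= C2}.
Proof.
have mA := @measurable_A R d measurableT `[C1, C2]%classic (measurable_itv _).
have mY := @measurable_Y R d measurableT `[C1, C2]%classic (measurable_itv _).
exists (~` ((setT `&` @A_ R d @^-1` `[C1, C2]) `&` (setT `&` @Y_ R d @^-1` `[C1, C2]))).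
split; first by apply: measurableC; exact: measurableI.
- rewrite /two_point_law /distribution /pushforward/=.
  rewrite (_ : draw @^-1` _ = set0) ?measure0//; apply/seteqP; split => // o /=.
  by apply; have [h1 h2] := two_point_range o; split; split=> //; rewrite in_itv.
- by move=> o /= h; apply: contra_not h => -[[_ +] [_ +]]; rewrite !in_itv.
Qed.

Lemma two_point_cond_exp (W : obs R d -> R) (w : d.-tuple R -> R) :
  measurable_fun setT W -> measurable_fun setT w -> (forall x, 0 <= w x <= 1) ->
  {ae two_point_law, forall o, C1 <= W o <= C2} ->
  (forall G h, bnd G -> bnd h -> \int[two_point_law]_o (G (W o) * h (X o)) =
     \int[mu]_x ((G C1 * (1 - w x) + G C2 * w x) * h x)) ->
  is_cond_exp two_point_law W (fun x => C1 + (C2 - C1) * w x).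
Proof.
move=> mW mw w01 Wae key.
have bw : bnd w.
  by split => //; exists 1 => x; have /andP[h0 h1] := w01 x; rewrite ger0_norm.
have bf : bnd (fun x => C1 + (C2 - C1) * w x) by bnd_tac.
have bfX := bnd_comp (@measurable_X R d) bf.
have mX := @measurable_X R d.
have C12' := ltW C12.
split; first exact: bf.1.
- apply: (ae_bnd_integrable (C := `|C1| + `|C2|) mW).
  by apply: filterS Wae => o h; rewrite -(clamp_id h); exact: clamp_abs.
- exact: (bnd_integrable _ bfX).
move=> B mB; have bi : bnd (\1_B : d.-tuple R -> R) by exact: bnd_indic.
have biX := bnd_comp mX bi.
have bcW := bnd_clamp C12' mW.
rewrite !Rintegral_indic (unif_law two_point_X (h := fun x => (C1 + (C2 - C1) * w x) * \1_B x)); last by bnd_tac.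
transitivity (\int[two_point_law]_o (cl (W o) * \1_B (X o))).
  apply: E_ae; first by apply: measurable_funM => //; exact: biX.1.
    exact: (bndM bcW biX).1.
  by apply: filterS Wae => o h; rewrite clamp_id.
rewrite (key cl)//; last exact: (bnd_clamp C12' (@measurable_id _ _ _)).
by apply: E_eq => x; rewrite !clamp_id ?lexx ?ltW//; ring.
Qed.

Lemma two_point_cond_A :
  is_cond_exp two_point_law (@A_ R d) (fun x => C1 + (C2 - C1) * pr x).
Proof.
apply: two_point_cond_exp => //; [exact: measurable_A| |exact: two_point_A].
by apply: filterS two_point_ae => o [].
Qed.

Lemma two_point_cond_Y :
  is_cond_exp two_point_law (@Y_ R d) (fun x => C1 + (C2 - C1) * rh x).
Proof.
apply: two_point_cond_exp => //; [exact: measurable_Y| |exact: two_point_Y].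
by apply: filterS two_point_ae => o [].
Qed.

Lemma two_point_model (J0 : nat) g (alpha beta M : R) :
  hoelder_ball g J0 alpha M (fun x => C1 + (C2 - C1) * pr x) ->
  hoelder_ball g J0 beta M (fun x => C1 + (C2 - C1) * rh x) ->
  model g J0 alpha beta C1 C2 M two_point_law.
Proof.
move=> hp hb; split; [exact: two_point_X|exact: two_point_ae| |].
- by exists (fun x => C1 + (C2 - C1) * pr x) => //; exact: two_point_cond_A.
- by exists (fun x => C1 + (C2 - C1) * rh x) => //; exact: two_point_cond_Y.
Qed.

End TwoPoint.

(** * Worst-case risk: lower bounds *)

Section LowerBounds.
Variables (R : realType) (d S J0 : nat) (g : cdv_generators R).
Hypothesis g_cdv : cdv_basis d g S J0.
Variable A : R.
Hypothesis A_size : size_bound g A.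
Hypotheses (S_ge1 : (1 <= S)%N) (d_gt0 : (0 < d)%N).
Variables (C1 C2 : R).
Hypothesis C12 : C1 < C2.

Local Notation mu := (unif R d).
Local Notation "<| f , h |>" := (dot mu f h) (at level 0, f, h at level 200).
Local Notation scal := (@scal R d g).
Local Notation Pi j := (proj mu (scal j)).
Local Notation X := (@X_ R d).
Local Notation cl := (clamp C1 C2).
Let bscal j m : bnd (scal j m). Proof. exact: (bnd_scal g_cdv). Qed.
Let oscal j : (J0 <= j)%N -> orthonormal mu predT (scal j).
Proof. exact: (scal_orthonormal g_cdv). Qed.
Implicit Types f h u : d.-tuple R -> R.

Lemma hoelder_clamp a M f : hoelder_ball g J0 a M f -> measurable_fun setT f ->
  {ae mu, forall x, C1 <= f x <= C2} -> hoelder_ball g J0 a M (fun x => cl (f x)).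
Proof.
move=> hf mf fC; have [c [w [c0 _ cw hc hw]]] := hoelder_elim d_gt0 hf.
apply: (hoelder_intro (c := c) (w := w)) => //.
- by apply: uc_clamp; case: hf.
- move=> m; rewrite (ip_clamp (ltW C12))//; exact: bscal.
- move=> l io m J0l io0; rewrite (ip_clamp (ltW C12)) ?hw//.
  exact: (bnd_wav g_cdv).
Qed.

(** The norm is subadditive, and a constant has no fine coefficients, so that
    only its coarse ones count. *)
Lemma hoelder_perturb a M f mid eps u K : bnd f -> bnd u -> 0 <= eps <= 1 -> 0 <= K ->
  hoelder_ball g J0 a M f -> unif_continuous_on_cube u ->
  (forall m, 2 `^ (J0%:R * (a + d%:R / 2)) * `|<| u, scal J0 m |>| <= K) ->
  (forall l io (m : Zidx d l), (J0 <= l)%N -> io != iota0 d ->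
    2 `^ (l%:R * (a + d%:R / 2)) * `|<| u, wav g io m |>| <= K) ->
  let B := 2 `^ (J0%:R * (a + d%:R / 2)) * (2 * A ^+ 2 / Num.sqrt (2 ^+ J0)) ^+ d in
  hoelder_ball g J0 a (M + eps * (`|mid| * B) + 2 * K)
    (fun x => (1 - eps) * f x + eps * mid + u x).
Proof.
move=> bf bu /andP[e0 e1] K0 hf ucu hu0 hu1 B.
have [c [w [c0 w0 cw hc hw]]] := hoelder_elim d_gt0 hf.
have A0 : 0 <= A by case: A_size => /(le_trans ler01).
have B0 : 0 <= B.
  by rewrite mulr_ge0 ?powR_ge0// exprn_ge0// divr_ge0 ?sqrtr_ge0// mulr_ge0// exprn_ge0.
have bh : bnd (fun x => (1 - eps) * f x + eps * mid + u x) by bnd_tac.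
have coef phi : bnd phi -> `|ip (fun x => (1 - eps) * f x + eps * mid + u x) phi| <=
    `|ip f phi| + eps * (`|mid| * `|<| fun=> 1, phi |>|) + `|<| u, phi |>|.
  move=> bphi; rewrite !(ip_dot _ bphi)//.
  have -> : <| fun x => (1 - eps) * f x + eps * mid + u x, phi |> =
      (1 - eps) * <| f, phi |> + eps * mid * <| fun=> 1, phi |> + <| u, phi |>.
    rewrite -(dotZl mu (1 - eps))// -(dotZl mu (eps * mid))//; last exact: bnd_cst.
    rewrite -dotDl//; [|bnd_tac|bnd_tac].
    rewrite -dotDl//; [|bnd_tac].
    by congr dot; apply/funext => x; rewrite mulr1.
  apply: le_trans (ler_normD _ _) _; rewrite lerD2r.
  apply: le_trans (ler_normD _ _) _; apply: lerD.
    by rewrite normrM ler_piMl// ger0_norm ?subr_ge0// gerBl.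
  by rewrite !normrM (ger0_norm e0) mulrA.
apply: (hoelder_intro (c := c + eps * (`|mid| * B) + K) (w := w + K)).
- apply: uc_add => //; apply: uc_add; last exact: uc_cst.
  by apply: uc_scale; case: hf.
- by apply: addr_ge0 => //; apply: addr_ge0 => //; apply: mulr_ge0 => //; apply: mulr_ge0.
- by lra.
- move=> m; set r := 2 `^ _; have r0 : 0 <= r by exact: powR_ge0.
  apply: (le_trans (ler_wpM2l r0 (coef _ (@bscal J0 m)))); rewrite !mulrDr.
  apply: lerD; last exact: hu0.
  apply: lerD; first exact: hc.
  rewrite mulrCA ler_wpM2l// mulrCA ler_wpM2l// /B -/r ler_wpM2l//.
  rewrite -[leRHS]mul1r; apply: (dot_wav_le g_cdv A_size _ _ (bnd_cst _ 1)).
  by move=> x; rewrite normr1.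
- move=> l io m J0l io0; set r := 2 `^ _; have r0 : 0 <= r by exact: powR_ge0.
  have bw := bnd_wav g_cdv io m.
  apply: (le_trans (ler_wpM2l r0 (coef _ bw))); rewrite !mulrDr.
  rewrite (in_V_dot_wav0 g_cdv m J0l io0 (bnd_cst _ 1) (in_V1 g_cdv S_ge1)).
  rewrite normr0 !mulr0 addr0; apply: lerD; first exact: hw.
  exact: hu1.
Qed.

Variable i0 : 'I_d.

(** Shrinking towards the midpoint [mid] of the responses keeps the regression
    function away from both ends, which leaves space for the wave and makes the
    responses random. The gap [M - M'] pays for both changes of norm. In the
    scale of probabilities [w] the regression function is [C1 + (C2 - C1) * w]. *)
Lemma room a M' M f : 0 < a -> a <= S%:R -> M' < M -> hoelder_ball g J0 a M' f ->
  measurable_fun setT f -> (forall x, C1 <= f x <= C2) ->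
  exists (w0 : d.-tuple R -> R) (eta eps : R), [/\ 0 < eta, 0 < eps, bnd w0 &
    forall j q sg, (J0 <= j)%N -> (q <= 4 * 2 ^ j)%N -> -1 <= sg <= 1 ->
      let w x := w0 x + sg * (eta * (2 `^ a) ^- j) * wave i0 q x in
      (forall x, eps <= w x <= 1 - eps) /\
      hoelder_ball g J0 a M (fun x => C1 + (C2 - C1) * w x)].
Proof.
move=> a0 aS MM hf mf fC.
pose mid := (C1 + C2) / 2; pose D := C2 - C1; have D0 : 0 < D by rewrite subr_gt0.
pose B := 2 `^ (J0%:R * (a + d%:R / 2)) * (2 * A ^+ 2 / Num.sqrt (2 ^+ J0)) ^+ d.
have A0 : 0 <= A by case: A_size => /(le_trans ler01).
have B0 : 0 <= B.
  by rewrite mulr_ge0 ?powR_ge0// exprn_ge0// divr_ge0 ?sqrtr_ge0// mulr_ge0// exprn_ge0.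
have mB0 : 0 <= `|mid| * B by rewrite mulr_ge0.
pose del := M - M'; have del0 : 0 < del by rewrite subr_gt0.
pose CW := Cwave d S A; have CW0 : 0 <= CW by exact: (Cwave_ge0 d S A_size).
pose e := Num.min 1 (del / (2 * (`|mid| * B + 1))).
have q1 : 0 < 2 * (`|mid| * B + 1) by lra.
have e0 : 0 < e by rewrite lt_min ltr01 divr_gt0.
have e1 : e <= 1 by rewrite ge_min lexx.
have emB : e * (`|mid| * B) <= del / 2.
  have : e <= del / (2 * (`|mid| * B + 1)) by rewrite ge_min lexx orbT.
  rewrite ler_pdivlMr// => h; nra.
pose eta := Num.min (e / 8) (del / (4 * (D * CW + 1))).
have DCW0 : 0 <= D * CW by rewrite mulr_ge0// ltW.
have q2 : 0 < 4 * (D * CW + 1) by lra.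
have eta0 : 0 < eta by rewrite lt_min !divr_gt0.
have eta1 : eta <= e / 8 by rewrite ge_min lexx.
have etaK : 2 * (D * eta * CW) <= del / 2.
  have : eta <= del / (4 * (D * CW + 1)) by rewrite ge_min lexx orbT.
  rewrite ler_pdivlMr// => h; nra.
have bf : bnd f.
  split => //; exists (`|C1| + `|C2|) => x; rewrite -(clamp_id (fC x)); exact: (clamp_abs (ltW C12)).
exists (fun x => D^-1 * ((1 - e) * f x + e * mid - C1)), eta, (e / 4).
split => //; [by rewrite divr_gt0|by bnd_tac|].
move=> j q sg J0j qj sg1 w; pose rho := (2 `^ a) ^- j.
have p1 : 1 <= 2 `^ a :> R by rewrite -[leLHS](powRr0 2) ler_powR// ?ler1n// ltW.
have p0 : 0 < (2 `^ a) ^+ j :> R by rewrite exprn_gt0// (lt_le_trans ltr01 p1).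
have rho0 : 0 < rho by rewrite invr_gt0.
have rho1 : rho <= 1 by rewrite invf_le1// exprn_ege1.
have sgn : `|sg| <= 1 by rewrite ler_norml.
have amp x : `|sg * (eta * rho) * wave i0 q x| <= e / 4.
  rewrite normrM (normrM sg) (normrM eta) (gtr0_norm eta0) (gtr0_norm rho0).
  have s2 : `|wave i0 q x| <= 2.
    apply: le_trans (wave_max _ _ _) _.
    by rewrite -[leRHS](ger0_norm (ler0n R 2)) -sqrtr_sqr ler_sqrt// expr2; lra.
  have h : `|sg| * (eta * rho) <= eta.
    rewrite -[leRHS]mul1r; apply: ler_pM => //; first by rewrite mulr_ge0// ltW.
    by rewrite -[leRHS]mulr1 ler_wpM2l// ltW.
  apply: (@le_trans _ _ (eta * 2)); last lra.
  by apply: ler_pM => //; rewrite mulr_ge0// mulr_ge0// ltW.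
have wE x : C1 + D * w x = (1 - e) * f x + e * mid + D * sg * (eta * rho) * wave i0 q x.
  by rewrite /w -/rho; field; rewrite lt0r_neq0.
split.
  move=> x; have := amp x; rewrite ler_norml => /andP[h1 h2].
  have Dw : D * (w x - sg * (eta * rho) * wave i0 q x) = (1 - e) * f x + e * mid - C1.
    by rewrite /w -/rho addrK mulrA divff ?mul1r// lt0r_neq0.
  have /andP[f1 f2] := fC x.
  have l1 : D * (e / 2) <= (1 - e) * f x + e * mid - C1 by rewrite /D /mid; nra.
  have l2 : (1 - e) * f x + e * mid - C1 <= D * (1 - e / 2) by rewrite /D /mid; nra.
  move: l1 l2; rewrite -Dw !ler_pM2l// => l1 l2.
  by apply/andP; split; lra.
have bw : bnd (wave (R := R) i0 q) by exact: bnd_wave.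
pose K := D * eta * CW.
have K0 : 0 <= K by apply: mulr_ge0 => //; apply: mulr_ge0; exact: ltW.
pose u x := D * sg * (eta * rho) * wave i0 q x.
have bu : bnd u by rewrite /u; bnd_tac.
have small r phi : bnd phi -> 0 <= r -> r * `|<| wave i0 q, phi |>| <= CW * (2 `^ a) ^+ j ->
    r * `|<| u, phi |>| <= K.
  move=> bphi r0 h; rewrite dotZl// (normrM _ <| _, _ |>) (normrM _ (eta * rho)) (normrM D) (normrM eta) (gtr0_norm eta0) (gtr0_norm rho0) (gtr0_norm D0).
  have -> : r * (D * `|sg| * (eta * rho) * `|<| wave i0 q, phi |>|) =
    D * eta * `|sg| * (rho * (r * `|<| wave i0 q, phi |>|)) by ring.
  rewrite /K; apply: ler_pM.
  - by rewrite !mulr_ge0// ltW.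
  - by rewrite !mulr_ge0// ltW.
  - by rewrite -[leRHS]mulr1 ler_wpM2l// mulr_ge0// ltW.
  - by rewrite /rho ler_pdivrMl// [leRHS]mulrC.
have e01 : 0 <= e <= 1 by rewrite e1 ltW.
have := @hoelder_perturb a M' f mid e u K bf bu e01 K0 hf _ _ _.
have ucu : unif_continuous_on_cube u by apply: uc_scale; exact: uc_wave.
move=> /(_ ucu).
have h0 m : 2 `^ (J0%:R * (a + d%:R / 2)) * `|<| u, scal J0 m |>| <= K.
  apply: small; [exact: bscal|exact: powR_ge0|].
  exact: (wave_coef0 g_cdv A_size).
have h1 l io (m : Zidx d l) : (J0 <= l)%N -> io != iota0 d ->
    2 `^ (l%:R * (a + d%:R / 2)) * `|<| u, wav g io m |>| <= K.
  move=> J0l io0; apply: small; [exact: (bnd_wav g_cdv)|exact: powR_ge0|].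
  exact: (wave_coef g_cdv A_size).
move=> /(_ h0 h1); cbv zeta; rewrite -/B => hb.
have -> : (fun x => C1 + (C2 - C1) * w x) = (fun x => (1 - e) * f x + e * mid + u x).
  by apply/funext => x; exact: wE.
have [c [v [c0 v0 cv hc hv]]] := hoelder_elim d_gt0 hb.
apply: (hoelder_intro (c := c) (w := v)) => //; first by case: hb.
apply: le_trans cv _; have delE : M = M' + (del / 2 + del / 2) by rewrite /del; field.
by rewrite [leRHS]delE -addrA lerD2l; exact: lerD.
Qed.

End LowerBounds.

Section RiskLowerBounds.
Variables (R : realType) (d S J0 : nat) (g : cdv_generators R).
Hypothesis g_cdv : cdv_basis d g S J0.
Variable A : R.
Hypothesis A_size : size_bound g A.
Hypotheses (S_ge1 : (1 <= S)%N) (d_gt0 : (0 < d)%N).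
Variables (alpha beta C1 C2 M : R).

Local Notation mu := (unif R d).
Local Notation "<| f , h |>" := (dot mu f h) (at level 0, f, h at level 200).
Local Notation scal := (@scal R d g).
Local Notation Pi j := (proj mu (scal j)).
Local Notation X := (@X_ R d).
Local Notation cl := (clamp C1 C2).
Local Notation dim j := (dim R d j).
Local Notation s := (alpha + beta).
Local Notation bias2 j := (dim j `^ (- (2 * s / d%:R))).
Local Notation Model := (model g J0 alpha beta C1 C2 M).
Local Notation risk est := (worst_risk g J0 alpha beta C1 C2 M (est : estimator R d)).
Let bscal j m : bnd (scal j m). Proof. exact: (bnd_scal g_cdv). Qed.
Let oscal j : (J0 <= j)%N -> orthonormal mu predT (scal j).
Proof. exact: (scal_orthonormal g_cdv). Qed.
Implicit Types f h u : d.-tuple R -> R.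

(** Up to its sign, the bias of a plug-in product at level [j]. *)
Definition residual_dot j f h : R :=
  <| fun x => f x - Pi j f x, fun x => h x - Pi j h x |>.

Let bres j f : bnd f -> bnd (fun x => f x - Pi j f x).
Proof. by move=> bf; apply: bndB => //; exact: bnd_proj. Qed.

Lemma residual_dotC j f h : residual_dot j f h = residual_dot j h f.
Proof. exact: dotC. Qed.

Lemma residual_dot_lin j c f u h : bnd f -> bnd u -> bnd h ->
  residual_dot j (fun x => f x + c * u x) h =
  residual_dot j f h + c * residual_dot j u h.
Proof.
move=> bf bu bh; have br f' : bnd f' -> bnd (fun x => f' x - Pi j f' x) by exact: bres.
rewrite /residual_dot -dotZl; [|exact: br|exact: br].
rewrite -dotDl; [|exact: br|by apply: bndM; [exact: bnd_cst|exact: br]|exact: br].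
congr dot; apply/funext => x; rewrite /proj.
have -> : \sum_(i | true) <| fun y => f y + c * u y, scal j i |> * scal j i x =
    \sum_i <| f, scal j i |> * scal j i x + c * \sum_i <| u, scal j i |> * scal j i x.
  rewrite mulr_sumr -big_split/=; apply: eq_bigr => i _.
  have bs := @bscal j i.
  by rewrite dotDl ?dotZl//; [ring|bnd_tac].
by ring.
Qed.

Section Member.
Variables (P : probability (obs R d) R) (p b : d.-tuple R -> R) (j1 j2 : nat -> nat) (n : nat).
Hypothesis PM : Model P.
Hypotheses (cp : is_cond_exp P (@A_ R d) p) (cb : is_cond_exp P (@Y_ R d) b).
Hypotheses (p_range : forall x, C1 <= p x <= C2) (b_range : forall x, C1 <= b x <= C2).
Hypotheses (L1 : levels J0 j1) (L2 : levels J0 j2) (n0 : (0 < n)%N).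

Let C12 : C1 <= C2. Proof. exact: (model_C12 PM). Qed.
Let clA := fun o : obs R d => cl (A_ o).
Let clY := fun o : obs R d => cl (Y_ o).
Let bA : bnd clA. Proof. exact: (bnd_clamp C12 (@measurable_A R d)). Qed.
Let bY : bnd clY. Proof. exact: (bnd_clamp C12 (@measurable_Y R d)). Qed.
Let pE : (fun x => cl (p x)) = p.
Proof. by apply/funext => x; rewrite clamp_id. Qed.
Let bE : (fun x => cl (b x)) = b.
Proof. by apply/funext => x; rewrite clamp_id. Qed.
Let bp : bnd p.
Proof. by rewrite -pE; apply: (bnd_clamp C12); case: cp. Qed.
Let bb : bnd b.
Proof. by rewrite -bE; apply: (bnd_clamp C12); case: cb. Qed.
Let regA : regression P mu X clA p.
Proof.
rewrite -pE; apply: (cond_exp_regression (model_law PM) C12 (@measurable_A R d) _ cp).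
by apply: filterS (model_range PM) => o [].
Qed.
Let regY : regression P mu X clY b.
Proof.
rewrite -bE; apply: (cond_exp_regression (model_law PM) C12 (@measurable_Y R d) _ cb).
by apply: filterS (model_range PM) => o [].
Qed.

Local Notation Cmax := (`|C1| + `|C2|).
Let AC o : `|clA o| <= Cmax. Proof. exact: clamp_abs. Qed.
Let YC o : `|clY o| <= Cmax. Proof. exact: clamp_abs. Qed.
Let pC x : `|p x| <= Cmax. Proof. by rewrite -pE; exact: clamp_abs. Qed.
Let bC x : `|b x| <= Cmax. Proof. by rewrite -bE; exact: clamp_abs. Qed.

Let mse_MC := mse P mu clA clY p b
  (est_MC X (scal (j1 n)) (scal (j2 n)) clA clY (n := n)).

Let risk_ge : (mse_MC%:E <= risk (psi_MC g) j1 j2 n)%E.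
Proof.
apply: ereal_sup_ubound; exists P => //.
rewrite psi_MCE (risk_clamp PM (est := fun A Y => est_MC X (scal (j1 n)) (scal (j2 n)) A Y (n := n)) _ _ cp cb).
- by rewrite pE bE.
- exact: est_MC_response.
- move=> A' Y' bA' bY'.
  exact: (bnd_est_MC (@measurable_X R d) (@bscal _) (@bscal _) bA' bY').
Qed.

Lemma risk_ge_bias :
  ((residual_dot (minn (j1 n) (j2 n)) p b ^+ 2)%:E <= risk (psi_MC g) j1 j2 n)%E.
Proof.
apply: le_trans risk_ge; rewrite lee_fin.
have := mse_MC_ge_bias (@measurable_X R d) (unif_law (model_law PM)) (@bscal (j1 n))
  (@bscal (j2 n)) bA bY bp bb regA regY AC YC pC n0.
by rewrite (bias_min g_cdv)// sqrrN.
Qed.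

Lemma risk_ge_noise (a0 kap : R) : 0 <= a0 -> 0 <= kap ->
  (forall h, bnd h -> (forall y, 0 <= h y) ->
     a0 * \int[mu]_y h y <= \int[P]_o (clA o ^+ 2 * h (X o))) ->
  (forall h, bnd h -> (forall y, 0 <= h y) ->
     a0 * \int[mu]_y h y <= \int[P]_o (clY o ^+ 2 * h (X o))) ->
  (forall j, (J0 <= j)%N -> {ae mu, forall x, kap * dim j <= repr_kernel (scal j) x x}) ->
  ((n%:R^-1 * (n%:R^-1 ^+ 2 * a0 ^+ 2 * (kap * dim (j1 n) * (kap * dim (j2 n)))
     - Cmax ^+ 4 * (4 + 2 * (n%:R^-1 * dim (minn (j1 n) (j2 n))))))%:E
   <= risk (psi_MC g) j1 j2 n)%E.
Proof.
move=> a00 kap0 hA hY hk; apply: le_trans risk_ge; rewrite lee_fin.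
rewrite -(card_dim_min R d).
have k0 j : 0 <= kap * dim j by rewrite mulr_ge0// ltW// dim_gt0.
exact: (mse_MC_ge_var (@measurable_X R d) (unif_law (model_law PM)) (@bscal (j1 n))
  (@bscal (j2 n)) (oscal (L1 n)) (oscal (L2 n)) bA bY bp bb regA regY AC YC pC bC n0
  a00 (k0 _) (k0 _) hA hY (hk _ (L1 n)) (hk _ (L2 n))).
Qed.

End Member.

(** Weighted by [a * b] and averaged over the four sign patterns, the expression
    is [w]; so for one pattern it is at least [w] in absolute value. *)
Lemma four_signs (x y z w : R) : 0 <= w ->
  exists a b : R, [/\ -1 <= a <= 1, -1 <= b <= 1 &
    w ^+ 2 <= (x + b * y + a * z + a * b * w) ^+ 2].
Proof.
move=> w0; have N1 : -1 <= 1 :> R by lra.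
case: (leP 0 x) => x0.
  case: (leP 0 (y + z)) => h.
    by exists 1, 1; rewrite lexx N1 !mul1r; split => //; nra.
  exists (-1), (-1); rewrite lexx N1; split => //.
  have -> : x + -1 * y + -1 * z + -1 * -1 * w = x - (y + z) + w by ring.
  by nra.
case: (leP 0 (y - z)) => h.
  exists 1, (-1); rewrite !lexx N1; split => //.
  have -> : x + -1 * y + 1 * z + 1 * -1 * w = - (- x + (y - z) + w) by ring.
  by rewrite sqrrN; nra.
exists (-1), 1; rewrite !lexx N1; split => //.
have -> : x + 1 * y + -1 * z + -1 * 1 * w = - (- x - (y - z) + w) by ring.
by rewrite sqrrN; nra.
Qed.

Hypotheses (alpha_gt0 : 0 < alpha) (beta_gt0 : 0 < beta).
Hypotheses (alphaS : alpha <= S%:R) (betaS : beta <= S%:R).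

(** Two adversaries. For the bias, both regression functions carry the same rough
    wave with signs as in [four_signs], so that the part of the bias due to the
    base functions cannot cancel the energy that the wave has outside the
    scaling space. For the noise, the base functions alone suffice: the responses
    have conditional second moment at least [a0]. *)
Theorem worst_risk_MC_ge : nondegenerate_class d g J0 alpha beta C1 C2 M ->
  exists c K : R, [/\ 0 < c, 0 <= K & forall j1 j2 n,
    levels J0 j1 -> levels J0 j2 -> (0 < n)%N ->
    ((c * bias2 (minn (j1 n) (j2 n)))%:E <= risk (psi_MC g) j1 j2 n)%E /\
    ((n%:R^-1 * (c * (n%:R^-1 ^+ 2 * (dim (j1 n) * dim (j2 n)))
       - K * (1 + n%:R^-1 * dim (minn (j1 n) (j2 n)))))%:E
     <= risk (psi_MC g) j1 j2 n)%E].
Proof.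
move=> [C12 [M' MM [P0 PM0]]]; pose i0 := Ordinal d_gt0.
have [_ _ [p0 hp0 cp0] [b0 hb0 cb0]] := PM0.
have [mp0 _ _ _] := cp0; have [mb0 _ _ _] := cb0.
have rp : {ae mu, forall x, C1 <= p0 x <= C2}.
  apply: (cond_exp_range (model_law PM0) (ltW C12) (@measurable_A R d) _ cp0).
  by apply: filterS (model_range PM0) => o [].
have rb : {ae mu, forall x, C1 <= b0 x <= C2}.
  apply: (cond_exp_range (model_law PM0) (ltW C12) (@measurable_Y R d) _ cb0).
  by apply: filterS (model_range PM0) => o [].
have hp := hoelder_clamp g_cdv d_gt0 C12 hp0 mp0 rp.
have hb := hoelder_clamp g_cdv d_gt0 C12 hb0 mb0 rb.
have bp : bnd (fun x => cl (p0 x)) by exact: (bnd_clamp (ltW C12)).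
have bb : bnd (fun x => cl (b0 x)) by exact: (bnd_clamp (ltW C12)).
have [wa [ea [epa [ea0 epa0 bwa hwa]]]] := room g_cdv A_size S_ge1 d_gt0 C12 i0
  alpha_gt0 alphaS MM hp bp.1 (fun x => clamp_range (ltW C12) _).
have [wb [eb [epb [eb0 epb0 bwb hwb]]]] := room g_cdv A_size S_ge1 d_gt0 C12 i0
  beta_gt0 betaS MM hb bb.1 (fun x => clamp_range (ltW C12) _).
pose D := C2 - C1; have D0 : 0 < D by rewrite subr_gt0.
pose ra j := ea * (2 `^ alpha) ^- j; pose rb' j := eb * (2 `^ beta) ^- j.
pose pr j q a (x : d.-tuple R) := wa x + a * ra j * wave i0 q x.
pose rh j q b (x : d.-tuple R) := wb x + b * rb' j * wave i0 q x.
have bwv q : bnd (wave (R := R) i0 q) by exact: bnd_wave.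
have bpr j q a : bnd (pr j q a) by rewrite /pr; bnd_tac.
have brh j q b : bnd (rh j q b) by rewrite /rh; bnd_tac.
pose eps := Num.min epa epb; have eps0 : 0 < eps by rewrite lt_min epa0.
have le01 (e t : R) : 0 < e -> e <= t <= 1 - e -> 0 <= t <= 1.
  by move=> e0 /andP[h1 h2]; apply/andP; split; lra.
have rangeD (t : R) : 0 <= t <= 1 -> C1 <= C1 + D * t <= C2.
  by move=> /andP[t0 t1]; rewrite /D in D0 *; apply/andP; split; nra.
pose c1 := (D ^+ 2 * (ea * eb) / 2) ^+ 2.
have c10 : 0 < c1 by rewrite exprn_gt0// divr_gt0// mulr_gt0 ?exprn_gt0// mulr_gt0.
pose a0 := eps * (C1 ^+ 2 + C2 ^+ 2).
have CC0 : 0 < C1 ^+ 2 + C2 ^+ 2.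
  rewrite lt0r addr_ge0 ?sqr_ge0// andbT paddr_eq0 ?sqr_ge0// !sqrf_eq0.
  by apply/negP => /andP[/eqP e1 /eqP e2]; move: C12; rewrite e1 e2 ltxx.
have a00 : 0 < a0 by rewrite mulr_gt0.
have A0 : 0 < A by case: A_size => /(lt_le_trans ltr01).
pose kap := ((4 * A ^+ 5) ^+ d)^-1.
have kap0 : 0 < kap by rewrite invr_gt0 exprn_gt0// mulr_gt0// exprn_gt0.
pose c2 := a0 ^+ 2 * kap ^+ 2; have c20 : 0 < c2 by rewrite mulr_gt0// exprn_gt0.
exists (Num.min c1 c2), (4 * (`|C1| + `|C2|) ^+ 4); split.
- by rewrite lt_min c10.
- by rewrite mulr_ge0// exprn_ge0// addr_ge0.
move=> j1 j2 n L1 L2 n0; set j := minn _ _.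
have J0j : (J0 <= j)%N by rewrite leq_min L1 L2.
split.
- have [q [q0 qj hq]] := rough_wave g_cdv i0 J0j.
  pose T := residual_dot j; pose u := wave (R := R) i0 q.
  pose pa x := C1 + D * wa x; pose pb x := C1 + D * wb x.
  have bpa : bnd pa by rewrite /pa; bnd_tac.
  have bpb : bnd pb by rewrite /pb; bnd_tac.
  have ra0 : 0 < ra j by rewrite mulr_gt0// invr_gt0 exprn_gt0// powR_gt0.
  have rb0 : 0 < rb' j by rewrite mulr_gt0// invr_gt0 exprn_gt0// powR_gt0.
  pose w := D ^+ 2 * (ra j * rb' j) * T u u.
  have w0 : 0 <= w by rewrite !mulr_ge0 ?(ltW D0) ?ltW// (lt_le_trans _ hq)// invr_gt0.
  have [a [b [a1 b1 hw]]] := four_signs (T pa pb) (D * rb' j * T pa u) (D * ra j * T u pb) w0.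
  have [ha hpa] := hwa j q a J0j qj a1; have [hb' hpb] := hwb j q b J0j qj b1.
  have ha' x := le01 _ _ epa0 (ha x); have hb'' x := le01 _ _ epb0 (hb' x).
  have PM := two_point_model C12 (bpr j q a).1 (brh j q b).1 ha' hb'' hpa hpb.
  have := risk_ge_bias PM (two_point_cond_A C12 (bpr j q a).1 (brh j q b).1 ha')
    (two_point_cond_Y C12 (bpr j q a).1 (brh j q b).1 hb'')
    (fun x => rangeD _ (ha' x)) (fun x => rangeD _ (hb'' x)) L1 L2 n0.
  apply: le_trans; rewrite lee_fin -/j.
  have -> : (fun x => C1 + (C2 - C1) * pr j q a x) = (fun x => pa x + (a * (D * ra j)) * u x).
    by apply/funext => x; rewrite /pr /pa -/D -/u; ring.
  have -> : (fun x => C1 + (C2 - C1) * rh j q b x) = (fun x => pb x + (b * (D * rb' j)) * u x).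
    by apply/funext => x; rewrite /rh /pb -/D -/u; ring.
  have bu : bnd u by exact: bwv.
  have bpb' : bnd (fun x => pb x + (b * (D * rb' j)) * u x) by bnd_tac.
  have linr c f h v : bnd f -> bnd h -> bnd v ->
      T f (fun x => h x + c * v x) = T f h + c * T f v.
    move=> bf bh bv; rewrite /T !(residual_dotC j f).
    exact: residual_dot_lin.
  have linl c f h v : bnd f -> bnd h -> bnd v ->
      T (fun x => f x + c * v x) h = T f h + c * T v h.
    by move=> bf bh bv; exact: residual_dot_lin.
  rewrite -/T (linl _ pa _ u)// (linr _ pa pb u)// (linr _ u pb u)//.
  have expand (x y z t r1 r2 : R) :
      x + b * (D * r2) * y + a * (D * r1) * (z + b * (D * r2) * t) =
      x + b * (D * r2 * y) + a * (D * r1 * z) + a * b * (D ^+ 2 * (r1 * r2) * t) by ring.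
  rewrite expand -/w.
  apply: le_trans hw; rewrite dim_powR//.
  apply: (@le_trans _ _ (c1 * 2 `^ (- (2 * s)) ^+ j)).
    by rewrite ler_wpM2r ?exprn_ge0 ?powR_ge0// ge_min lexx.
  have -> : c1 * 2 `^ (- (2 * s)) ^+ j = (D ^+ 2 * (ra j * rb' j) * 2^-1) ^+ 2.
    have -> : 2 `^ (- (2 * s)) = ((2 `^ alpha)^-1 * (2 `^ beta)^-1) ^+ 2 :> R.
      rewrite -!powRN -powRD; last by rewrite implybE pnatr_eq0 orbT.
      rewrite -powR_mulrn ?powR_ge0// -powRrM; congr (_ `^ _); ring.
    by rewrite (exprAC _ 2 j) exprMn !exprVn /c1 /ra /rb'; ring.
  have h0 : 0 <= D ^+ 2 * (ra j * rb' j) by rewrite !mulr_ge0// ltW.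
  have hw' : D ^+ 2 * (ra j * rb' j) * 2^-1 <= w by exact: ler_wpM2l.
  by apply: lerXn2r hw'; rewrite nnegrE //; apply: mulr_ge0.
have z01 : -1 <= (0 : R) <= 1 by apply/andP; split; lra.
have [ha hpa] := hwa j 0%N 0 J0j isT z01; have [hb' hpb] := hwb j 0%N 0 J0j isT z01.
have ha' x := le01 _ _ epa0 (ha x); have hb'' x := le01 _ _ epb0 (hb' x).
have PM := two_point_model C12 (bpr j 0%N 0).1 (brh j 0%N 0).1 ha' hb'' hpa hpb.
have bcl : bnd (fun t : R => cl t ^+ 2).
  by apply: bndX; exact: (bnd_clamp (ltW C12) (@measurable_id _ _ _)).
have clE : (cl C1 = C1) * (cl C2 = C2) by rewrite !clamp_id ?lexx ?ltW.
have lower (e t : R) : eps <= e -> e <= t <= 1 - e -> a0 <= C1 ^+ 2 * (1 - t) + C2 ^+ 2 * t.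
  move=> ee /andP[t1 t2]; have := sqr_ge0 C1; have := sqr_ge0 C2; rewrite /a0; nra.
have epsa : eps <= epa by rewrite ge_min lexx.
have epsb : eps <= epb by rewrite ge_min lexx orbT.
have := risk_ge_noise PM (two_point_cond_A C12 (bpr j 0%N 0).1 (brh j 0%N 0).1 ha')
    (two_point_cond_Y C12 (bpr j 0%N 0).1 (brh j 0%N 0).1 hb'')
    (fun x => rangeD _ (ha' x)) (fun x => rangeD _ (hb'' x)) L1 L2 n0 (ltW a00) (ltW kap0).
move=> noise; apply: (le_trans _ (noise _ _ _)); last first.
- by move=> j' J0j'; rewrite -dimE; exact: (scal_kernel_ge g_cdv A_size).
- move=> h bh h0; rewrite (two_point_Y _ _ _ _ hb'' bcl bh) -E_scale//.
  have brh0 := brh j 0%N 0.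
  apply: E_le; [by bnd_tac|by bnd_tac|move=> x].
  by rewrite !clE ler_wpM2r//; exact: lower (hb' x).
- move=> h bh h0; rewrite (two_point_A _ _ _ _ ha' bcl bh) -E_scale//.
  have bpr0 := bpr j 0%N 0.
  apply: E_le; [by bnd_tac|by bnd_tac|move=> x].
  by rewrite !clE ler_wpM2r//; exact: lower (ha x).
rewrite lee_fin -/j; set v := n%:R^-1; have v0 : 0 <= v by rewrite invr_ge0.
rewrite ler_wpM2l//; set C4 := (_ + _) ^+ 4.
have C40 : 0 <= C4 by rewrite exprn_ge0// addr_ge0.
have dj : 0 <= dim j by rewrite ltW// dim_gt0.
apply: lerB.
  have -> : v ^+ 2 * a0 ^+ 2 * (kap * dim (j1 n) * (kap * dim (j2 n))) =
    c2 * (v ^+ 2 * (dim (j1 n) * dim (j2 n))) by rewrite /c2; ring.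
  rewrite ler_wpM2r ?ge_min ?lexx ?orbT//.
  by rewrite mulr_ge0 ?sqr_ge0// mulr_ge0// ltW// dim_gt0.
have -> : 4 * C4 * (1 + v * dim j) = C4 * (4 + 4 * (v * dim j)) by ring.
apply: ler_wpM2l => //.
by have := mulr_ge0 v0 dj; lra.
Qed.

End RiskLowerBounds.

(** * Rates *)

Section Orders.
Variable R : realType.
Implicit Types (u v w : nat -> R) (a b : nat -> \bar R).

Local Notation pow r := (fun n : nat => n%:R `^ r : R).
Local Notation "u '<~' v" := (lesssim (EFin \o u) (EFin \o v)) (at level 70).

Lemma lesssim_real u v : (u <~ v) <-> exists2 C : R, 0 < C &
  exists n0 : nat, forall n, (n0 <= n)%N -> u n <= C * v n.
Proof.
by split=> -[C C0 [n0 h]]; exists C => //; exists n0 => n nn; have := h n nn;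
  rewrite /= -EFinM lee_fin.
Qed.

Lemma lesssim_trans b a a' : lesssim a b -> lesssim b a' -> lesssim a a'.
Proof.
move=> [C C0 [n0 h]] [D D0 [m0 h']]; exists (C * D); first exact: mulr_gt0.
exists (maxn n0 m0) => n; rewrite geq_max => /andP[nn nm].
by apply: le_trans (h n nn) _; rewrite EFinM -muleA lee_pmul2l ?lte_fin//; exact: h'.
Qed.

Lemma lesssim_le a v K : 0 < K -> (forall n, (0 < n)%N -> (a n <= (K * v n)%:E)%E) ->
  lesssim a (EFin \o v).
Proof. by move=> K0 h; exists K => //; exists 1%N => n n0; rewrite -EFinM; exact: h. Qed.

Lemma lesssim_add u v w : (u <~ w) -> (v <~ w) -> ((fun n => u n + v n) <~ w).
Proof.
move=> /lesssim_real[C C0 [n0 h]] /lesssim_real[D D0 [m0 h']]; apply/lesssim_real.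
exists (C + D); first exact: addr_gt0.
exists (maxn n0 m0) => n; rewrite geq_max => /andP[nn nm].
by rewrite mulrDl; apply: lerD; [exact: h|exact: h'].
Qed.

Lemma pow_le (r t : R) : r <= t -> pow r <~ pow t.
Proof.
move=> rt; apply/lesssim_real; exists 1 => //; exists 1%N => n n0.
by rewrite mul1r ler_powR// ler1n.
Qed.

Lemma pow_unbounded (e C : R) : 0 < e -> 0 <= C -> exists n0 : nat, forall n, (n0 <= n)%N ->
  C <= n%:R `^ e.
Proof.
move=> e0 C0; exists (Num.truncn (C `^ e^-1)).+1 => n nn.
have h : C `^ e^-1 <= n%:R.
  by rewrite (le_trans (ltW (truncnS_gt _)))// ler_nat.
have -> : C = (C `^ e^-1) `^ e by rewrite -powRrM mulVf ?powRr1// lt0r_neq0.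
by apply: ge0_ler_powR; rewrite ?nnegrE ?powR_ge0// ltW.
Qed.

Lemma pow_order (r t : R) : (pow r <~ pow t) -> r <= t.
Proof.
move=> /lesssim_real[C C0 [n0 h]]; rewrite leNgt; apply/negP => tr.
have [m0 hm] := @pow_unbounded (r - t) (C + 1) (eqbRL (subr_gt0 _ _) tr) (addr_ge0 (ltW C0) ler01).
pose n := maxn 1 (maxn n0 m0).
have n1 : (0 < n)%N by rewrite leq_max.
have nn : (n0 <= n)%N by rewrite !leq_max leqnn orbT.
have nm : (m0 <= n)%N by rewrite !leq_max leqnn !orbT.
have := h n nn; have p : 0 < n%:R `^ t :> R by rewrite powR_gt0// ltr0n.
have -> : n%:R `^ r = n%:R `^ (r - t) * n%:R `^ t :> R.
  by rewrite -powRD ?subrK// pnatr_eq0 -lt0n n1 implybT.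
by rewrite ler_pM2r// => h1; have := hm n nm; lra.
Qed.

Lemma lesssim_mul u v (r t : R) : (forall n, 0 <= u n) -> (forall n, 0 <= v n) ->
  (u <~ pow r) -> (v <~ pow t) -> ((fun n => u n * v n) <~ pow (r + t)).
Proof.
move=> u0 v0 /lesssim_real[C C0 [n0 h]] /lesssim_real[D D0 [m0 h']]; apply/lesssim_real.
exists (C * D); first exact: mulr_gt0.
exists (maxn 1 (maxn n0 m0)) => n; rewrite !geq_max => /andP[n1 /andP[nn nm]].
have n1' : n%:R != 0 :> R by rewrite pnatr_eq0 -lt0n.
rewrite powRD; last by rewrite n1' implybT.
by rewrite mulrACA; apply: ler_pM => //; [exact: h|exact: h'].
Qed.

Lemma lesssim_powN u (r t : R) : 0 <= t -> (pow r <~ u) ->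
  ((fun n => u n `^ (- t)) <~ pow (- (r * t))).
Proof.
move=> t0 /lesssim_real[C C0 [n0 h]]; apply/lesssim_real.
exists (C `^ t); first exact: powR_gt0.
exists (maxn 1 n0) => n; rewrite geq_max => /andP[n1 nn].
have nr : 0 < n%:R `^ r :> R by rewrite powR_gt0// ltr0n.
have uC := h n nn; have u0 : 0 < u n.
  by have := lt_le_trans nr uC; rewrite pmulr_rgt0.
have key : n%:R `^ (r * t) <= C `^ t * u n `^ t.
  rewrite powRrM -powRM ?(ltW u0) ?(ltW C0)//.
  by apply: ge0_ler_powR; rewrite ?nnegrE ?powR_ge0// mulr_ge0// ltW.
rewrite !powRN -ler_pdivrMr ?invr_gt0 ?powR_gt0 ?ltr0n// invrK mulrC.
by rewrite ler_pdivrMr ?powR_gt0.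
Qed.

Lemma pow_inv k : (fun n => n%:R^-1 ^+ k) = pow (- k%:R).
Proof.
apply/funext => n; rewrite powRN powR_mulrn ?exprVn//.
Qed.

End Orders.

Section Resolutions.
Variables (R : realType) (d : nat).
Hypothesis d_gt0 : (0 < d)%N.
Implicit Type j : nat -> nat.
Local Notation dim := (dim R d).

Lemma mins_res j1 j2 : mins (res R d j1) (res R d j2) =
  EFin \o (fun n => dim (minn (j1 n) (j2 n))).
Proof. by apply/funext => n; rewrite /mins /res /= -EFin_min dim_min. Qed.

Lemma maxs_res j1 j2 : maxs (res R d j1) (res R d j2) =
  EFin \o (fun n => dim (maxn (j1 n) (j2 n))).
Proof. by apply/funext => n; rewrite /maxs /res /= -EFin_max dim_max. Qed.

Lemma lesssim_min (u : nat -> R) j1 j2 :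
  lesssim (EFin \o u) (res R d j1) -> lesssim (EFin \o u) (res R d j2) ->
  lesssim (EFin \o u) (mins (res R d j1) (res R d j2)).
Proof.
rewrite mins_res => -[C C0 [n0 h]] [D D0 [m0 h']].
exists (C + D); first exact: addr_gt0.
exists (maxn n0 m0) => n; rewrite geq_max => /andP[nn nm].
have := h n nn; have := h' n nm; rewrite /res /= -!EFinM !lee_fin -!/(dim _) => h2 h1.
have k1 := dim_gt0 R d (j1 n); have k2 := dim_gt0 R d (j2 n).
by rewrite dim_min minr_pMr; [rewrite le_min; apply/andP; split; nra|lra].
Qed.

Lemma dim_min_le_max j1 j2 :
  lesssim (mins (res R d j1) (res R d j2)) (maxs (res R d j1) (res R d j2)).
Proof.
exists 1 => //; exists 0%N => n _; rewrite mul1e mins_res maxs_res lee_fin dim_min dim_max.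
by rewrite ge_min le_max lexx.
Qed.

(** The level is the integer part of a logarithm, raised by [J0] to be
    admissible; rounding and raising both cost constant factors only. *)
Lemma level_exists (J0 : nat) (f : R) : 0 <= f ->
  exists2 j, levels J0 j & asymp (res R d j) (npow f).
Proof.
move=> f0; pose N n := Num.truncn (n%:R `^ f : R).
pose i n := trunc_log (2 ^ d) (N n); exists (fun n => (J0 + i n)%N).
  by move=> n; exact: leq_addr.
have p1 : (1 < 2 ^ d)%N by rewrite -[1%N](expn0 2) ltn_exp2l.
have key n : (0 < n)%N -> 2 ^+ (i n * d) <= n%:R `^ f :> R /\
    n%:R `^ f <= 2 ^+ d * 2 ^+ (i n * d) :> R.
  move=> n0; have nf : 1 <= n%:R `^ f :> R.
    by rewrite -[leLHS](powRr0 n%:R) ler_powR// ler1n.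
  have N0 : (0 < N n)%N by rewrite truncn_gt0.
  have /andP[h1 h2] := trunc_log_bounds p1 N0; rewrite -/(i n) in h1 h2.
  have /andP[t1 t2] := truncn_itv (le_trans ler01 nf); rewrite -/(N n) in t1 t2.
  split.
    by rewrite (le_trans _ t1)// -natrX ler_nat mulnC expnM.
  by rewrite (le_trans (ltW t2))// -exprD -natrX ler_nat -mulSn mulnC expnM.
split.
  exists (2 ^+ (J0 * d)); first exact: exprn_gt0.
  exists 1%N => n n0; rewrite /res /npow -EFinM lee_fin mulnDl exprD ler_wpM2l//.
  by have [] := key n n0.
exists (2 ^+ d); first exact: exprn_gt0.
exists 1%N => n n0; rewrite /res /npow -EFinM lee_fin.
apply: (le_trans (key n n0).2); rewrite ler_wpM2l ?exprn_ge0//.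
by rewrite ler_eXn2l ?ltr1n// leq_mul2r leq_addl orbT.
Qed.

End Resolutions.

Section MainTheorem.
Variables (R : realType) (d S J0 : nat) (g : cdv_generators R).
Variables (alpha beta C1 C2 M : R).
Hypotheses (d_gt0 : (0 < d)%N) (S_ge1 : (1 <= S)%N).
Hypothesis g_cdv : cdv_basis d g S J0.
Hypotheses (alpha_gt0 : 0 < alpha) (beta_gt0 : 0 < beta).
Hypothesis S_gt : Num.max alpha beta < S%:R.

Local Notation dim j := (dim R d j).
Local Notation s := (alpha + beta).
Local Notation D := (d%:R : R).
Local Notation bias2 j := (dim j `^ (- (2 * s / D))).
Local Notation risk est := (worst_risk g J0 alpha beta C1 C2 M (est : estimator R d)).
Local Notation pow r := (fun n : nat => n%:R `^ r : R).
Local Notation "u '<~' v" := (lesssim (EFin \o u) (EFin \o v)) (at level 70).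
Implicit Type j : nat -> nat.

Let D0 : 0 < D. Proof. by rewrite ltr0n. Qed.
Let s0 : 0 < s. Proof. exact: addr_gt0. Qed.
Let t0 : 0 <= 2 * s / D. Proof. by rewrite divr_ge0 ?mulr_ge0// ltW. Qed.
Let dim0 k : 0 <= dim k. Proof. by rewrite ltW// dim_gt0. Qed.

Let inv_pow : (fun n : nat => n%:R^-1 : R) = pow (-1).
Proof. by rewrite -(pow_inv R 1). Qed.

Lemma bias_rate (e r : R) j : e * (2 * s / D) = - r ->
  (pow e <~ (fun n => dim (j n))) -> ((fun n => bias2 (j n)) <~ pow r).
Proof. by move=> er h; have := lesssim_powN t0 h; rewrite er opprK. Qed.

Lemma linear_rate (e r : R) j : e - 2 <= r -> ((fun n => dim (j n)) <~ pow e) ->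
  ((fun n => n%:R^-1 ^+ 2 * dim (j n)) <~ pow r).
Proof.
move=> er h; apply: (lesssim_trans _ (pow_le (r := -2%:R + e) _)); last by lra.
apply: lesssim_mul => //.
by rewrite (pow_inv R 2); exact: pow_le.
Qed.

Lemma cubic_rate (e1 e2 r : R) j1 j2 : e1 + e2 - 3 <= r ->
  ((fun n => dim (j1 n)) <~ pow e1) -> ((fun n => dim (j2 n)) <~ pow e2) ->
  ((fun n => n%:R^-1 ^+ 3 * (dim (j1 n) * dim (j2 n))) <~ pow r).
Proof.
move=> er h1 h2; apply: (lesssim_trans _ (pow_le (r := -3%:R + (e1 + e2)) _)); last by lra.
apply: lesssim_mul => //.
- by move=> n; rewrite mulr_ge0.
- by rewrite (pow_inv R 3); exact: pow_le.
- exact: lesssim_mul.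
Qed.

Lemma risk_INT_rate (e f r : R) j1 j2 : levels J0 j1 -> levels J0 j2 ->
  e * (2 * s / D) = - r -> -1 <= r -> f - 2 <= r ->
  (pow e <~ (fun n => dim (minn (j1 n) (j2 n)))) ->
  ((fun n => dim (minn (j1 n) (j2 n))) <~ pow f) ->
  lesssim (risk (psi_INT g) j1 j2) (npow r).
Proof.
move=> L1 L2 er r1 fr lo hi;
have [K K0 h] := worst_risk_INT_le g_cdv C1 C2 M d_gt0 alpha_gt0 beta_gt0.
apply: lesssim_trans (lesssim_le K0 (fun n => h j1 j2 n L1 L2)) _.
apply: lesssim_add; [apply: lesssim_add|].
- exact: bias_rate lo.
- by rewrite inv_pow; exact: pow_le.
- exact: linear_rate hi.
Qed.

Lemma split_rate (e1 e2 r : R) j1 j2 : e1 - 2 <= r -> e2 - 2 <= r ->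
  ((fun n => dim (j1 n)) <~ pow e1) -> ((fun n => dim (j2 n)) <~ pow e2) ->
  ((fun n => n%:R^-1 ^+ 2 * (dim (j1 n) + dim (j2 n))) <~ pow r).
Proof.
move=> h1 h2 k1 k2.
rewrite (_ : (fun n => _) = fun n => n%:R^-1 ^+ 2 * dim (j1 n) + n%:R^-1 ^+ 2 * dim (j2 n)).
  by apply: lesssim_add; [exact: linear_rate k1|exact: linear_rate k2].
by apply/funext => n; rewrite mulrDr.
Qed.

Lemma risk_MC_rate (e f1 f2 r : R) j1 j2 : levels J0 j1 -> levels J0 j2 ->
  e * (2 * s / D) = - r -> -1 <= r -> f1 - 2 <= r -> f2 - 2 <= r -> f1 + f2 - 3 <= r ->
  (pow e <~ (fun n => dim (minn (j1 n) (j2 n)))) ->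
  ((fun n => dim (j1 n)) <~ pow f1) -> ((fun n => dim (j2 n)) <~ pow f2) ->
  lesssim (risk (psi_MC g) j1 j2) (npow r).
Proof.
move=> L1 L2 er r1 h1 h2 h12 lo k1 k2; have [A A_size] := cdv1_size g_cdv.
have [K K0 h] := worst_risk_MC_le g_cdv A_size C1 C2 M d_gt0 alpha_gt0 beta_gt0.
apply: lesssim_trans (lesssim_le K0 (fun n => h j1 j2 n L1 L2)) _.
apply: lesssim_add; [apply: lesssim_add; [apply: lesssim_add|]|].
- exact: bias_rate lo.
- by rewrite inv_pow; exact: pow_le.
- exact: split_rate k1 k2.
- exact: cubic_rate k1 k2.
Qed.

Lemma risk_IF_rate (e f1 f2 r : R) j1 j2 : levels J0 j1 -> levels J0 j2 ->
  e * (2 * s / D) = - r -> -1 <= r -> f1 - 2 <= r -> f2 - 2 <= r -> f1 + f2 - 3 <= r ->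
  (pow e <~ (fun n => dim (maxn (j1 n) (j2 n)))) ->
  ((fun n => dim (minn (j1 n) (j2 n))) <~ pow f1) ->
  ((fun n => dim (maxn (j1 n) (j2 n))) <~ pow f2) ->
  lesssim (risk (psi_IF g) j1 j2) (npow r).
Proof.
move=> L1 L2 er r1 h1 h2 h12 lo k1 k2; have [A A_size] := cdv1_size g_cdv.
have [K K0 h] := worst_risk_IF_le g_cdv A_size C1 C2 M d_gt0 alpha_gt0 beta_gt0.
apply: lesssim_trans (lesssim_le K0 (fun n => h j1 j2 n L1 L2)) _.
apply: lesssim_add; [apply: lesssim_add; [apply: lesssim_add|]|].
- exact: bias_rate lo.
- by rewrite inv_pow; exact: pow_le.
- rewrite (_ : (fun n => _) = fun n => n%:R^-1 ^+ 2 *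
    (dim (minn (j1 n) (j2 n)) + dim (maxn (j1 n) (j2 n)))).
    exact: split_rate k1 k2.
  by apply/funext => n; case: leqP => _; rewrite // [dim (j1 n) + _]addrC.
- rewrite (_ : (fun n => _) = fun n => n%:R^-1 ^+ 3 *
    (dim (minn (j1 n) (j2 n)) * dim (maxn (j1 n) (j2 n)))).
    exact: cubic_rate k1 k2.
  by apply/funext => n; case: leqP => _; rewrite // [dim (j1 n) * _]mulrC.
Qed.

(** The resolution [n `^ f] balances the bias of the coarser space against the
    product of the two noises, of order [k ^ 2 / n ^ 3]. Below it the bias alone is
    too large. Above it the product is, since [1 < f] in the rough regime: the
    remaining terms are then of smaller order. *)
Lemma risk_MC_lower j1 j2 : levels J0 j1 -> levels J0 j2 ->
  s / 2 < D / 4 -> nondegenerate_class d g J0 alpha beta C1 C2 M ->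
  lesssim (npow (- (3 * s / (s + D)))) (risk (psi_MC g) j1 j2).
Proof.
move=> L1 L2 low nd; have [A A_size] := cdv1_size g_cdv.
have aS : alpha <= S%:R by apply: ltW; apply: le_lt_trans S_gt; rewrite le_max lexx.
have bS : beta <= S%:R by apply: ltW; apply: le_lt_trans S_gt; rewrite le_max lexx orbT.
have [c [K [c0 K0 h]]] :=
  worst_risk_MC_ge g_cdv A_size S_ge1 d_gt0 alpha_gt0 beta_gt0 aS bS nd.
set r := 3 * s / (s + D).
pose f := 3 * D / (2 * (s + D)).
have sD : 0 < s + D by rewrite addr_gt0.
have f1 : 0 < f - 1.
  have -> : f - 1 = (D - 2 * s) / (2 * (s + D)) by rewrite /f; field; lra.
  by rewrite divr_gt0 ?mulr_gt0//; lra.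
have fr : f * (2 * s / D) = r by rewrite /f /r; field; lra.
pose Y := Num.max 1 (4 * K / c).
have Y1 : 1 <= Y by rewrite le_max lexx.
have YK : 4 * K <= c * Y.
  by rewrite [leRHS]mulrC -ler_pdivrMr// le_max lexx orbT.
have [n1 hn1] := pow_unbounded f1 (le_trans ler01 Y1).
exists (2 / c); first exact: divr_gt0.
exists (maxn 1 n1) => n; rewrite geq_max => /andP[n0 nn1].
have [hb hv] := h j1 j2 n L1 L2 n0.
set k := dim (minn _ _) in hb hv; set rk := risk _ _ _ _ in hb hv *.
have nR : 0 < n%:R :> R by rewrite ltr0n.
suff : ((c / 2 * n%:R `^ (- r))%:E <= rk)%E.
  move=> hh; have c2 : (0 <= (2 / c)%:E)%E by rewrite lee_fin divr_ge0// ltW.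
  apply: le_trans (lee_wpmul2l c2 hh); rewrite -EFinM lee_fin.
  by rewrite mulrA (_ : 2 / c * (c / 2) = 1) ?mul1r//; field; lra.
have [kf|fk] := leP k (n%:R `^ f).
  apply: le_trans hb; rewrite lee_fin.
  have c2c : c / 2 <= c by lra.
  apply: ler_pM => //; first by rewrite divr_ge0// ltW.
  rewrite -fr -mulrN powRrM !powRN lef_pV2 ?posrE ?powR_gt0 ?dim_gt0//.
  by apply: ge0_ler_powR; rewrite ?nnegrE ?powR_ge0 ?dim0.
apply: le_trans hv; rewrite lee_fin; set v := n%:R^-1.
have v0 : 0 < v by rewrite invr_gt0.
pose y := v * k; have vy : n%:R `^ (f - 1) <= y.
  rewrite powRD ?pnatr_eq0 -?lt0n ?n0 ?implybT// powR_inv1// mulrC.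
  by rewrite ler_wpM2l// ltW.
have Yy : Y <= y := le_trans (hn1 n nn1) vy.
have kk : k * k <= dim (j1 n) * dim (j2 n).
  rewrite /k dim_min; apply: ler_pM; rewrite ?le_min ?dim0//.
    by rewrite ge_min lexx.
  by rewrite ge_min lexx orbT.
have y2 : y ^+ 2 <= v ^+ 2 * (dim (j1 n) * dim (j2 n)).
  by rewrite /y exprMn [k ^+ 2]expr2 ler_wpM2l// sqr_ge0.
have npow2 : n%:R `^ (- r) = v * (n%:R `^ (f - 1)) ^+ 2.
  have -> : v = n%:R `^ (-1) by rewrite powR_inv1.
  rewrite -powR_mulrn ?powR_ge0// -powRrM -powRD ?pnatr_eq0 -?lt0n ?n0 ?implybT//.
  by congr (_ `^ _); rewrite /f /r; field; lra.
have q0 : 0 <= n%:R `^ (f - 1) :> R by exact: powR_ge0.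
rewrite npow2 mulrCA ler_wpM2l ?(ltW v0)// -/y.
have h1 : (n%:R `^ (f - 1)) ^+ 2 <= y ^+ 2 by rewrite lerXn2r// nnegrE (le_trans q0).
have h2 : K * (1 + y) <= c / 2 * y ^+ 2.
  have e1 : K * (1 + y) <= 2 * K * y by nra.
  have e2 : 4 * K * y <= c * Y * y by rewrite ler_wpM2r//; lra.
  have e3 : c * Y * y <= c * y ^+ 2 by rewrite -mulrA expr2 ler_wpM2l ?(ltW c0)// ler_wpM2r//; lra.
  by lra.
have h3 : c * y ^+ 2 <= c * (v ^+ 2 * (dim (j1 n) * dim (j2 n))) by rewrite ler_wpM2l// ltW.
have h4 : c / 2 * (n%:R `^ (f - 1)) ^+ 2 <= c / 2 * y ^+ 2 by rewrite ler_wpM2l//; lra.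
by lra.
Qed.

End MainTheorem.

Unset Implicit Arguments.

Theorem corollary1 (R : realType) (d S J0 : nat) (g : cdv_generators R)
    (alpha beta C1 C2 M : R)
    (d_gt0 : (0 < d)%N) (S_ge1 : (1 <= S)%N) (J0_ge : (S <= 2 ^ J0)%N)
    (g_cdv : cdv_basis d g S J0)
    (alpha_gt0 : 0 < alpha) (beta_gt0 : 0 < beta) (M_gt0 : 0 < M)
    (S_gt : Num.max alpha beta < S%:R) :
  let risk (est : estimator R d) := worst_risk g J0 alpha beta C1 C2 M est in
  let optimal (est : estimator R d) j1 j2 :=
    lesssim (risk est j1 j2) (minimax_rate d alpha beta) in
  let k := @res R d in
  let n_pow := @npow R in
  let D := d%:R : R in
  (D / 4 <= (alpha + beta) / 2 ->
    let lo := n_pow (D / (2 * alpha + 2 * beta)) in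
    [/\ forall j1 j2, levels J0 j1 -> levels J0 j2 ->
          lesssim lo (mins (k j1) (k j2)) ->
          lesssim (mins (k j1) (k j2)) (n_pow 1) ->
          optimal (psi_INT g) j1 j2,
        forall j1 j2, levels J0 j1 -> levels J0 j2 ->
          lesssim lo (k j1) -> lesssim (k j1) (n_pow 1) ->
          lesssim lo (k j2) -> lesssim (k j2) (n_pow 1) ->
          optimal (psi_MC g) j1 j2 &
        forall j1 j2, levels J0 j1 -> levels J0 j2 ->
          lesssim lo (maxs (k j1) (k j2)) ->
          lesssim (maxs (k j1) (k j2)) (n_pow 1) ->
          optimal (psi_IF g) j1 j2]) /\
  ((alpha + beta) / 2 < D / 4 ->
    let k_opt := n_pow (2 * D / (2 * alpha + 2 * beta + D)) in
    let k_MC := n_pow (3 * D / (2 * alpha + 2 * beta + 2 * D)) in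
    let r_MC := n_pow (- ((3 * alpha + 3 * beta) / (alpha + beta + D))) in
    [/\ forall j1 j2, levels J0 j1 -> levels J0 j2 ->
          asymp (mins (k j1) (k j2)) k_opt ->
          optimal (psi_INT g) j1 j2,
        (nondegenerate_class d g J0 alpha beta C1 C2 M ->
          (forall j1 j2, levels J0 j1 -> levels J0 j2 ->
            ~ optimal (psi_MC g) j1 j2) /\
          best_rate J0 (risk (psi_MC g)) r_MC) /\
        (forall j1 j2, levels J0 j1 -> levels J0 j2 ->
          asymp (k j1) k_MC -> asymp (k j2) k_MC ->
          lesssim (risk (psi_MC g) j1 j2) r_MC) &
        forall j1 j2, levels J0 j1 -> levels J0 j2 ->
          asymp (maxs (k j1) (k j2)) k_opt ->
          lesssim (mins (k j1) (k j2)) (n_pow 1) ->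
          optimal (psi_IF g) j1 j2]).
Proof.
move=> risk optimal k n_pow D.
have D0 : 0 < D by rewrite ltr0n.
have S_pos : 0 < 2 * alpha + 2 * beta by lra.
have rateE j1 j2 : mins (k j1) (k j2) = EFin \o (fun n => dim R d (minn (j1 n) (j2 n))).
  exact: mins_res.
have ratexE j1 j2 : maxs (k j1) (k j2) = EFin \o (fun n => dim R d (maxn (j1 n) (j2 n))).
  exact: maxs_res.
have C2E : 2 * alpha + 2 * beta + D != 0 by rewrite lt0r_neq0//; lra.
have C3E : alpha + beta + D != 0 by rewrite lt0r_neq0//; lra.
split => [high lo|low k_opt k_MC r_MC].
- have optE est j1 j2 : lesssim (risk est j1 j2) (npow (-1)) -> optimal est j1 j2.
    by rewrite /optimal /minimax_rate high.
  have lo_bias : D / (2 * alpha + 2 * beta) * (2 * (alpha + beta) / D) = - -1.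
    by field; lra.
  have N1 : (1 : R) - 2 <= -1 by lra.
  have N3 : (1 : R) + 1 - 3 <= -1 by lra.
  split => j1 j2 L1 L2.
  + rewrite rateE => h1 h2; apply: optE.
    exact: (risk_INT_rate C1 C2 M d_gt0 g_cdv alpha_gt0 beta_gt0 L1 L2 lo_bias (lexx _) N1).
  + move=> h1 h2 h3 h4; apply: optE.
    apply: (risk_MC_rate C1 C2 M d_gt0 g_cdv alpha_gt0 beta_gt0 L1 L2 lo_bias (lexx _) N1 N1 N3) => //.
    by rewrite -rateE; exact: lesssim_min.
  + move=> h1 h2; apply: optE.
    have h3 : lesssim (mins (k j1) (k j2)) (n_pow 1).
      by rewrite ratexE in h2 *; apply: lesssim_trans h2; rewrite -ratexE; exact: dim_min_le_max.
    rewrite ratexE in h1 h2; rewrite rateE in h3.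
    exact: (risk_IF_rate C1 C2 M d_gt0 g_cdv alpha_gt0 beta_gt0 L1 L2 lo_bias (lexx _) N1 N1 N3).
pose rho := (4 * alpha + 4 * beta) / (2 * alpha + 2 * beta + D).
have optE est j1 j2 : optimal est j1 j2 = lesssim (risk est j1 j2) (npow (- rho)).
  by rewrite /optimal /minimax_rate leNgt low.
pose e := 2 * D / (2 * alpha + 2 * beta + D).
have rho1 : rho <= 1 by rewrite ler_pdivrMr; lra.
have e_rho : e - 2 = - rho by rewrite /e /rho; field.
have e_bias : e * (2 * (alpha + beta) / D) = - - rho.
  by rewrite /e /rho; field; rewrite C2E lt0r_neq0.
have rhoN : -1 <= - rho by lra.
have e2 : e - 2 <= - rho by rewrite e_rho.
(* In terms of [q] the inequalities between exponents become linear. *)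
pose q := D / (alpha + beta + D); pose f := 3 * D / (2 * alpha + 2 * beta + 2 * D).
pose r := (3 * alpha + 3 * beta) / (alpha + beta + D).
have q23 : 2 / 3 < q by rewrite ltr_pdivlMr; lra.
have C4E : 2 * alpha + 2 * beta + 2 * D != 0 by rewrite lt0r_neq0//; lra.
have fq : f = 3 / 2 * q by rewrite /f /q; field; rewrite C4E C3E.
have rq : r = 3 * (1 - q) by rewrite /r /q; field.
have f_bias : f * (2 * (alpha + beta) / D) = - - r.
  by rewrite /f /r; field; rewrite C4E C3E lt0r_neq0.
have rN : -1 <= - r by lra.
have f2 : f - 2 <= - r by lra.
have f3 : f + f - 3 <= - r by lra.
have MC j1 j2 : levels J0 j1 -> levels J0 j2 -> asymp (k j1) k_MC -> asymp (k j2) k_MC ->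
    lesssim (risk (psi_MC g) j1 j2) r_MC.
  move=> L1 L2 [h1 h2] [h3 h4].
  apply: (risk_MC_rate C1 C2 M d_gt0 g_cdv alpha_gt0 beta_gt0 L1 L2 f_bias rN f2 f2 f3) => //.
  by rewrite -rateE; exact: lesssim_min.
split => [j1 j2 L1 L2||j1 j2 L1 L2].
- rewrite rateE optE => -[h1 h2].
  exact: (risk_INT_rate C1 C2 M d_gt0 g_cdv alpha_gt0 beta_gt0 L1 L2 e_bias rhoN e2).
- split => // nd.
  have lower j1 j2 (L1 : levels J0 j1) (L2 : levels J0 j2) : lesssim r_MC (risk (psi_MC g) j1 j2).
    have := risk_MC_lower d_gt0 S_ge1 g_cdv alpha_gt0 beta_gt0 S_gt L1 L2 low nd.
    by rewrite /r_MC mulrDr.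
  split=> [j1 j2 L1 L2|].
    rewrite optE => up.
    have : lesssim (npow (- r)) (npow (- rho)) by exact: lesssim_trans (lower _ _ L1 L2) up.
    move=> /pow_order; rewrite lerN2 leNgt => /negP; apply.
    have q1 : q < 1 by rewrite ltr_pdivrMr; lra.
    have rho_q : rho * (2 - q) = 4 * (1 - q) by rewrite /rho /q; field; rewrite C2E C3E.
    (* [r < rho] because [2 / 3 < q], which is the rough regime. *)
    rewrite rq; nra.
  split => //; have f0 : 0 <= f by lra.
  have [j Lj jf] := level_exists d_gt0 J0 f0.
  by exists j, j; split => //; exact: MC.
- rewrite ratexE rateE optE => -[h1 h2] h3.
  apply: (risk_IF_rate C1 C2 M d_gt0 g_cdv alpha_gt0 beta_gt0 L1 L2 e_bias rhoN _ e2 _ h2 h3 h1); lra.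
Qed.
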